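(* Let $p\ge 3$ be a prime and $m=(p-1)/2$. Let $\alpha_1,\alpha_2\in\mathbb{F}_p\setminus\{0\}$ and let $a_1,\dots,a_6,b_5,b_6\in\mathbb{F}_p$ be eight pairwise distinct elements such that $$(a_2-a_4)(a_1-a_6)(a_3-a_5)=(a_2-a_6)(a_1-a_5)(a_3-a_4),$$ $$(a_2-a_4)(a_1-b_6)(a_3-b_5)=(a_2-b_6)(a_1-b_5)(a_3-a_4),$$ and such that both $(a_1-a_2)(a_2-a_4)(a_4-a_5)(a_5-a_1)$ and $(a_1-a_2)(a_2-a_4)(a_4-b_5)(b_5-a_1)$ are squares in $\mathbb{F}_p^*$. Let $C$ be the non-singular projective model of the fibre product $C_1\times_{\mathbf{P}^1}C_2$ (taken with respect to the $x$-coordinate maps) of the genus $2$ curves $$C_1\colon y_1^2=\alpha_1(x-a_1)(x-a_2)(x-a_3)(x-a_4)(x-a_5)(x-a_6),$$ $$C_2\colon y_2^2=\alpha_2(x-a_1)(x-a_2)(x-a_3)(x-a_4)(x-b_5)(x-b_6),$$ and let $\theta_i,\lambda_i\in\mathbb{F}_p$ $(1\le i\le 5)$ and $H_p$ be as defined in the context. Then: (i) If $p\ge 17$, the curve $C$ over $\mathbb{F}_p$ attains the Serre bound if and only if $$(-\theta_i)^mH_p(\lambda_i)\equiv-\lfloor 2\sqrt{p}\rfloor \mod p\qquad\text{for } 1\le i\le 5.$$ (ii) The curve $C$ over $\mathbb{F}_{p^2}$ is maximal if and only if $$H_p(\lambda_i)\equiv 0\mod p\qquad\text{for }1\le i\le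 5.$$ Further, if $C$ over $\mathbb{F}_{p^2}$ is maximal, then $p\equiv 3\mod 4$. (iii) Let $p\ge 11$, and let $h_i$ be the integer such that $h_i\equiv(-\theta_i)^mH_p(\lambda_i)\mod p$ and $0\le h_i<p$. The curve $C$ over $\mathbb{F}_{p^3}$ attains the Serre bound if and only if $$h_i^3-3ph_i=-\lfloor 2p\sqrt{p}\rfloor\qquad\text{for }1\le i\le 5.$$ (iv) For every power $q$ of $p$, the number of $\mathbb{F}_q$-rational points of $C$ satisfies $\#C(\mathbb{F}_q)\equiv 0\mod 4$.
   Context: A curve is a projective, absolutely irreducible, non-singular algebraic curve; an affine equation denotes its non-singular projective model. The curve $C$ has genus $5$. A curve $X$ of genus $g$ over $\mathbb{F}_q$ is said to attain the Serre bound if $\#X(\mathbb{F}_q)=q+1+g\lfloor 2\sqrt{q}\rfloor$, and to be maximal if $\#X(\mathbb{F}_q)=q+1+2g\sqrt{q}$. The polynomial $H_p$ is $H_p(t)=\sum_{i=0}^m\binom{m}{i}^2t^i$ with $m=(p-1)/2$. Congruences modulo $p$ between elements of $\mathbb{F}_p$ and integers mean equality in $\mathbb{F}_p$ after reducing the integers mod $p$. Notation: put $$a=\frac{(a_1-a_3)(a_2-a_4)}{(a_2-a_3)(a_1-a_4)},\quad b=\frac{(a_1-a_3)(a_2-a_5)}{(a_2-a_3)(a_1-a_5)},\quad c=\frac{(a_1-a_3)(a_2-b_5)}{(a_2-a_3)(a_1-b_5)},$$ $$\beta_1=\alpha_1(a_2-a_3)(a_1-a_4)(a_1-a_5)(a_1-a_6),\quad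 \beta_2=\alpha_2(a_2-a_3)(a_1-a_4)(a_1-b_5)(a_1-b_6).$$ The assumption on squares implies that $a^2-ab$ and $a^2-ac$ are squares in $\mathbb{F}_p^*$; $(a^2-ab)^{1/2}$ and $(a^2-ac)^{1/2}$ denote fixed square roots in $\mathbb{F}_p$. Define $$\theta_1=\theta_2=\frac{\beta_1(1-b)}{1-a},\qquad \lambda_1,\lambda_2=\frac{(1-a)\big(b-2a\pm2(a^2-ab)^{1/2}\big)}{b-1}$$ (sign $+$ for $\lambda_1$, $-$ for $\lambda_2$), $$\theta_3=\theta_4=\frac{\beta_2(1-c)}{1-a},\qquad \lambda_3,\lambda_4=\frac{(1-a)\big(c-2a\pm2(a^2-ac)^{1/2}\big)}{c-1}$$ (sign $+$ for $\lambda_3$, $-$ for $\lambda_4$), $$\theta_5=\alpha_1\alpha_2(a_5-b_6)(a_6-b_5),\qquad \lambda_5=\frac{(a_5-b_5)(a_6-b_6)}{(a_5-b_6)(a_6-b_5)}.$$ *)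

(* Defs.v *)
From HB Require Import structures.
From mathcomp Require Import all_boot all_order all_algebra all_field.
From mathcomp Require Import generic_quotient fraction.
From mathcomp Require Import boolp classical_sets functions cardinality.

Set Implicit Arguments.
Unset Strict Implicit.
Unset Printing Implicit Defensive.

Import Order.TTheory GRing.Theory Num.Theory.
Local Open Scope ring_scope.

(* A non-singular projective curve over F is given by its function field K,
   with embedding cst of the constants: its closed points are the places of
   K / F, i.e. the valuation rings F <= O < K, and the residue field of a point
   is that of its valuation ring. *)

Definition valuation_ring (F K : fieldType) (cst : {rmorphism F -> K})
    (O : {pred K}) : Prop :=
  [/\ subring_closed O,
      forall c : F, cst c \in O,
      exists z : K, z \notin O &
      forall z : K, z != 0 -> (z \in O) || (z^-1 \in O)].

Definition max_ideal (K : fieldType) (O : {pred K}) : {pred K} :=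
  [pred z | (z == 0) || (z^-1 \notin O)].

(* The F-rational points are the places with residue field F: every element of
   O is congruent to a constant modulo the maximal ideal. *)
Definition rational_points (F K : fieldType) (cst : {rmorphism F -> K}) :
    set (K -> bool) :=
  [set O : K -> bool | valuation_ring cst O /\
           forall z : K, O z -> exists c : F, z - cst c \in max_ideal O].

Definition num_points (F K : fieldType) (cst : {rmorphism F -> K})
    (N : nat) : Prop :=
  (rational_points cst #= `I_N)%card.

(* In the next two definitions g is the genus of the curve. *)

Definition attains_Serre_bound (g : nat) (F : finFieldType) (K : fieldType)
    (cst : {rmorphism F -> K}) : Prop :=
  exists2 N : nat, num_points cst N &
    N%:Z = #|F|%:Z + 1 + g%:Z * Num.floor (2 * sqrtC #|F|%:R : algC).

Definition maximal_curve (g : nat) (F : finFieldType) (K : fieldType)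
    (cst : {rmorphism F -> K}) : Prop :=
  exists2 N : nat, num_points cst N &
    N%:R = #|F|%:R + 1 + 2 * g%:R * sqrtC #|F|%:R :> algC.

(* The non-singular projective model, over F, of the fibre product over the
   x-line of y1 ^ 2 = f1(x) and y2 ^ 2 = f2(x): its function field is
   F(x, y1, y2) with x transcendental over F.  When f1, f2 and f1 * f2 are
   non-squares in F(x), such a field exists, has degree 4 over F(x), and is
   unique up to isomorphism. *)
Record fibre_product (F : fieldType) (f1 f2 : {poly F}) := FibreProduct {
  function_field : fieldType;
  constants : {rmorphism F -> function_field};
  coord_x : function_field;
  coord_y1 : function_field;
  coord_y2 : function_field;
  _ : ~ algebraicOver constants coord_x;
  _ : coord_y1 ^+ 2 = (map_poly constants f1).[coord_x];
  _ : coord_y2 ^+ 2 = (map_poly constants f2).[coord_x];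
  _ : forall S : {pred function_field}, divring_closed S ->
        (forall c : F, constants c \in S) ->
        coord_x \in S -> coord_y1 \in S -> coord_y2 \in S ->
        forall z : function_field, z \in S
}.

Definition H_poly (p : nat) : {poly 'F_p} :=
  \sum_(i < (p.-1./2).+1) ('C(p.-1./2, i) ^ 2)%:R *: 'X^i.

(* Existence of the fibre product, so that quantifying over its models is
   never vacuous. *)

Local Open Scope quotient_scope.

Lemma fracE (R : idomainType) (z : {fraction R}) : exists n d : R, z = tofrac n / tofrac d.
Proof.
elim/quotW: z => r; exists (\n_r), (\d_r).
have dn := denom_ratioP r.
apply: (canRL (mulfK _)); first by rewrite tofrac_eq0.
unlock tofrac; rewrite -[LHS]FracField.pi_mul; apply/eqP; rewrite FracField.equivf_def /FracField.mulf.
by rewrite !numden_Ratio ?(oner_neq0, mulr1, mul1r) // mulrC.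
Qed.

Lemma sqrt_ext (Q : fieldType) (d : Q) :
 exists (K : fieldType) (j : {rmorphism Q -> K}) (y : K),
    y ^+ 2 = j d /\
    forall S : {pred K}, divring_closed S -> (forall q, j q \in S) ->
      y \in S -> forall z, z \in S.
Proof.
have sp : size ('X^2 - d%:P) = 3 by rewrite size_XnsubC.
have [r|nr] := pselect (exists r, root ('X^2 - d%:P) r).
  case: r => r; rewrite rootE !hornerE subr_eq0 => /eqP rd.
  exists Q, idfun, r; split=> [|S _ h _ z]; [by rewrite /= -rd expr2|exact: h z].
have irr : irreducible_poly ('X^2 - d%:P).
  apply: cubic_irreducible; first by rewrite sp.
  by move=> x; apply/negP => hx; apply: nr; exists x.
have [L _ [z rz gz]] := irredp_FAdjoin irr.
exists L, (in_alg L), z; split.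
  move: rz; rewrite rootE rmorphB /= map_polyXn map_polyC /= !hornerE subr_eq0 => /eqP; by rewrite expr2.
move=> S Sc hS zS v.
have: v \in <<1; z>>%VS by rewrite gz memvf.
case/Fadjoin_polyP => q /polyOverP hq ->.
have [S1 SB SD] := Sc.
have S0 : 0 \in S by rewrite -(subrr 1) SB.
have SN u : u \in S -> - u \in S by move=> ?; rewrite -sub0r; exact: SB.
have SA u w : u \in S -> w \in S -> u + w \in S by move=> ? ?; rewrite -[w]opprK; apply: SB => //; apply: SN.
have SV u : u \in S -> u^-1 \in S by move=> ?; rewrite -div1r; apply: SD.
have SM u w : u \in S -> w \in S -> u * w \in S by move=> ? ?; rewrite -[w]invrK; apply: SD => //; apply: SV.
rewrite horner_coef; elim/big_ind: _ => [|v1 v2|i _]; [exact: S0|exact: SA|].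
apply: (SM); first by case/vlineP: (hq i) => k ->; apply: hS.
by elim: (i : nat) => [|n IH]; rewrite ?expr0 ?exprS //; exact: SM.
Qed.

Lemma fibre_product_exists (F : fieldType) (f1 f2 : {poly F}) : inhabited (fibre_product f1 f2).
Proof.
pose Q := {fraction {poly F}}.
pose t : {rmorphism {poly F} -> Q} := [the {rmorphism _ -> _} of @tofrac {poly F}].
have [K1 [j1 [y1 [h1 g1]]]] := @sqrt_ext Q (t f1).
have [K2 [j2 [y2 [h2 g2]]]] := @sqrt_ext K1 (j1 (t f2)).
pose u : {rmorphism {poly F} -> K2} := [the {rmorphism _ -> _} of j2 \o (j1 \o t)].
pose cst : {rmorphism F -> K2} := [the {rmorphism _ -> _} of u \o polyC].
have ev f : (map_poly cst f).[u 'X] = u f.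
  rewrite map_poly_comp horner_map /=; congr (j2 (j1 (t _))).
  exact: comp_polyXr.
constructor; apply: (@FibreProduct F f1 f2 K2 cst (u 'X) (j2 y1) y2).
- case=> p p0; rewrite rootE ev /u /= !fmorph_eq0 tofrac_eq0; exact/negP.
- by rewrite ev -rmorphXn h1.
- by rewrite ev h2.
move=> S Sc hc hx hy1 hy2; apply: g2 => //.
suff hh : forall q, q \in [pred a | j2 a \in S] by move=> q; exact: hh.
have [S1 SB SD] := Sc.
have Sc' : divring_closed [pred a | j2 a \in S].
  split=> [|a b|a b]; rewrite !inE ?rmorph1 // ?rmorphB ?fmorph_div; [exact: SB|exact: SD].
apply: g1 => // q; rewrite inE.
have S0 : 0 \in S by rewrite -(subrr 1) SB.
have SN v : v \in S -> - v \in S by move=> ?; rewrite -sub0r; exact: SB.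
have SA v w : v \in S -> w \in S -> v + w \in S by move=> ? ?; rewrite -[w]opprK; apply: SB => //; apply: SN.
have SV v : v \in S -> v^-1 \in S by move=> ?; rewrite -div1r; apply: SD.
have SM v w : v \in S -> w \in S -> v * w \in S by move=> ? ?; rewrite -[w]invrK; apply: SD => //; apply: SV.
have Su p : u p \in S.
  elim/poly_ind: p => [|p c IH]; first by rewrite rmorph0.
  rewrite rmorphD rmorphM; apply: SA; [exact: SM|exact: hc].
have [n [d ->]] := fracE q.
rewrite !fmorph_div; apply: SD; exact: Su.
Qed.

(* Main.v *)
Require Import Defs.
From HB Require Import structures.
From mathcomp Require Import all_boot all_order all_algebra all_field.
From mathcomp Require Import zify ring.

(* Places of the function field over a point of the projective line are determined by
   residues of y1 and y2 (or of y2 / y1 at a common branch point), so the points of C over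
   F_q number q + 1 plus the complete quadratic character sums of f1, f2 and of the quartic
   dividing f1 f2 up to squares.  The quartic is a Legendre curve after a Moebius map.
   The relation between the branch points gives each genus 2 curve an extra involution,
   defined over F_p by the assumption on squares, so each sextic sum is a sum of two Legendre
   sums; altogether #C(F_q) = q + 1 + T_1 + ... + T_5 with T_i the character sum of
   theta_i x (x - 1) (x - lambda_i).

   Euler's criterion and the coefficient of x^(p-1) in (theta x (x - 1) (x - lambda))^m give
   T_i = - (-theta_i)^m H_p(lambda_i) mod p.  The Hasse bound T_i^2 <= 4 p is proved as by
   Manin: the points Frobenius + n on the twisted Legendre curve over F_p(x) have heights
   n^2 +- T_i n + p, which is a quadratic form that cannot be negative.  Over F_(p^2) and
   F_(p^3) the sums become 2 p - T^2 and T^3 - 3 p T, because the character sums over monic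
   polynomials of degree 2 and 3 are p and 0.  The equality cases of the resulting bounds are
   (i)-(iii), and (iv) holds as q + 1 + T counts points of a curve with full 2-torsion. *)

Set Implicit Arguments.
Unset Strict Implicit.
Unset Printing Implicit Defensive.

Import Order.TTheory GRing.Theory Num.Theory.
Local Open Scope ring_scope.

(** * The quadratic character of a finite field *)

(** No group law is formalised. Manin's argument needs only [x]-coordinates, and going from P - Q
    and P to P + Q exchanges the two roots of a quadratic. The work lies in keeping these fractions
    in lowest terms, since otherwise degrees are not heights. The bound is needed over the prime
    field alone: over [F_(p^2)] and [F_(p^3)] the new traces are polynomials in the old one, and
    these polynomials come from counting monic polynomials by their roots, in place of the
    rationality of a zeta function. Places are treated one quadratic extension at a time, through
    [F(x)], [F(x, y1)], [K]; the points at infinity are the points over 0 for the coordinate [1/x].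
    Eight distinct elements force [p >= 8], so the Hasse bound is always available. The constant 17
    makes [4 sqrt p < p], so that congruent traces are equal. In the cubic case a wrong
    representative modulo [p] satisfies the size estimates only up to [p = 13], and from 11 on a
    finite check excludes it. *)

Section QuadraticCharacter.
Variable F : finFieldType.

(** Defined by counting square roots, so that [1 + qchar u] is a point count from the start; Euler's
    criterion then yields multiplicativity. *)
Definition qchar (x : F) : int := #|[set r : F | r ^+ 2 == x]|%:Z - 1.

Lemma card_sqrt x : #|[set r : F | r ^+ 2 == x]|%:Z = 1 + qchar x.
Proof. by rewrite /qchar; ring. Qed.

Lemma qchar0 : qchar 0 = 0.
Proof.
rewrite /qchar (_ : [set _ | _] = [set 0]) ?cards1 //.
by apply/setP => r; rewrite !inE sqrf_eq0.
Qed.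

Hypothesis oddF : odd #|F|.

Lemma odd_card_two_neq0 : 2 != 0 :> F.
Proof.
apply/negP => h2; have pF : 2 \in [pchar F] by rewrite inE.
move: oddF (card_pprimeChar pF); rewrite -[#|F|]/#|pPrimeCharType pF| => + E.
rewrite E oddX orbF => /eqP l0; move: E (finNzRing_gt1 F).
by rewrite l0 -[#|pPrimeCharType pF|]/#|F| => ->.
Qed.

Let h := #|F|.-1./2.

Lemma card_odd : #|F| = h.*2.+1.
Proof. by rewrite /h; have := finNzRing_gt1 F; have := oddF; lia. Qed.

Lemma card_sqrt_sqr r : r != 0 -> #|[set s : F | s ^+ 2 == r ^+ 2]| = 2%N.
Proof.
move=> r0; rewrite (_ : [set _ | _] = [set r; - r]).
  rewrite cards2 -addr_eq0 -mulr2n -mulr_natl mulf_eq0 negb_or.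
  by rewrite odd_card_two_neq0 r0.
by apply/setP => s; rewrite !inE eqf_sqr.
Qed.

Lemma qchar_sqr r : r != 0 -> qchar (r ^+ 2) = 1.
Proof. by move=> r0; rewrite /qchar card_sqrt_sqr. Qed.

Lemma qchar_nonsquare x : (forall r, r ^+ 2 != x) -> qchar x = -1.
Proof.
move=> hx; rewrite /qchar (_ : [set _ | _] = set0) ?cards0 //.
by apply/setP => s; rewrite !inE; apply/negbTE.
Qed.

Lemma expf_unit_card (r : F) : r != 0 -> r ^+ h.*2 = 1.
Proof. by move=> r0; apply: (mulfI r0); rewrite -exprS -card_odd expf_card mulr1. Qed.

Lemma card_squares : #|[set x : F | (x != 0) && [exists r, r ^+ 2 == x]]| = h.
Proof.
set A := [set x | _].
have E : (#|[set r : F | r != 0%R]| = \sum_(x in A) 2)%N.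
  rewrite -sum1_card (partition_big (fun r => r ^+ 2) (mem A)) /=; last first.
    by move=> r; rewrite !inE sqrf_eq0 => ->; apply/existsP; exists r.
  apply: eq_bigr => x; rewrite !inE => /andP[x0 /existsP[r /eqP hr]].
  have r0 : r != 0 by rewrite -sqrf_eq0 hr.
  transitivity #|[set s : F | s ^+ 2 == r ^+ 2]|; last exact: card_sqrt_sqr.
  rewrite -sum1_card; apply: eq_bigl => s.
  by rewrite !inE hr andb_idl // => /eqP hs; rewrite -sqrf_eq0 hs.
have := cardsC1 (0 : F); rewrite (_ : [set~ 0] = [set r : F | r != 0]).
  by rewrite E sum_nat_const /h => E2; rewrite -E2; lia.
by apply/setP => r; rewrite !inE.
Qed.

(** The nonzero squares already supply [h] roots of [X^h - 1]; a non-square with [x^h = 1] would be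
    one root too many, and the only other square root of 1 is -1. *)
Lemma euler_criterion x : (qchar x)%:~R = x ^+ h.
Proof.
have h0 : (0 < h)%N.
  by rewrite lt0n; apply/eqP => h0; have := finNzRing_gt1 F; rewrite -[#|_|]/#|F| card_odd h0.
have [->|x0] := eqVneq x 0; first by rewrite qchar0 expr0n eqn0Ngt h0.
have [/existsP[r /eqP <-]|] := boolP [exists r, r ^+ 2 == x].
  have [->|r0] := eqVneq r 0; first by rewrite expr0n qchar0 expr0n eqn0Ngt h0.
  by rewrite qchar_sqr // -exprM mul2n expf_unit_card.
move=> /existsPn nx; rewrite qchar_nonsquare // rmorphN1.
have : (x ^+ h) ^+ 2 = 1 by rewrite -exprM muln2 expf_unit_card.
move/eqP; rewrite sqrf_eq1 => /orP[/eqP xh|/eqP //].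
have p0 : 'X^h - 1 != 0 :> {poly F} by rewrite -size_poly_gt0 size_XnsubC.
set A := [set y : F | (y != 0) && [exists r, r ^+ 2 == y]].
have := @max_poly_roots _ _ (x :: enum A) p0; rewrite size_XnsubC // /= -cardE card_squares ltnn.
move=> H; suff: false by []; apply: H; last first.
  rewrite enum_uniq andbT mem_enum inE negb_and; apply/orP; right.
  by apply/existsPn.
rewrite rootE !hornerE xh subrr eqxx /=.
apply/allP => y; rewrite mem_enum inE => /andP[y0 /existsP[r /eqP hr]].
rewrite rootE !hornerE -hr -exprM mul2n expf_unit_card ?subrr //.
by apply: contraNneq y0 => r0; rewrite -hr r0 expr0n.
Qed.

Lemma qchar_values x : x != 0 -> qchar x = 1 \/ qchar x = -1.
Proof.
move=> x0; have [/existsP[r /eqP hr]|] := boolP [exists r, r ^+ 2 == x].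
  left; rewrite -hr qchar_sqr //; by apply: contraNneq x0 => r0; rewrite -hr r0 expr0n.
by move/existsPn => nx; right; apply: qchar_nonsquare.
Qed.

(** Two of the values 0, 1, -1 differ by at most 2, and 2 is invertible. Identities of characters
    can therefore be checked in [F], where they become identities of powers. *)
Lemma qchar_int_inj x (e : int) : e \in [:: 0; 1; -1] -> (qchar x)%:~R = e%:~R :> F -> qchar x = e.
Proof.
move=> he hx; have hd : (qchar x - e)%:~R = 0 :> F by rewrite rmorphB /= hx subrr.
have hq : [\/ qchar x = 0, qchar x = 1 | qchar x = -1].
  have [->|x0] := eqVneq x 0; first by rewrite qchar0; apply: Or31.
  by case: (qchar_values x0) => ->; [apply: Or32|apply: Or33].
have h2 := odd_card_two_neq0; have h1 := oner_neq0 F.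
have hd' : qchar x - e = 0 \/ qchar x - e = 1 \/ qchar x - e = -1 \/ qchar x - e = 2 \/ qchar x - e = -2.
  by move: he; rewrite !inE => /or3P[] /eqP ->; case: hq => ->; lia.
move: hd; case: hd' => [|[|[|[]]]] E; rewrite E ?rmorphN /= => /eqP.
- by move=> _; apply/eqP; rewrite -subr_eq0 E.
- by rewrite (negbTE h1).
- by rewrite oppr_eq0 (negbTE h1).
- by rewrite (negbTE h2).
by rewrite oppr_eq0 (negbTE h2).
Qed.

Lemma qcharM : {morph qchar : x y / x * y}.
Proof.
move=> x y; apply: qchar_int_inj; last first.
  by rewrite intrM !euler_criterion exprMn.
have [->|x0] := eqVneq x 0; first by rewrite qchar0 mul0r inE.
have [->|y0] := eqVneq y 0; first by rewrite qchar0 mulr0 inE.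
by case: (qchar_values x0) => ->; case: (qchar_values y0) => ->.
Qed.

Lemma qcharMsqr x r : r != 0 -> qchar (x * r ^+ 2) = qchar x.
Proof. by move=> r0; rewrite qcharM qchar_sqr // mulr1. Qed.

Lemma qchar1 : qchar 1 = 1.
Proof. by rewrite -(expr1n _ 2) qchar_sqr ?oner_neq0. Qed.

Lemma qchar_mulxx x : qchar x * qchar x = (x != 0)%:Z.
Proof.
have [->|x0] := eqVneq x 0; first by rewrite qchar0.
by case: (qchar_values x0) => ->.
Qed.

Lemma sum_qchar : \sum_x qchar x = 0.
Proof.
rewrite /qchar big_split /= sumr_const -(@rmorph_sum _ _ Posz) /=.
rewrite (_ : (\sum_x _)%N = #|F|); first by rewrite mulNrn natz subrr.
rewrite -sum1_card [RHS](partition_big (fun r : F => r ^+ 2) predT) //=.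
by apply: eq_bigr => x _; rewrite -sum1_card; apply: eq_bigl => r; rewrite inE.
Qed.

Lemma sum_qchar_affine (a b : F) : a != 0 -> \sum_x qchar (a * x + b) = 0.
Proof.
move=> a0; rewrite -[RHS]sum_qchar [RHS](reindex_inj (h := fun x => a * x + b)) //.
by move=> x y /addIr /(mulfI a0).
Qed.

Lemma sum_sqr_comp (G : F -> int) : \sum_x G (x ^+ 2) = \sum_x (1 + qchar x) * G x.
Proof.
rewrite (partition_big (fun r : F => r ^+ 2) predT) //=.
apply: eq_bigr => x _; rewrite -card_sqrt.
rewrite (eq_bigr (fun=> G x)); last by move=> r /eqP ->.
by rewrite sumr_const -natz mulr_natl; congr (_ *+ _); apply: eq_card => r; rewrite !inE.
Qed.

Lemma sum_qchar_quadratic (a r r' : F) :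
  \sum_x qchar (a * ((x - r) * (x - r'))) = qchar a * ((r == r')%:Z * #|F|%:Z - 1).
Proof.
transitivity (qchar a * \sum_x qchar ((x + (r' - r)) * x)).
  rewrite mulr_sumr (reindex_inj (addIr r')) /=; apply: eq_bigr => x _.
  by rewrite -qcharM; congr (qchar (_ * (_ * _))); ring.
congr (_ * _); rewrite (bigD1 0) //= mulr0 qchar0 add0r.
have [<-|d] := eqVneq r r'.
  rewrite (eq_bigr (fun=> 1)) => [|x x0]; last by rewrite subrr addr0 -expr2 qchar_sqr.
  rewrite sumr_const (_ : #|_| = #|F|.-1); first by rewrite natz card_odd /=; lia.
  by have <- := cardsC1 (0 : F); apply: eq_card => x; rewrite !inE.
have d0 : r' - r != 0 by rewrite subr_eq0 eq_sym.
have /eqP := sum_qchar_affine 1 d0; rewrite (bigD1 0) //= mulr0 add0r qchar1 addrC addr_eq0 => /eqP E.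
(* For [x != 0] one has [(x + d) x = x^2 (1 + d / x)]; inverting [x] leaves a complete affine sum,
   which is 0, without its term [qchar 1] at 0. *)
rewrite mul0r add0r -E [RHS](reindex_inj (h := GRing.inv)) /=; last exact: invr_inj.
apply: eq_big => [x|x x0]; first by rewrite invr_eq0.
rewrite -(@qcharMsqr (_ + 1) x) //; congr qchar; field.
exact: x0.
Qed.
End QuadraticCharacter.

(** * The Hasse bound for the Legendre curve *)

Section VietaJumping.
Variable R : comUnitRingType.
Variables (t l : R).

(* [biquad x z x' z' = 0] relates the x-coordinates [x/z] and [x'/z'] of [P] and [P + Q]
   on a twist of [y^2 = x(x-1)(x-l)], where [Q] has x-coordinate [t].  The two roots
   [x/z] for given [x'/z'] are those of [P] and [P + 2Q]. *)
Definition biquad (x z x' z' : R) : R :=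
  (x' - t * z') ^+ 2 * x ^+ 2
  - ((t * x' - l * z') ^+ 2 + (x' - t * z') ^+ 2 - (t * x' - x' - t * z' + l * z') ^+ 2) * x * z
  + (t * x' - l * z') ^+ 2 * z ^+ 2.

Lemma biquadC x z x' z' : biquad x z x' z' = biquad x' z' x z.
Proof. by rewrite /biquad; ring. Qed.

(** In the fourth power of the relation every monomial of degree 4 in the three generators contains
    one of them squared; the witnesses collect these monomials. *)
Lemma unimodular_sqr (x a y c z e : R) : x * a + y * c + z * e = 1 ->
  exists r s w, r * a ^+ 2 + s * c ^+ 2 + w * e ^+ 2 = 1.
Proof.
move=> h; pose v := y * c + z * e.
exists (x ^+ 2 * ((x * a) ^+ 2 + 4 * x * a * v + 6 * v ^+ 2)).
exists ((y ^+ 3 * c + 3 * y ^+ 2 * z * e) * (4 * x * a + v)).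
exists ((3 * y * c * z ^+ 2 + z ^+ 3 * e) * (4 * x * a + v)).
transitivity ((x * a + y * c + z * e) ^+ 4); last by rewrite h expr1n.
by rewrite /v; ring.
Qed.

(** The three linear forms generate the unit ideal: eliminating [x'] from them leaves
    [2 l (l - 1) z'], and [x'] is then recovered from [x' - t z']. *)
Lemma biquad_coprime (k x' z' : R) : k * (2 * l * (l - 1)) = 1 ->
  (exists u v, u * x' + v * z' = 1) ->
  exists r s w, r * (t * x' - l * z') ^+ 2 + s * (x' - t * z') ^+ 2
     + w * (t * x' - x' - t * z' + l * z') ^+ 2 = 1.
Proof.
move=> hk [u [v huv]].
pose a := t * x' - l * z'; pose c := x' - t * z'; pose e := t * x' - x' - t * z' + l * z'.
have hz : z' = k * (2 * (a - t * c) - (t + l) * (a - e - c)).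
  transitivity (k * (2 * l * (l - 1)) * z'); first by rewrite hk mul1r.
  by rewrite /a /c /e; ring.
pose w := k * (u * t + v).
apply: (@unimodular_sqr (w * (2 - (t + l))) _ (u + w * (t + l - 2 * t)) _ (w * (t + l))).
transitivity (u * c + (u * t + v) * z'); last by rewrite -huv /c; ring.
by rewrite [in RHS]hz -/a -/c -/e /w; ring.
Qed.

(** This is Gauss's lemma made explicit: [C X^2 - B X Z + A Z^2 = (z X - x Z)(U X - V Z)]. The
    cofactors come from multiplying each coefficient by [(u x + v z)^2 = 1], so no unique
    factorisation is used. *)
Lemma factor_form (A B C x z : R) : (exists u v, u * x + v * z = 1) ->
  C * x ^+ 2 - B * x * z + A * z ^+ 2 = 0 ->
  exists U V, [/\ C = z * U, A = x * V & B = x * U + z * V].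
Proof.
move=> [u [v huv]] h.
pose U := u ^+ 2 * (B * x - A * z) + 2 * u * v * x * C + v ^+ 2 * z * C.
pose V := v ^+ 2 * (B * z - C * x) + 2 * u * v * z * A + u ^+ 2 * x * A.
have h' : C * x ^+ 2 = B * x * z - A * z ^+ 2 by rewrite -[LHS]subr0 -h; ring.
have h1 : (u * x + v * z) ^+ 2 = 1 by rewrite huv expr1n.
have hE : (C * x ^+ 2 - B * x * z + A * z ^+ 2) = 0 by [].
exists U, V; split.
- transitivity (C * (u * x + v * z) ^+ 2); first by rewrite h1 mulr1.
  by rewrite -[RHS]addr0 -(mulr0 (u ^+ 2)) -hE /U; ring.
- transitivity (A * (u * x + v * z) ^+ 2); first by rewrite h1 mulr1.
  by rewrite -[RHS]addr0 -(mulr0 (v ^+ 2)) -hE /V; ring.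
transitivity (B * (u * x + v * z) ^+ 2); first by rewrite h1 mulr1.
by rewrite -[RHS]addr0 -(mulr0 (- (2 * u * v))) -hE /U /V; ring.
Qed.

Lemma vieta_jump (k x z x' z' : R) : k * (2 * l * (l - 1)) = 1 ->
  (exists u v, u * x + v * z = 1) -> (exists u v, u * x' + v * z' = 1) ->
  biquad x z x' z' = 0 ->
  exists x2 z2, [/\ exists u v, u * x2 + v * z2 = 1,
    biquad x' z' x2 z2 = 0,
    x * x2 = (t * x' - l * z') ^+ 2, z * z2 = (x' - t * z') ^+ 2 &
    x * z2 + z * x2 = (t * x' - l * z') ^+ 2 + (x' - t * z') ^+ 2
       - (t * x' - x' - t * z' + l * z') ^+ 2].
Proof.
move=> hk c0 c1 h0; have [U [V [hC hA hB]]] := factor_form c0 h0.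
have [r [s [w hrsw]]] := biquad_coprime hk c1.
exists V, U; split=> //.
(* The three squares are [x V], [z U] and [(x - z)(V - U)], so their Bezout relation is already one
   between [V] and [U]. *)
- exists (r * x + w * (x - z)), (s * z + w * (z - x)).
  rewrite -hrsw hA hC.
  have -> : (t * x' - x' - t * z' + l * z') ^+ 2 = x * V + z * U - (x * U + z * V).
    by rewrite -hA -hC -hB; ring.
  ring.
- by rewrite biquadC /biquad hA hC in hB *; rewrite hB; ring.
Qed.
End VietaJumping.

(** * Heights of fractions of polynomials along the orbit *)

Section Heights.
Variable F : fieldType.
Implicit Types p q : {poly F}.
Local Notation ht p q := (maxn (size p) (size q)).

Lemma size_mul_le_pred p q m n : (size p <= m)%N -> (size q <= n)%N ->
  (size (p * q)%R <= (m + n).-1)%N.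
Proof. by move=> hm hn; have := size_polyMleq p q; lia. Qed.

Let size_mulF p q : p != 0 -> q != 0 -> size (p * q) = (size p + size q).-1.
Proof. exact: size_mul. Qed.
Let size_mul_leqF p q : (size (p * q)%R <= (size p + size q).-1)%N.
Proof. exact: size_polyMleq. Qed.
Let size_addlF p q : (size q < size p)%N -> size (p + q) = size p.
Proof. exact: size_polyDl. Qed.
Let size_gt0F p : (0 < size p)%N = (p != 0).
Proof. exact: size_poly_gt0. Qed.

Lemma size_add_le p q n : (size p <= n)%N -> (size q <= n)%N -> (size (p + q)%R <= n)%N.
Proof. by move=> hp hq; apply: leq_trans (size_polyD _ _) _; rewrite geq_max hp hq. Qed.

(** Gauss's lemma for the degree valuation: when the dominant entries of the two fractions lie in
    opposite slots, the middle coefficient has an uncancelled leading term; otherwise an outer one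
    is the product of the dominant entries. Sizes are degrees plus one, whence the predecessor. *)
Lemma ht_prod (x z x2 z2 : {poly F}) : (0 < ht x z)%N -> (0 < ht x2 z2)%N ->
  maxn (ht (x * x2) (z * z2)) (size (x * z2 + z * x2)) = (ht x z + ht x2 z2).-1.
Proof.
move=> h h2; apply/eqP; rewrite eqn_leq; apply/andP; split.
  rewrite !geq_max !size_mul_le_pred ?leq_max ?leqnn ?orbT //=.
  by rewrite size_add_le // size_mul_le_pred // ?leq_max ?leqnn ?orbT.
have [xz|xz] := leqP (size z) (size x); have [xz2|xz2] := leqP (size z2) (size x2).
- have x0 : x != 0 by rewrite -size_gt0F; lia.
  have x20 : x2 != 0 by rewrite -size_gt0F; lia.
  by apply: leq_trans (leq_maxl _ _); apply: leq_trans (leq_maxl _ _); rewrite size_mulF //; lia.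
- have x0 : x != 0 by rewrite -size_gt0F; lia.
  have x20 : z2 != 0 by rewrite -size_gt0F; lia.
  have x0p := x0; rewrite -size_gt0F in x0p; apply: leq_trans (leq_maxr _ _).
  have E : (size (z * x2)%R < size (x * z2)%R)%N.
    by rewrite [X in (_ < X)%N]size_mulF //; apply: leq_ltn_trans (size_mul_leqF _ _) _; lia.
  by rewrite size_addlF // size_mulF //; lia.
- have x0 : z != 0 by rewrite -size_gt0F; lia.
  have x20 : x2 != 0 by rewrite -size_gt0F; lia.
  have x0p := x0; rewrite -size_gt0F in x0p; apply: leq_trans (leq_maxr _ _); rewrite [_ + z * x2]addrC.
  have E : (size (x * z2)%R < size (z * x2)%R)%N.
    by rewrite [X in (_ < X)%N]size_mulF //; apply: leq_ltn_trans (size_mul_leqF _ _) _; lia.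
  by rewrite size_addlF // size_mulF //; lia.
- have x0 : z != 0 by rewrite -size_gt0F; lia.
  have x20 : z2 != 0 by rewrite -size_gt0F; lia.
  by apply: leq_trans (leq_maxl _ _); apply: leq_trans (leq_maxr _ _); rewrite size_mulF //; lia.
Qed.

Lemma size_sqr p n : (size p <= n.+1)%N -> (size (p ^+ 2)%R <= n.*2.+1)%N.
Proof. by move=> h; rewrite expr2; have := size_mul_le_pred h h; lia. Qed.

Lemma size_sqrE p n : size p = n.+1 -> size (p ^+ 2) = n.*2.+1.
Proof.
move=> h; have p0 : p != 0 by rewrite -size_gt0F h.
by rewrite expr2 size_mulF // h; lia.
Qed.

(** Each of [a], [c], [e] gains at most one degree. The gain is attained by [a] if [x] has the
    larger degree and by [c] if [z] has, thanks to the factor ['X]. *)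
Lemma ht_quadratic (l : F) (x z : {poly F}) (n := ht x z) :
  let a := 'X * x - l%:P * z in let c := x - 'X * z in
  let e := 'X * x - x - 'X * z + l%:P * z in (0 < n)%N ->
  maxn (ht (a ^+ 2) (c ^+ 2)) (size (a ^+ 2 + c ^+ 2 - e ^+ 2)) = n.*2.+1.
Proof.
move=> a c e n0.
have sx : (size x <= n)%N by rewrite leq_max leqnn.
have sz : (size z <= n)%N by rewrite leq_max leqnn orbT.
have sXx : (size ('X * x)%R <= n.+1)%N by have := @size_mul_le_pred 'X x 2 n; rewrite size_polyX; lia.
have sXz : (size ('X * z)%R <= n.+1)%N by have := @size_mul_le_pred 'X z 2 n; rewrite size_polyX; lia.
have slz : (size (l%:P * z)%R <= n)%N by have := @size_mul_le_pred l%:P z 1 n; rewrite size_polyC; lia.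
have sN p : size (- p) = size p by rewrite size_polyN.
have sa : (size a <= n.+1)%N by rewrite size_add_le // ?sN //; lia.
have sc : (size c <= n.+1)%N by rewrite size_add_le // ?sN //; lia.
have se : (size e <= n.+1)%N by rewrite !size_add_le // ?sN //; lia.
apply/eqP; rewrite eqn_leq; apply/andP; split.
  by rewrite !geq_max ?size_add_le // ?sN ?size_sqr.
have [xz|xz] := leqP (size z) (size x).
  have x0 : x != 0 by rewrite -size_gt0F; lia.
  have : size a = n.+1.
    rewrite /a size_polyDl ?sN ?[_ * x]mulrC ?size_mulX //; lia.
  by move/size_sqrE; lia.
have z0 : z != 0 by rewrite -size_gt0F; lia.
have : size c = n.+1.
  rewrite /c addrC size_polyDl ?sN ?[_ * z]mulrC ?size_mulX //; lia.
by move/size_sqrE; lia.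
Qed.

Lemma unimodular_ht (x z : {poly F}) : (exists u v, u * x + v * z = 1) -> (0 < ht x z)%N.
Proof.
move=> [u [v h]]; rewrite lt0n; apply/eqP => h0.
have x0 : x = 0 by apply/eqP; rewrite -size_poly_leq0; lia.
have z0 : z = 0 by apply/eqP; rewrite -size_poly_leq0; lia.
by move/eqP: h; rewrite x0 z0 !mulr0 addr0 eq_sym oner_eq0.
Qed.

(* The height grows quadratically along the orbit of the Vieta involutions: this is the
   parallelogram law [h(P+Q) + h(P-Q) = 2 h(P) + 2 h(Q)] on an elliptic curve,
   with [x(Q) = 'X]. *)
Lemma ht_orbit (l : F) (x0 z0 x1 z1 : {poly F}) (e : int) (h : int) :
  2 * l * (l - 1) != 0 ->
  (exists u v, u * x0 + v * z0 = 1) -> (exists u v, u * x1 + v * z1 = 1) ->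
  biquad 'X l%:P x0 z0 x1 z1 = 0 ->
  (ht x0 z0)%:Z = h -> (ht x1 z1)%:Z = h + e + 1 ->
  forall n : nat, 0 < n%:Z ^+ 2 + e * n%:Z + h.
Proof.
move=> hl c0 c1 hb hh0 hh1 n.
pose k : {poly F} := ((2 * l * (l - 1))^-1)%:P.
have hk : k * (2 * l%:P * (l%:P - 1)) = 1.
  by rewrite -(polyC1 F) -polyCB -[2]/((1 + 1)) -polyCD -!polyCM mulVf.
suff [y [w [y' [w' [cy cy' _ <- _]]]]] : exists y w y' w',
   [/\ exists u v, u * y + v * w = 1, exists u v, u * y' + v * w' = 1,
    biquad 'X l%:P y w y' w' = 0, (ht y w)%:Z = n%:Z ^+ 2 + e * n%:Z + h &
    (ht y' w')%:Z = n.+1%:Z ^+ 2 + e * n.+1%:Z + h].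
  by rewrite ltz_nat unimodular_ht.
elim: n => [|n [y [w [y' [w' [cy cy' b hy hy']]]]]].
  exists x0, z0, x1, z1; split=> //; [rewrite hh0|rewrite hh1]; ring.
have [y2 [w2 [c2 b2 E1 E2 E3]]] := vieta_jump hk cy cy' b.
exists y', w', y2, w2; split=> //.
have := ht_prod (unimodular_ht cy) (unimodular_ht c2).
rewrite E1 E2 E3 ht_quadratic ?unimodular_ht // => E.
(* Three consecutive heights satisfy [i + m = 2 j + 2]: the second difference is 2, which makes the
   sequence [n^2 + e n + h]. *)
have aux (i j m : nat) : (0 < i)%N -> (0 < m)%N -> j.*2.+1 = (i + m).-1 ->
    m%:Z = 2 * j%:Z + 2 - i%:Z by lia.
rewrite (aux _ _ _ (unimodular_ht cy) (unimodular_ht c2) E).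
rewrite hy hy' !intS; ring.
Qed.
End Heights.

Definition legendre_sum (F : finFieldType) (th l : F) : int :=
  \sum_x qchar (th * (x * (x - 1) * (x - l))).

(** In the application [a] and [b] are the sizes of numerator and denominator of a point; the
    equations give [a = b + 1], so the numerator decides the height. *)
Lemma maxn_sizes (a b c d q : nat) : b = c.*2.+4 -> (a + d.*2.+3 = q.*2.+2)%N ->
  (c + d + 3 = q)%N -> (maxn a b)%:Z = q%:Z + 1 + (c%:Z - d%:Z) + 1.
Proof. by lia. Qed.

(** * Frobenius on the twisted Legendre curve *)

Section HasseBound.
Variables (p : nat) (l : 'F_p).
Hypotheses (p_pr : prime p) (p_gt3 : (3 < p)%N) (l0 : l != 0) (l1 : l != 1).
Let F : finFieldType := 'F_p.
Let m := p.-1./2.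
Let f : {poly F} := 'X * ('X - 1) * ('X - l%:P).
Let T : {poly F} := 'X^p.
Let A (e : int) : {set F} := [set a | qchar f.[a] == e].
Let W (e : int) : {poly F} := \prod_(a in A e) ('X - a%:P).

Let cardF : #|F| = p. Proof. exact: card_Fp. Qed.
Let p_odd : odd p. Proof. by case/even_prime: p_pr p_gt3 => [->|]. Qed.
Let oddF : odd #|F|. Proof. by rewrite cardF. Qed.
Let pE : p = m.*2.+1. Proof. by rewrite /m; have := p_odd; lia. Qed.

Let euler (a : F) : a ^+ m = (qchar a)%:~R.
Proof. by rewrite (euler_criterion oddF) cardF. Qed.

Let hornerf a : f.[a] = a * (a - 1) * (a - l).
Proof. by rewrite /f !hornerE. Qed.

Let qchar_f_eq0 a : (qchar f.[a] == 0) = (a \in [:: 0; 1; l]).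
Proof.
have <- : (f.[a] == 0) = (a \in [:: 0; 1; l]).
  by rewrite hornerf !mulf_eq0 !subr_eq0 !inE orbA.
have [->|f0] := eqVneq f.[a] 0; first by rewrite qchar0.
by case: (qchar_values oddF f0) => ->.
Qed.

Let frob_factor : T - 'X = f * W 1 * W (-1).
Proof.
rewrite /T -[p in LHS]cardF finField_genPoly (bigD1 0) //= (bigD1 1) ?oner_neq0 //= (bigD1 l) ?l0 ?l1 //=.
rewrite subr0 !mulrA -/f; rewrite -!mulrA; congr (_ * (_ * (_ * _))).
rewrite (bigID (mem (A 1))) /=.
have hP a : (a != 0) && (a != 1) && (a != l) = (qchar f.[a] != 0).
  by rewrite qchar_f_eq0 !inE !negb_or andbA.
by congr (_ * _); apply: eq_bigl => a; rewrite !inE hP;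
  have [->|f0] := eqVneq f.[a] 0; rewrite ?qchar0 //; case: (qchar_values oddF f0) => ->.
Qed.

Let S := \sum_a qchar f.[a].
Let n e := #|A e|.

Let size_W e : size (W e) = (n e).+1.
Proof. by rewrite /W -big_enum size_prod_XsubC -cardE. Qed.

Let size_f : size f = 4%N.
Proof.
rewrite /f -(polyC1 F) -[X in X * _ * _]subr0 -(polyC0 F).
by rewrite !size_mul ?mulf_neq0 ?polyXsubC_eq0 // !size_XsubC.
Qed.

Let W_neq0 e : W e != 0. Proof. by rewrite -size_poly_gt0 size_W. Qed.
Let f_neq0 : f != 0. Proof. by rewrite -size_poly_gt0 size_f. Qed.

Let size_T : size T = p.+1. Proof. by rewrite size_polyXn. Qed.

Let n_sum : (n 1 + n (-1) + 3 = p)%N.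
Proof.
have : size (T - 'X) = p.+1.
  by rewrite size_polyDl size_T // size_polyN size_polyX ltnS; lia.
rewrite frob_factor size_mul; [|by rewrite mulf_neq0|exact: W_neq0].
by rewrite size_mul // !size_W size_f; lia.
Qed.

Let S_diff : S = (n 1)%:Z - (n (-1))%:Z.
Proof.
rewrite /S (bigID (mem (A 1))) (bigID (mem (A (-1))) (fun i => ~~ _)) /=.
rewrite (eq_bigr (fun=> 1)) => [|a]; last by rewrite inE => /eqP.
rewrite sumr_const natz (eq_bigr (fun=> -1)) => [|a /andP[_]]; last by rewrite inE => /eqP.
rewrite sumr_const mulNrn natz [X in _ + (_ + X)]big1 ?addr0 => [|a].
  congr (_ - Posz _); apply: eq_card => a; rewrite !inE.
  by rewrite -topredE /= !inE andb_idl // => /eqP ->.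
rewrite !inE; have [->|f0] := eqVneq f.[a] 0; first by rewrite qchar0.
by case: (qchar_values oddF f0) => ->.
Qed.

Let fT : f ^+ p = T * (T - 1) * (T - l%:P).
Proof.
have pF : p \in [pchar {poly F}] by rewrite pchar_poly; apply: pchar_Fp.
rewrite /f !exprMn -![_ ^+ p]/(pFrobenius_aut pF _) !rmorphB !rmorph1 /=.
have lp : l ^+ p = l by have := expf_card (l : F); rewrite cardF.
by rewrite !pFrobenius_autE -[l%:P ^+ p]rmorphXn /= lp.
Qed.

Let B : {poly F} := (T + 'X) * (T * 'X + l%:P) - 2 * (1 + l%:P) * (T * 'X).

Section Sign.
Variable e : int.
Hypothesis e_sign : e = 1 \/ e = -1.
Let eF : {poly F} := (e%:~R)%:P.
Let M := B + 2 * eF * f ^+ m.+1.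

Let eF2 : eF ^+ 2 = 1.
Proof. by rewrite /eF -rmorphXn -rmorphXn; case: e_sign => ->. Qed.

(** By Euler's criterion [f ^+ m] takes the value [- e] at the roots of [W (- e)]. This is the
    cancellation between the two terms of the slope [(f ^+ m + eF) / (T - 'X)]. *)
Let dvd_W : W (- e) %| f ^+ m + eF.
Proof.
rewrite /W -big_enum /=; apply: uniq_roots_dvdp; last by rewrite uniq_rootsE enum_uniq.
apply/allP => a; rewrite mem_enum inE => /eqP h.
rewrite rootE /eF hornerD hornerC horner_exp euler.
by rewrite h rmorphN addNr.
Qed.

(* [x1 / z1] is the x-coordinate of the sum of [(T, f ^+ m)] (Frobenius) and [('X, e)]
   on the curve [f y^2 = x(x-1)(x-l)] over [F('X)], in lowest terms. *)
Let K := (f ^+ m + eF) %/ W (- e).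
Let KE : f ^+ m + eF = K * W (- e). Proof. by rewrite divpK. Qed.
Let x1 := K ^+ 2 - (T + 'X - (1 + l%:P)) * f * W e ^+ 2.
Let z1 := f * W e ^+ 2.

Let frob_factor' : T - 'X = f * W e * W (- e).
Proof. by rewrite frob_factor; case: e_sign => ->; rewrite ?opprK //; ring. Qed.

Let z1E : z1 * (f * W (- e) ^+ 2) = (T - 'X) ^+ 2.
Proof. by rewrite frob_factor' /z1; ring. Qed.

(** The chord formula gives [f slope^2 + 1 + l - T - 'X], that is [M / (T - 'X)^2]; the factor
    [f * W (- e) ^+ 2] is what numerator and denominator share. *)
Let x1E : x1 * (f * W (- e) ^+ 2) = M.
Proof.
transitivity (f * (f ^+ m + eF) ^+ 2 - (T + 'X - (1 + l%:P)) * (T - 'X) ^+ 2).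
  by rewrite KE frob_factor' /x1; ring.
transitivity (f ^+ p + f + 2 * eF * f ^+ m.+1 - (T + 'X - (1 + l%:P)) * (T - 'X) ^+ 2).
  rewrite sqrrD eF2 -exprM muln2 [in f ^+ p]pE !exprS; ring.
by rewrite fT /M /B /f; ring.
Qed.

(** After clearing the common factor, the square root [f ^+ m.+1] occurs only squared, as
    [f ^+ p * f]. Since [f ^+ p] is [f] evaluated at [T], a polynomial identity in [T] and ['X]
    remains. *)
Let biquad1 : biquad 'X l%:P T 1 x1 z1 = 0.
Proof.
have G0 : (f * W (- e) ^+ 2) ^+ 2 != 0.
  by apply/expf_neq0/mulf_neq0/expf_neq0/W_neq0; exact: f_neq0.
apply: (mulfI G0); rewrite mulr0 biquadC.
transitivity ((T - 'X) ^+ 2 * (4 * f ^+ p * f - B ^+ 2 + (T - 'X) ^+ 2 * ('X * T - l%:P) ^+ 2)).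
  transitivity ((T - 'X) ^+ 2 * (x1 * (f * W (- e) ^+ 2)) ^+ 2
    - ((('X * T - l%:P) ^+ 2 + (T - 'X) ^+ 2 - ('X * T - T - 'X + l%:P) ^+ 2) *
      (x1 * (f * W (- e) ^+ 2)) * (z1 * (f * W (- e) ^+ 2)))
    + ('X * T - l%:P) ^+ 2 * (z1 * (f * W (- e) ^+ 2)) ^+ 2).
    by rewrite /biquad; ring.
  have E : f ^+ p * f = (f ^+ m.+1) ^+ 2 by rewrite -exprSr -exprM muln2 doubleS -pE.
  have E2 : M ^+ 2 = B ^+ 2 + 2 * B * (2 * eF * f ^+ m.+1) + 4 * (f ^+ p * f).
    transitivity (B ^+ 2 + 2 * B * (2 * eF * f ^+ m.+1) + eF ^+ 2 * (4 * (f ^+ m.+1) ^+ 2)).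
      by rewrite /M; ring.
    by rewrite eF2 mul1r E.
  rewrite x1E z1E E2 /M /B; ring.
by rewrite fT /B /f; ring.
Qed.

(** Modulo [z1] the numerator is [K ^+ 2], and [K] has no root in common with [z1]: [f ^+ m + eF]
    equals [e] at the roots of [f] and [2 e] at those of [W e]. *)
Let coprime1 : coprimep x1 z1.
Proof.
have eF0 : (e%:~R : F) != 0 by case: e_sign => ->; rewrite ?rmorphN1 ?oppr_eq0 oner_eq0.
have Kroot a : ~~ root (f ^+ m + eF) a -> ~~ root K a.
  by apply: contra; rewrite KE rootM => ->.
suff h : coprimep K z1.
  rewrite /x1 -mulrA -/z1 coprimep_sym -mulNr; rewrite addrC.
  by rewrite [coprimep _ _]coprimep_addl_mul coprimep_sym coprimep_expl.
have hf : coprimep K f.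
  rewrite /f -(polyC1 F) -[X in X * _ * _]subr0 -(polyC0 F) !coprimepMr !coprimep_XsubC.
  have hr a : f.[a] = 0 -> ~~ root K a.
    move=> fa; apply: Kroot; rewrite rootE /eF hornerD hornerC horner_exp fa expr0n.
    by rewrite (_ : (m == 0)%N = false) ?add0r //; apply/negbTE; rewrite -lt0n /m; lia.
  by rewrite !hr //; rewrite hornerf ?(subrr, mul0r, mulr0).
rewrite /z1 coprimepMr hf coprimep_expr // /W -big_enum /= big_seq.
elim/big_ind: _ => [|q1 q2 h1 h2|a].
- exact: coprimep1.
- by rewrite coprimepMr h1 h2.
rewrite mem_enum inE => /eqP h; rewrite coprimep_XsubC; apply: Kroot.
rewrite rootE /eF hornerD hornerC horner_exp euler.
rewrite h -mulr2n -mulr_natl mulf_neq0 //; exact: odd_card_two_neq0.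
Qed.

Let size_M : size M = p.*2.+2.
Proof.
(* The degree [2 p + 1] of the first term exceeds the degree [3 (p + 1) / 2] of [f ^+ m.+1]. *)
have -> : M = T ^+ 2 * 'X + (T * ('X ^+ 2 + l%:P - 2 * (1 + l%:P) * 'X) + l%:P * 'X
   + 2 * eF * f ^+ m.+1) by rewrite /M /B; ring.
have sz : size (T ^+ 2 * 'X) = p.*2.+2.
  by rewrite -exprM -exprSr size_polyXn muln2.
rewrite size_polyDl sz // ltnS; apply: size_add_le; first apply: size_add_le.
- apply: leq_trans (size_mul_le_pred (m := p.+1) (n := 3) _ _) _; last by rewrite !addnS /=; lia.
    by rewrite size_T.
  apply: size_add_le; [apply: size_add_le|].
  + by rewrite size_polyXn.
  + by apply: leq_trans (size_polyC_leq1 _) _.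
  rewrite size_polyN -(polyC1 F) -[2]/((1 + 1)) -!polyCD -polyCM.
  by apply: leq_trans (size_mul_le_pred (m := 1) (n := 2) (size_polyC_leq1 _) _) _; rewrite ?size_polyX.
- apply: leq_trans (size_mul_le_pred (m := 1) (n := 2) (size_polyC_leq1 _) _) _; rewrite ?size_polyX //.
  by lia.
have -> : 2 * eF = (2 * e%:~R)%:P by rewrite rmorphM rmorph_nat.
apply: leq_trans (size_mul_le_pred (m := 1) (n := (m.+1 * 3).+1) (size_polyC_leq1 _) _) _.
  by apply: leq_trans (size_exp_leq _ _) _; rewrite size_f mulnC.
by rewrite add1n /= [in leqRHS]pE; lia.
Qed.

(* The left-hand side is the degree of [Frobenius + k e] plus one. *)
Lemma hasse_orbit k : 0 < k%:Z ^+ 2 + e * S * k%:Z + (p%:Z + 1).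
Proof.
have G0 : f * W (- e) ^+ 2 != 0 by apply/mulf_neq0/expf_neq0/W_neq0; exact: f_neq0.
have sW c : size (W c ^+ 2) = (n c).*2.+1 by rewrite (@size_sqrE _ _ (n c)).
have ns : (n e + n (- e) + 3 = p)%N by case: e_sign => ->; rewrite ?opprK -n_sum //; ring.
have sz : size z1 = (n e).*2.+4.
  by rewrite /z1 size_mul ?expf_neq0 // sW size_f addnS.
have x10 : x1 != 0 by apply/eqP => x10; move: size_M; rewrite -x1E x10 mul0r size_poly0.
have sx : (size x1 + (n (- e)).*2.+3 = p.*2.+2)%N.
  rewrite -size_M -x1E size_mul // size_mul ?expf_neq0 // sW size_f.
  by rewrite /= !addnS.
apply: (@ht_orbit _ l T 1 x1 z1) => //.
- by rewrite !mulf_neq0 ?subr_eq0 //; apply: odd_card_two_neq0.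
- by exists 0, 1; rewrite mul0r add0r mulr1.
- by have /Bezout_eq1_coprimepP [[u v]] := coprime1; exists u, v.
- by rewrite size_T size_poly1 (maxn_idPl _) // intS addrC.
rewrite (_ : e * S = (n e)%:Z - (n (- e))%:Z); first exact: maxn_sizes sz sx ns.
by rewrite S_diff; case: e_sign => ->; rewrite ?opprK; ring.
Qed.
End Sign.

(** [S] is even, because [n 1 + n (-1) = p - 3] is. The quadratic form is thus evaluated exactly at
    its minimum [k = |S| / 2], with [e] opposite to the sign of [S]: this gives [k^2 < p + 1]. *)
Lemma hasse_bound : (\sum_a qchar f.[a]) ^+ 2 <= 4 * p%:Z.
Proof.
have [k hk] : exists k : nat, S = 2 * k%:Z \/ S = - (2 * k%:Z).
  by exists (`|S|./2)%N; have := S_diff; have := n_sum; have := p_odd; lia.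
rewrite -/S; case: hk => hk.
  have := hasse_orbit (or_intror erefl) k; rewrite hk; nia.
have := hasse_orbit (or_introl erefl) k; rewrite hk; nia.
Qed.
End HasseBound.

Lemma legendre_sum_hasse (p : nat) (th l : 'F_p) : prime p -> (3 < p)%N ->
  th != 0 -> l != 0 -> l != 1 -> legendre_sum th l ^+ 2 <= 4 * p%:Z.
Proof.
move=> p_pr p_gt3 th0 l0 l1; have oddF : odd #|{: 'F_p}|.
  by rewrite card_Fp //; case/even_prime: p_pr p_gt3 => [->|].
have := hasse_bound p_pr p_gt3 l0 l1.
rewrite (_ : legendre_sum th l = qchar th * \sum_a qchar ('X * ('X - 1) * ('X - l%:P)).[a]).
  by rewrite exprMn [qchar th ^+ 2](qchar_mulxx oddF) th0 mul1r.
by rewrite mulr_sumr; apply: eq_bigr => a _; rewrite -(qcharM oddF) !hornerE.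
Qed.

(** * Congruence modulo p with the polynomial H_p *)

Section PowerSums.
Variable F : finFieldType.
Let n := #|F|.-1.

Lemma sum_expr_lt k : (k < n)%N -> \sum_(x : F) x ^+ k = 0.
Proof.
move=> kn; case: k kn => [|k] kn.
  rewrite (eq_bigr (fun=> 1)) // sumr_const.
  have [p pr pF] := finPcharP F.
  have /eqP := card_pprimeChar pF; rewrite -[#|pPrimeCharType pF|]/#|F| => /eqP ->.
  case: logn (finNzRing_gt1 F) (card_pprimeChar pF); rewrite -[#|pPrimeCharType pF|]/#|F|.
    by move=> + E; rewrite E.
  by move=> d _ _; rewrite expnS mulnC mulrnA (mulrn_pchar pF).
have [a a0 ak] : exists2 a : F, a != 0 & a ^+ k.+1 != 1.
  apply/exists_inP/existsPn => h.
  have p0 : 'X^(k.+1) - 1 != 0 :> {poly F} by rewrite -size_poly_gt0 size_XnsubC.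
  have := @max_poly_roots _ _ (enum [set~ (0 : F)]) p0.
  rewrite size_XnsubC // -cardE cardsC1 enum_uniq -/n.
  suff -> : all (root ('X^(k.+1) - 1)) (enum [set~ (0 : F)]) by move=> /(_ isT isT); lia.
  apply/allP => y; rewrite mem_enum !inE => y0; have := h y.
  by rewrite y0 /= negbK rootE !hornerE => /eqP ->; rewrite subrr.
have /eqP : (a ^+ k.+1 - 1) * \sum_(x : F) x ^+ k.+1 = 0.
  rewrite mulrBl mul1r mulr_sumr [X in _ - X](reindex_inj (mulfI a0)) -sumrB big1 // => x _.
  by rewrite exprMn subrr.
by rewrite mulf_eq0 subr_eq0 (negbTE ak) => /eqP.
Qed.

Lemma sum_expr_card_pred k : (k < n)%N -> \sum_(x : F) x ^+ (n + k) = - (k == 0%N)%:R.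
Proof.
have n1 : n.+1 = #|F| by rewrite /n prednK // ltnW // finNzRing_gt1.
move=> kn; transitivity (\sum_(x : F) (x ^+ k - ((k == 0%N) && (x == 0))%:R)); last first.
  rewrite sumrB sum_expr_lt // sub0r; case: eqP => _ /=; last by rewrite big1.
  by rewrite (bigD1 0) //= eqxx big1 ?addr0 // => x /negbTE ->.
apply: eq_bigr => x _; have [->|x0] := eqVneq x 0.
  rewrite !expr0n addn_eq0 (_ : (n == 0)%N = false) ?andbT ?subrr //.
  by apply/negbTE; rewrite -lt0n; apply: leq_ltn_trans kn.
rewrite andbF subr0 exprD (_ : x ^+ n = 1) ?mul1r //.
by apply: (mulfI x0); rewrite -exprS n1 expf_card mulr1.
Qed.

(** Among the exponents below [2 n] only [n] has a nonzero power sum, namely -1. *)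
Lemma sum_horner (q : {poly F}) : (size q <= n.*2)%N -> \sum_x q.[x] = - q`_n.
Proof.
move=> sq; transitivity (\sum_(i < n + n) q`_i * \sum_x x ^+ i).
  rewrite (eq_bigr _ (fun x _ => horner_coef_wide x (n := (n + n)) _)) ?addnn //.
  by rewrite exchange_big; apply: eq_bigr => i _; rewrite mulr_sumr.
rewrite big_split_ord /= big1 ?add0r => [|i _]; last by rewrite sum_expr_lt ?mulr0.
have n0 : (0 < n)%N by rewrite /n; have := finNzRing_gt1 F; rewrite -[#|_|]/#|F|; case: #|F| => [|[]].
rewrite (bigD1 (Ordinal n0)) //= sum_expr_card_pred //= addn0 mulrN1 big1 ?addr0 // => i.
by rewrite -val_eqE /= sum_expr_card_pred // => /negbTE ->; rewrite oppr0 mulr0.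
Qed.
End PowerSums.

Lemma coef_exp_XsubC (R : comNzRingType) (c : R) m j : (j <= m)%N ->
  (('X - c%:P) ^+ m)`_j = (- c) ^+ (m - j) *+ 'C(m, j).
Proof.
move=> jm; rewrite -polyCN addrC exprDn coef_sum (bigD1 (Ordinal (jm : (j < m.+1)%N))) //=.
rewrite coefMn -rmorphXn coefCM coefXn eqxx mulr1 big1 ?addr0 // => i.
by rewrite -val_eqE coefMn -rmorphXn coefCM coefXn eq_sym => /negbTE /= ->; rewrite mulr0 mul0rn.
Qed.

Lemma coef_mul_XsubC_exp (R : comNzRingType) (l : R) m j : (j <= m)%N ->
  (('X - 1%:P) ^+ m)`_j * (('X - l%:P) ^+ m)`_(m - j) = (-1) ^+ m * (('C(m, j) ^ 2)%:R * l ^+ j).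
Proof.
move=> jm; rewrite !coef_exp_XsubC ?leq_subr // subKn // bin_sub //.
have -> : (-1) ^+ m = (-1) ^+ (m - j) * (-1) ^+ j :> R by rewrite -exprD subnK.
rewrite -[(- 1) ^+ _ *+ _]mulr_natl -[X in _ * X]mulr_natl [(- l) ^+ _]exprNn -mulnn natrM; ring.
Qed.

Lemma legendre_sum_mod (p : nat) (th l : 'F_p) : prime p -> odd p ->
  (legendre_sum th l)%:~R = - ((- th) ^+ p.-1./2 * (H_poly p).[l]).
Proof.
move=> pr po; have cF := card_Fp pr; have oF : odd #|{: 'F_p}| by rewrite cF.
set m := p.-1./2; have pE : p.-1 = m.*2 by rewrite /m; have := prime_gt0 pr; lia.
have m0 : (0 < m)%N by have := prime_gt1 pr; lia.
pose f : {poly 'F_p} := 'X * (('X - 1%:P) * ('X - l%:P)).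
have sf : size f = 4%N.
  by rewrite /f -[X in X * _]subr0 -(polyC0 'F_p) !size_mul ?mulf_neq0 ?polyXsubC_eq0 // !size_XsubC.
rewrite /legendre_sum rmorph_sum /=.
transitivity (th ^+ m * \sum_x (f ^+ m).[x]).
  rewrite mulr_sumr; apply: eq_bigr => x _.
  by rewrite (euler_criterion oF) cF -/m horner_exp -exprMn /f !hornerM !hornerXsubC hornerX mulrA.
rewrite sum_horner; last first.
  rewrite cF pE (leq_trans (size_exp_leq _ _)) // sf; lia.
(* The factor ['X ^+ m] of [f ^+ m] turns the coefficient of degree [p - 1 = 2 m] into the
   coefficient of degree [m] of the remaining product. *)
rewrite cF pE exprMn coefXnM -addnn ltnNge leq_addr /= addnK exprMn coefM.
rewrite exprNn mulrN [_ ^+ m * th ^+ m]mulrC -mulrA; congr (- (_ * _)).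
rewrite /H_poly -/m horner_sum mulr_sumr; apply: eq_bigr => j _.
by rewrite hornerZ hornerXn coef_mul_XsubC_exp // -ltnS.
Qed.

(** * Legendre sums over quadratic and cubic extensions *)

Lemma sum_pair (I J : finType) (w : I * J -> int) : \sum_g w g = \sum_i \sum_j w (i, j).
Proof. by rewrite pair_bigA; apply: eq_bigr => -[]. Qed.

Lemma sum_card_fiber (T G : finType) (g : T -> G) (w : G -> int) :
  \sum_x w (g x) = \sum_c #|[set x | g x == c]|%:Z * w c.
Proof.
rewrite (partition_big g predT) //=; apply: eq_bigr => c _.
rewrite (eq_bigr (fun=> w c)) => [|x /eqP ->] //.
by rewrite sumr_const -natz mulr_natl; congr (_ *+ _); apply: eq_card => x; rewrite !inE.
Qed.

Lemma sum_fiber (T G : finType) (g : T -> G) :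
  \sum_c #|[set x | g x == c]|%:Z = #|T|%:Z.
Proof.
transitivity (\sum_(x : T) (1 : int)); last by rewrite sumr_const natz.
by rewrite (sum_card_fiber g (fun=> 1)); apply: eq_bigr => c _; rewrite mulr1.
Qed.

(** It spares half of each fibre count below: an upper bound for every fibre together with the right
    total is enough. *)
Lemma sum_le_eq (G : finType) (u v : G -> int) : (forall c, u c <= v c) ->
  \sum_c u c = \sum_c v c -> forall c, u c = v c.
Proof.
move=> h E c; apply/eqP; rewrite eq_sym -subr_eq0; apply/eqP.
have h2 : \sum_c (v c - u c) = 0 by rewrite sumrB E subrr.
by move/eqP: h2; rewrite psumr_eq0 => [/allP/(_ c)|i _]; rewrite ?mem_index_enum ?subr_ge0 // => /(_ isT)/eqP.
Qed.

Section SplitMonic.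
Variable k : finFieldType.

Definition quad_of_roots (r : k * k) : k * k := (r.1 + r.2, r.1 * r.2).

Definition cubic_of_roots (r : k * k * k) : k * k * k :=
  let: (a, b, c) := r in (a + b + c, a * b + a * c + b * c, a * b * c).

(** These are the symmetric functions of [(X - a)(X^2 - d1 X + d2)], where the quadratic factor need
    not split. *)
Definition cubic_of_root_quad (r : k * (k * k)) : k * k * k :=
  let: (a, (d1, d2)) := r in (a + d1, a * d1 + d2, a * d2).

Variables th l : k.
Hypotheses (odd_k : odd #|k|) (th0 : th != 0) (l0 : l != 0) (l1 : l != 1).
Let f a := qchar (th * (a * (a - 1) * (a - l))).
Let S := legendre_sum th l.

(* A pair or triple of elementary symmetric functions encodes a monic polynomial; its
   weight is the product of the character values at the roots.  The weights of degrees
   1, 2, 3 sum to [S], [q], [0], the coefficients of the L-function [1 + S T + q T^2]. *)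
Definition quad_weight (g : k * k) : int :=
  qchar (th ^+ 2 * (g.2 * (g.2 - g.1 + 1) * (g.2 - l * g.1 + l ^+ 2))).

Definition cubic_weight (g : k * k * k) : int :=
  let: (e1, e2, e3) := g in
  qchar (th ^+ 3 * (e3 * (e3 - e2 + e1 - 1) * (e3 - l * e2 + l ^+ 2 * e1 - l ^+ 3))).

(** For fixed [e2] the weight is a quadratic in [e1] with roots [e2 + 1] and [e2 / l + l]. They
    coincide only for [e2 = l], which contributes [q]; the rest is a complete character sum. *)
Lemma sum_quad_weight : \sum_g quad_weight g = #|k|%:Z.
Proof.
rewrite sum_pair exchange_big /=.
transitivity (\sum_(e2 : k) (qchar (e2 * l) * ((e2 == l)%:Z * #|k|%:Z - 1))).
  apply: eq_bigr => e2 _.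
  transitivity (\sum_e1 qchar ((e2 * l) * ((e1 - (e2 + 1)) * (e1 - (e2 / l + l))))).
    apply: eq_bigr => e1 _; rewrite /quad_weight /= mulrC (qcharMsqr odd_k) //; congr qchar.
    by field.
  rewrite (sum_qchar_quadratic odd_k); congr (_ * (_%:Z * _ - 1)).
  rewrite -subr_eq0 -[in RHS]subr_eq0.
  have -> : e2 + 1 - (e2 / l + l) = (e2 - l) * ((l - 1) / l) by field.
  by rewrite !mulf_eq0 invr_eq0 (negbTE l0) [l - 1 == 0]subr_eq0 (negbTE l1) !orbF.
rewrite (eq_bigr (fun e2 : k => (if e2 == l then #|k|%:Z else 0) - qchar (l * e2 + 0))) => [|e2 _].
  by rewrite sumrB sum_qchar_affine // subr0 -big_mkcond /= big_pred1_eq.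
case: eqP => [->|_]; last by rewrite mul0r add0r addr0 mulrN1 mulrC sub0r.
by rewrite addr0 -expr2 (qchar_sqr odd_k) // !mul1r.
Qed.

(** For fixed [e3] and [e2] the weight is a quadratic in [e1], with a double root for exactly one
    [e2]. Its contribution [q] cancels the [q] terms -1. *)
Lemma sum_cubic_weight : \sum_g cubic_weight g = 0.
Proof.
rewrite sum_pair exchange_big /=.
rewrite big1 // => e3 _.
rewrite sum_pair exchange_big /=.
transitivity (\sum_(e2 : k) qchar (th ^+ 3 * e3) * ((e2 == l + e3 * (1 + l^-1))%:Z * #|k|%:Z - 1)).
  apply: eq_bigr => e2 _.
  transitivity (\sum_e1 qchar ((th ^+ 3 * e3) * ((e1 - (1 + e2 - e3)) * (e1 - (l + e2 / l - e3 / l ^+ 2))))).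
    apply: eq_bigr => e1 _.
    by rewrite -[RHS](qcharMsqr odd_k _ l0) /=; congr qchar; field.
  rewrite (sum_qchar_quadratic odd_k); congr (_ * (_%:Z * _ - 1)).
  rewrite -subr_eq0 -[in RHS]subr_eq0.
  have -> : 1 + e2 - e3 - (l + e2 / l - e3 / l ^+ 2) = (e2 - (l + e3 * (1 + l^-1))) * ((l - 1) / l) by field.
  by rewrite !mulf_eq0 invr_eq0 (negbTE l0) [l - 1 == 0]subr_eq0 (negbTE l1) !orbF.
rewrite -mulr_sumr sumrB -mulr_suml sumr_const natz.
rewrite (bigD1 (l + e3 * (1 + l^-1))) //= eqxx big1 => [|e2 /negbTE -> //].
by rewrite addr0 mul1r subrr mulr0.
Qed.

Lemma sum_quad_of_roots : \sum_r quad_weight (quad_of_roots r) = S ^+ 2.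
Proof.
rewrite expr2 {1}/S /legendre_sum big_distrl /= sum_pair /=.
apply: eq_bigr => a _; rewrite /S /legendre_sum big_distrr /=; apply: eq_bigr => b _.
by rewrite -(qcharM odd_k) /quad_weight /=; congr qchar; ring.
Qed.

Lemma sum_cubic_of_roots : \sum_r cubic_weight (cubic_of_roots r) = S ^+ 3.
Proof.
rewrite exprS -sum_quad_of_roots mulrC big_distrl /=.
rewrite sum_pair /=.
apply: eq_bigr => -[a b] _; rewrite /S /legendre_sum big_distrr /=; apply: eq_bigr => c _.
by rewrite -(qcharM odd_k) /cubic_weight /=; congr qchar; ring.
Qed.

Lemma sum_cubic_of_root_quad : \sum_r cubic_weight (cubic_of_root_quad r) = S * #|k|%:Z.
Proof.
rewrite -sum_quad_weight {1}/S /legendre_sum big_distrl /=.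
rewrite sum_pair /=.
apply: eq_bigr => a _; rewrite big_distrr /=; apply: eq_bigr => -[d1 d2] _.
by rewrite -(qcharM odd_k) /cubic_weight /=; congr qchar; ring.
Qed.
End SplitMonic.

Section FiniteExtension.
Variables (k F : finFieldType) (phi : {rmorphism k -> F}).
Hypothesis odd_k : odd #|k|.
Let q := #|k|.

Lemma card_power_pchar : exists p : nat, exists d, [/\ p \in [pchar k], p \in [pchar F] & q = (p ^ d)%N].
Proof.
have [p pr pk] := finPcharP k; exists p, (logn p #|k|); split=> //.
  by rewrite -(fmorph_pchar phi) in pk *.
exact: card_pprimeChar pk.
Qed.

Lemma frobeniusD (x y : F) : (x + y) ^+ q = x ^+ q + y ^+ q.
Proof.
have [p [d [_ pF ->]]] := card_power_pchar.
elim: d => [|d IH]; first by rewrite expn0 !expr1.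
by rewrite expnSr !exprM IH -!(pFrobenius_autE pF) rmorphD.
Qed.

Lemma frobeniusN (x : F) : (- x) ^+ q = - x ^+ q.
Proof. by rewrite exprNn -signr_odd odd_k mulN1r. Qed.

Lemma frobeniusB (x y : F) : (x - y) ^+ q = x ^+ q - y ^+ q.
Proof. by rewrite frobeniusD frobeniusN. Qed.

Lemma frobenius_base (a : k) : phi a ^+ q = phi a.
Proof. by rewrite -rmorphXn expf_card. Qed.

Lemma frobenius_fixed (x : F) : x ^+ q = x -> exists a, x = phi a.
Proof.
move=> hx; have /(congr1 (fun P => (map_poly phi P).[x])) := finField_genPoly k.
rewrite rmorphB /= map_polyXn map_polyX !hornerE -/q hx subrr rmorph_prod horner_prod => /esym/eqP.
rewrite prodf_seq_eq0 => /hasP[a _] /=; rewrite map_polyXsubC hornerXsubC subr_eq0 => /eqP ->.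
by exists a.
Qed.

Definition descend (y : F) : k := odflt 0 [pick a | phi a == y].

Lemma descendK (y : F) : y ^+ q = y -> phi (descend y) = y.
Proof.
move=> /frobenius_fixed[a ->]; rewrite /descend; case: pickP => [b /eqP //|/(_ a)].
by rewrite eqxx.
Qed.

(** [x ^+ E] is the norm to [k], and Euler's criterion factors through it because
    [(#|F| - 1) / 2 = E (q - 1) / 2]. *)
Lemma qchar_norm (E : nat) (x : F) (a : k) : #|F|.-1 = (q.-1 * E)%N -> odd #|F| ->
  phi a = x ^+ E -> qchar x = qchar a.
Proof.
move=> cF oF ha; apply: (qchar_int_inj oF).
  have [->|a0] := eqVneq a 0; first by rewrite qchar0 inE.
  by case: (qchar_values odd_k a0) => ->.
rewrite (euler_criterion oF) -(rmorph_int phi) (euler_criterion odd_k) rmorphXn ha -exprM.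
have [h hq] : exists h, q = h.*2.+1 by exists (q./2); have := odd_k; rewrite -/q; lia.
by rewrite cF -/q hq /= -doubleMl !doubleK mulnC.
Qed.
End FiniteExtension.

Lemma card_le_seq (T : finType) (A : {set T}) (s : seq T) :
  (forall x, x \in A -> x \in s) -> (#|A| <= size s)%N.
Proof. by move=> h; apply: leq_trans (card_size s); apply/subset_leq_card/fintype.subsetP. Qed.

Lemma card_ge_seq (T : finType) (A : {set T}) (s : seq T) : uniq s ->
  (forall x, x \in s -> x \in A) -> (size s <= #|A|)%N.
Proof. by move=> /card_uniqP <- h; apply/subset_leq_card/fintype.subsetP. Qed.

Section QuadraticExtension.
Variables (k F : finFieldType) (phi : {rmorphism k -> F}).
Hypotheses (odd_k : odd #|k|) (cardF : #|F| = (#|k| ^ 2)%N).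
Let q := #|k|.

Definition quad_of_conj (x : F) : k * k :=
  (descend phi (x + x ^+ q), descend phi (x * x ^+ q)).

Let frob2 (x : F) : (x ^+ q) ^+ q = x.
Proof. by rewrite -exprM mulnn -cardF expf_card. Qed.

Lemma quad_of_conj_sum x : phi (quad_of_conj x).1 = x + x ^+ q.
Proof. by rewrite descendK // (frobeniusD phi) frob2 addrC. Qed.

Lemma quad_of_conj_prod x : phi (quad_of_conj x).2 = x * x ^+ q.
Proof. by rewrite descendK // exprMn frob2 mulrC. Qed.

(** A quadratic comes from two ordered pairs of roots if it splits, from two conjugates if it is
    irreducible, and once in each way if it has a double root. Only the bound 2 is proved for each
    [g]; both totals are [2 q^2]. *)
Lemma quad_fiber (g : k * k) :
  #|[set x | quad_of_conj x == g]|%:Z + #|[set r | quad_of_roots r == g]|%:Z = 2.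
Proof.
move: g; apply: sum_le_eq; last first.
  by rewrite big_split /= !sum_fiber sumr_const card_prod cardF -natz -/q; lia.
have conj_quad x y : quad_of_conj x = quad_of_conj y -> (x - y) * (x - y ^+ q) = 0.
  move=> E; have := quad_of_conj_sum x; have := quad_of_conj_prod x.
  rewrite E quad_of_conj_sum quad_of_conj_prod => h1 h2.
  have -> : (x - y) * (x - y ^+ q) = x * x - (y + y ^+ q) * x + y * y ^+ q by ring.
  by rewrite h1 h2; ring.
move=> g; have [/existsP[[a b] /eqP <-]|/existsPn nr] := boolP [exists r, quad_of_roots r == g].
  have hx x : quad_of_conj x = quad_of_roots (a, b) -> x = phi a /\ a = b.
    move=> E; have := quad_of_conj_sum x; have := quad_of_conj_prod x; rewrite E /= => h1 h2.
    have /eqP : (x - phi a) * (x - phi b) = 0.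
      have -> : (x - phi a) * (x - phi b) = x * x - phi (a + b) * x + phi (a * b).
        by rewrite rmorphD rmorphM; ring.
      by rewrite h1 h2; ring.
    rewrite mulf_eq0 !subr_eq0 => /orP[]/eqP xE; move: h2; rewrite xE frobenius_base rmorphD.
      by move/addrI/fmorph_inj ->.
    by move/addIr/fmorph_inj ->.
  have hr : (#|[set r | quad_of_roots r == quad_of_roots (a, b)]| <= 2)%N.
    apply: (card_le_seq (s := [:: (a, b); (b, a)])) => -[c d]; rewrite inE !inE => /eqP[h1 h2].
    have /eqP : (c - a) * (c - b) = 0.
      by have -> : (c - a) * (c - b) = c * c - (a + b) * c + a * b by [ring]; rewrite -h1 -h2; ring.
    rewrite mulf_eq0 !subr_eq0 => /orP[]/eqP cE; move: h1; rewrite cE.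
      by move/addrI ->; rewrite eqxx.
    by rewrite addrC => /addIr ->; rewrite eqxx orbT.
  have [ab|ab] := eqVneq a b.
    have h1 : (#|[set x | quad_of_conj x == quad_of_roots (a, b)]| <= 1)%N.
      by apply: (card_le_seq (s := [:: phi a])) => x; rewrite !inE => /eqP/hx[->].
    have h2 : (#|[set r | quad_of_roots r == quad_of_roots (a, b)]| <= 1)%N.
      rewrite -ab; apply: (card_le_seq (s := [:: (a, a)])) => -[c d]; rewrite inE !inE => /eqP[h2 h3].
      have /eqP : (c - a) ^+ 2 = 0.
        have -> : (c - a) ^+ 2 = c * c - (a + a) * c + a * a by ring.
        by rewrite -h2 -h3; ring.
      by rewrite sqrf_eq0 subr_eq0 => /eqP cE; move: h2; rewrite cE => /addrI ->.
    by lia.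
  have h1 : (#|[set x | quad_of_conj x == quad_of_roots (a, b)]| <= 0)%N.
    apply: (card_le_seq (s := [::])) => x; rewrite inE => /eqP/hx[_ E].
    by rewrite E eqxx in ab.
  by lia.
have -> : [set r | quad_of_roots r == g] = set0.
  by apply/setP => r; rewrite !inE; apply/negbTE.
rewrite cards0 addr0.
have [/existsP[x /eqP hx]|/existsPn nx] := boolP [exists x, quad_of_conj x == g].
  suff : (#|[set x | quad_of_conj x == g]| <= 2)%N by lia.
  apply: (card_le_seq (s := [:: x; x ^+ q])) => y; rewrite !inE -hx => /eqP/conj_quad/eqP.
  by rewrite mulf_eq0 !subr_eq0.
have -> : [set x | quad_of_conj x == g] = set0 by apply/setP => r; rewrite !inE; apply/negbTE.
by rewrite cards0.
Qed.

(** Newton's identity for power sums of degree 2: weighting the fibre identity gives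
    [T_2 + S^2 = 2 q]. *)
Lemma legendre_sum_quadratic (th l : k) : th != 0 -> l != 0 -> l != 1 ->
  legendre_sum (phi th) (phi l) = 2 * q%:Z - legendre_sum th l ^+ 2.
Proof.
move=> th0 l0 l1.
have oF : odd #|F| by rewrite cardF oddX odd_k orbT.
have E : legendre_sum (phi th) (phi l) = \sum_x quad_weight th l (quad_of_conj x).
  apply: eq_bigr => x _; apply: (qchar_norm (phi := phi) (E := q.+1) odd_k _ oF).
    by rewrite cardF -/q; have := odd_k; rewrite -/q; lia.
  rewrite /quad_weight !(rmorphXn, rmorphB, rmorphD, rmorphM, rmorph1).
  rewrite quad_of_conj_sum quad_of_conj_prod [RHS]exprS !exprMn !(frobeniusB phi odd_k) !frobenius_base expr1n.
  by ring.
have := sum_quad_of_roots th l odd_k; have := sum_quad_weight odd_k th0 l0 l1.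
rewrite E (sum_card_fiber quad_of_conj) (sum_card_fiber (@quad_of_roots k)) -/q => h1 <-; rewrite -h1.
apply/eqP; rewrite eq_sym subr_eq; apply/eqP; rewrite -big_split mulr_sumr /=.
by apply: eq_bigr => g _; rewrite -mulrDl quad_fiber.
Qed.
End QuadraticExtension.

Section CubicExtension.
Variables (k F : finFieldType) (phi : {rmorphism k -> F}).
Hypotheses (odd_k : odd #|k|) (cardF : #|F| = (#|k| ^ 3)%N).
Let q := #|k|.

Definition cubic_of_conj (x : F) : k * k * k :=
  let y := x ^+ q in let z := y ^+ q in
  (descend phi (x + y + z), descend phi (x * y + x * z + y * z), descend phi (x * y * z)).

Let frob3 (x : F) : ((x ^+ q) ^+ q) ^+ q = x.
Proof. by rewrite -!exprM mulnA -[in LHS](expnSr _ 2) -cardF expf_card. Qed.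

Lemma cubic_of_conjE x (y := x ^+ q) (z := y ^+ q) :
  [/\ phi (cubic_of_conj x).1.1 = x + y + z,
      phi (cubic_of_conj x).1.2 = x * y + x * z + y * z &
      phi (cubic_of_conj x).2 = x * y * z].
Proof.
by split; rewrite descendK // !(exprMn, frobeniusD phi) frob3 -/y -/z; ring.
Qed.

Lemma cubic_root_values (a b c x : F) : (x - a) * (x - b) * (x - c) = 0 -> x \in [:: a; b; c].
Proof.
by move/eqP; rewrite !mulf_eq0 !subr_eq0 !inE orbA.
Qed.

(** Newton's identity of degree 3 as a count by factorisation type: [3 + 0 - 0] for an irreducible
    cubic, [0 + 3 - 0] with one simple root in [k], [0 + 9 - 6] for distinct roots, [0 + 6 - 3] for
    a double root, [1 + 3 - 1] for a triple one. Again only an upper bound is proved, both totals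
    being [3 q^3]. *)
Lemma cubic_fiber (g : k * k * k) :
  #|[set x | cubic_of_conj x == g]|%:Z + 3 * #|[set r | cubic_of_root_quad r == g]|%:Z
  - #|[set r | @cubic_of_roots k r == g]|%:Z = 3.
Proof.
move: g; apply: sum_le_eq; last first.
  rewrite sumrB big_split /= -mulr_sumr !sum_fiber sumr_const !card_prod cardF -natz -/q.
  by rewrite -mulr_natl; lia.
have conj_cubic x y : cubic_of_conj x = cubic_of_conj y ->
    (x - y) * (x - y ^+ q) * (x - (y ^+ q) ^+ q) = 0.
  move=> E; have [] := cubic_of_conjE x; have [] := cubic_of_conjE y; rewrite E => -> -> -> h1 h2 h3.
  set z := y ^+ q in h1 h2 h3 *; set w := z ^+ q in h1 h2 h3 *.
  have -> : (x - y) * (x - z) * (x - w) =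
     x ^+ 3 - (y + z + w) * x ^+ 2 + (y * z + y * w + z * w) * x - y * z * w by ring.
  by rewrite h1 h2 h3; ring.
have conj_root x a d : cubic_of_conj x = cubic_of_root_quad (a, d) -> x = phi a.
  case: d => d1 d2 E; have [] := cubic_of_conjE x; rewrite E /= => h1 h2 h3.
  set y := x ^+ q in h1 h2 h3; set z := y ^+ q in h1 h2 h3.
  have /cubic_root_values : (phi a - x) * (phi a - y) * (phi a - z) = 0.
    have -> : (phi a - x) * (phi a - y) * (phi a - z) = phi a ^+ 3 - (x + y + z) * phi a ^+ 2
        + (x * y + x * z + y * z) * phi a - x * y * z by ring.
    by rewrite -h1 -h2 -h3 !rmorphD !rmorphM; ring.
  rewrite !inE => /or3P[] /eqP h; first by rewrite h.
    by rewrite -(frob3 x) -/y -h !frobenius_base.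
  by rewrite -(frob3 x) -/y -/z -h frobenius_base.
have root_eq (a : k) d b d' : cubic_of_root_quad (a, d) = cubic_of_root_quad (b, d') -> 
    (a - b) * (a ^+ 2 - d'.1 * a + d'.2) = 0.
  case: d d' => [d1 d2] [e1 e2] [h1 h2 h3] /=.
  have -> : (a - b) * (a ^+ 2 - e1 * a + e2) = a ^+ 3 - (b + e1) * a ^+ 2 + (b * e1 + e2) * a - b * e2 by ring.
  by rewrite -h1 -h2 -h3; ring.
have quad_inj a d d' : cubic_of_root_quad (a, d) = cubic_of_root_quad (a, d') -> d = d' :> k * k.
  by case: d d' => [d1 d2] [e1 e2] [/addrI -> /addrI ->].
move=> g; have [/existsP[x /eqP <-]|/existsPn nx] := boolP [exists x, cubic_of_conj x == g].
  have [/existsP[[a d] /eqP E]|/existsPn nr] := boolP [exists r, cubic_of_root_quad r == cubic_of_conj x].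
    have xE := conj_root _ _ _ (esym E).
    have gE : cubic_of_conj x = cubic_of_roots (a, a, a).
      have [] := cubic_of_conjE x; case: (cubic_of_conj x) => [[u v] w].
      rewrite xE !frobenius_base -!rmorphM -!rmorphD /=.
      by move=> /fmorph_inj -> /fmorph_inj -> /fmorph_inj ->.
    have h1 : (#|[set y | cubic_of_conj y == cubic_of_conj x]| <= 1)%N.
      apply: (card_le_seq (s := [:: x])) => y; rewrite !inE -E => /eqP/conj_root ->.
      by rewrite xE.
    have h2 : (#|[set r | cubic_of_root_quad r == cubic_of_conj x]| <= 1)%N.
      apply: (card_le_seq (s := [:: (a, d)])) => -[b d']; rewrite !inE => /eqP E2.
      have := conj_root _ _ _ (esym E2); rewrite xE => /fmorph_inj ab.
      by move: E2; rewrite -E -ab => /quad_inj ->.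
    have h3 : (1 <= #|[set r | cubic_of_roots r == cubic_of_conj x]|)%N.
      apply: (card_ge_seq (s := [:: (a, a, a)])) => // r; rewrite !inE => /eqP ->.
      by rewrite gE.
    by lia.
  have -> : [set r | cubic_of_root_quad r == cubic_of_conj x] = set0.
    by apply/setP => r; rewrite !inE; apply/negbTE.
  have h1 : (#|[set y | cubic_of_conj y == cubic_of_conj x]| <= 3)%N.
    apply: (card_le_seq (s := [:: x; x ^+ q; (x ^+ q) ^+ q])) => y; rewrite inE => /eqP/conj_cubic.
    exact: cubic_root_values.
  by rewrite cards0; lia.
have -> : [set x | cubic_of_conj x == g] = set0 by apply/setP => r; rewrite !inE; apply/negbTE.
rewrite cards0 add0r.
set R := [set r | cubic_of_root_quad r == g].
(* A single factorisation meets the bound. Two different linear factors split the cubic completely,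
   and the ordered triples of roots make up for the excess. *)
have [R1|] := leqP #|R| 1; first by lia.
case/card_gt1P => -[a d] [[b d'] [ha hb ab]].
rewrite !inE in ha hb; move/eqP: ha => ha; move/eqP: hb => hb.
have {}ab : a != b.
  by apply: contraNneq ab => E; move: ha; rewrite E -hb => /quad_inj ->.
have [c gE] : exists c, g = cubic_of_roots (a, b, c).
  have := root_eq b d' a d; rewrite ha hb => /(_ erefl)/eqP.
  rewrite mulf_eq0 subr_eq0 eq_sym (negbTE ab) /= => /eqP h.
  exists (d.1 - b); rewrite -ha; case: (d) h => d1 d2 /= h.
  have -> : d2 = b * (d1 - b) by rewrite -[LHS]subr0 -h; ring.
  by congr (_, _, _); ring.
have Rabc r : r \in R -> r.1 \in [:: a; b; c].
  case: r => e [e1 e2]; rewrite inE gE => /eqP[h1 h2 h3] /=.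
  have /eqP : (e - a) * (e - b) * (e - c) = 0.
    have -> : (e - a) * (e - b) * (e - c) = e ^+ 3 - (a + b + c) * e ^+ 2
        + (a * b + a * c + b * c) * e - a * b * c by ring.
    by rewrite -h1 -h2 -h3; ring.
  by rewrite !mulf_eq0 !subr_eq0 !inE orbA.
have cardR (s : seq k) : (forall r, r \in R -> r.1 \in s) -> (#|R| <= size s)%N.
  move=> h; have inj : {in R &, injective (fun r : k * (k * k) => r.1)}.
    move=> -[u1 u2] [v1 v2]; rewrite !inE => /eqP h1 /eqP h2 /= E; move: h1; rewrite -h2 E.
    by move/quad_inj ->.
  rewrite -(card_in_imset inj); apply: card_le_seq => _ /imsetP[r rR ->]; exact: h.
have roots6 r : r \in [:: (a, b, c); (a, c, b); (b, a, c); (b, c, a); (c, a, b); (c, b, a)] ->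
    r \in [set r | cubic_of_roots r == g].
  by rewrite gE !inE => /or4P[/eqP->|/eqP->|/eqP->|/or3P[]/eqP->]; apply/eqP; congr (_, _, _); ring.
have [ca|ca] := eqVneq c a.
  have : (#|R| <= 2)%N by apply: (cardR [:: a; b]) => r /Rabc; rewrite ca !inE; case: eqP; case: eqP.
  have : (3 <= #|[set r | cubic_of_roots r == g]|)%N.
    apply: (card_ge_seq (s := [:: (a, b, a); (a, a, b); (b, a, a)])) => [|r hr].
      by rewrite /= !inE !xpair_eqE !eqxx (negbTE ab) eq_sym (negbTE ab) !andbF.
    by apply: roots6; move: hr; rewrite ca !inE => /or3P[] ->; rewrite ?orbT.
  by lia.
have [cb|cb] := eqVneq c b.
  have : (#|R| <= 2)%N by apply: (cardR [:: a; b]) => r /Rabc; rewrite cb !inE; case: eqP; case: eqP.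
  have : (3 <= #|[set r | cubic_of_roots r == g]|)%N.
    apply: (card_ge_seq (s := [:: (a, b, b); (b, a, b); (b, b, a)])) => [|r hr].
      by rewrite /= !inE !xpair_eqE !eqxx (negbTE ab) eq_sym (negbTE ab) !andbF.
    by apply: roots6; move: hr; rewrite cb !inE => /or3P[] ->; rewrite ?orbT.
  by lia.
have : (#|R| <= 3)%N by apply: (cardR [:: a; b; c]).
have : (6 <= #|[set r | cubic_of_roots r == g]|)%N.
  apply: card_ge_seq roots6 => /=.
  have ba : b != a by rewrite eq_sym.
  have ac : a != c by rewrite eq_sym.
  have bc : b != c by rewrite eq_sym.
  have E := (negbTE ab, negbTE ba, negbTE ac, negbTE ca, negbTE bc, negbTE cb).
  by rewrite !inE !xpair_eqE !eqxx !E !andbF.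
by lia.
Qed.

(** The weighted fibre identity reads [T_3 + 3 q S - S^3 = 3 * 0], since the weights of all cubics
    sum to 0. *)
Lemma legendre_sum_cubic (th l : k) : th != 0 -> l != 0 -> l != 1 ->
  legendre_sum (phi th) (phi l) = legendre_sum th l ^+ 3 - 3 * q%:Z * legendre_sum th l.
Proof.
move=> th0 l0 l1.
have oF : odd #|F| by rewrite cardF oddX odd_k orbT.
have E : legendre_sum (phi th) (phi l) = \sum_x cubic_weight th l (cubic_of_conj x).
  apply: eq_bigr => x _.
  have [h1 h2 h3] := cubic_of_conjE x; case: (cubic_of_conj x) h1 h2 h3 => [[e1 e2] e3] /= h1 h2 h3.
  apply: (qchar_norm (phi := phi) (E := (1 + q + q ^ 2)%N) odd_k _ oF).
    rewrite cardF -/q; have [h ->] : exists h, q = h.+1 by exists q.-1; have := odd_k; rewrite -/q; lia.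
    by rewrite /= !expnS expn0; lia.
  rewrite [RHS]exprD [in RHS]exprD expr1 -mulnn exprM.
  rewrite !(rmorphXn, rmorphB, rmorphD, rmorphM, rmorph1) h1 h2 h3.
  rewrite !exprMn !(frobeniusB phi odd_k) !frobenius_base !expr1n.
  by ring.
have hB := sum_cubic_of_roots th l odd_k; have hC := sum_cubic_of_root_quad odd_k th0 l0 l1.
have hG := sum_cubic_weight th odd_k l0 l1.
have : legendre_sum (phi th) (phi l) + 3 * (legendre_sum th l * q%:Z) - legendre_sum th l ^+ 3 = 0.
  rewrite -hB -hC E (sum_card_fiber cubic_of_conj) (sum_card_fiber (@cubic_of_roots k)) (sum_card_fiber (@cubic_of_root_quad k)).
  rewrite mulr_sumr -big_split -sumrB /=; transitivity (3 * \sum_g cubic_weight th l g).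
    rewrite mulr_sumr; apply: eq_bigr => g _; rewrite -[X in _ = X * _](cubic_fiber g); ring.
  by rewrite hG mulr0.
by move/(canRL (subrK _)); rewrite add0r => <-; ring.
Qed.
End CubicExtension.

(** * Divisibility by four *)

Section TwoTorsion.
Variables (F : finFieldType) (th l : F).
Hypotheses (oddF : odd #|F|) (th0 : th != 0) (l0 : l != 0) (l1 : l != 1).
Let f x := th * (x * (x - 1) * (x - l)).
Let A := [set x | qchar (f x) == 1].

(** [x -> l / x] is translation by the 2-torsion point over 0; it multiplies [f x] by the square of
    [l / x^2]. *)
Let qchar_f_inv x : x != 0 -> qchar (f (l / x)) = qchar (f x).
Proof.
move=> x0; rewrite -(qcharMsqr oddF (f x) (r := l / x ^+ 2)).
  by congr qchar; rewrite /f; field.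
by rewrite mulf_neq0 // invr_eq0 expf_neq0.
Qed.

Let A_neq0 x : x \in A -> x != 0.
Proof. by apply: contraTneq => ->; rewrite inE /f !(mul0r, mulr0) qchar0. Qed.

Let even_unfixed : ~~ odd #|[set x in A | x ^+ 2 != l]|.
Proof.
set B := [set x in A | _].
have BE : (#|B| = \sum_(z in [set (x + l / x)%R | x in B]) 2)%N.
  rewrite -sum1_card (partition_big (fun x => x + l / x) (mem [set x + l / x | x in B])) /=; last first.
    by move=> x xB; apply: imset_f.
  apply: eq_bigr => z /imsetP[x xB ->].
  have [xA xl] : x \in A /\ x ^+ 2 != l by move: xB; rewrite inE => /andP.
  have x0 := A_neq0 xA.
  have dx : x != l / x.
    by apply: contraNneq xl => h; rewrite expr2 {1}h divfK.
  have : #|[set x; l / x]| = 2%N by rewrite cards2 dx.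
  rewrite -sum1_card => <-; apply: eq_bigl => y; rewrite !inE.
  apply/idP/idP => [/andP[/andP[yA yl] /eqP h]|].
    have y0 : y != 0 by apply: A_neq0; rewrite inE.
    have /eqP : (y - x) * (y - l / x) = 0.
      have -> : (y - x) * (y - l / x) = y * ((y + l / y) - (x + l / x)) by field; rewrite x0 y0.
      by rewrite h subrr mulr0.
    by rewrite mulf_eq0 !subr_eq0.
  move=> /orP[]/eqP->; first by rewrite eqxx andbT; rewrite !inE in xB.
  rewrite qchar_f_inv //; move: xA; rewrite inE => -> /=.
  have -> : l / (l / x) = x by field; rewrite l0 x0.
  rewrite addrC eqxx andbT; apply: contraNneq xl => h.
  apply/eqP; apply: (mulfI l0); transitivity ((l / x) ^+ 2 * x ^+ 2); first by rewrite h.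
  by field.
by rewrite BE sum_nat_const oddM andbF.
Qed.

(** At a fixed point [s^2 = l] one has [f s = - th (s (s - 1))^2], so the two fixed points, if they
    exist, lie in [A] together or not at all. *)
Let even_fixed : ~~ odd #|[set x in A | x ^+ 2 == l]|.
Proof.
have [/existsP[r /eqP rl]|/existsPn nr] := boolP [exists r, r ^+ 2 == l]; last first.
  rewrite (_ : [set _ | _] = set0) ?cards0 //; apply/setP => x; rewrite !inE.
  by rewrite (negbTE (nr x)) andbF.
have r0 : r != 0 by apply: contraNneq l0 => r0; rewrite -rl r0 expr0n.
have qr s : s ^+ 2 = l -> qchar (f s) = qchar (- th).
  move=> sl; have s0 : s != 0 by apply: contraNneq l0 => s0; rewrite -sl s0 expr0n.
  have s1 : s - 1 != 0 by rewrite subr_eq0; apply: contraNneq l1 => s1; rewrite -sl s1 expr1n.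
  rewrite -(qcharMsqr oddF (- th) (r := s * (s - 1))) ?mulf_neq0 //.
  by congr qchar; rewrite /f -sl; ring.
have [h|h] := eqVneq (qchar (- th)) 1.
  rewrite (_ : [set _ | _] = [set x | x ^+ 2 == r ^+ 2]) ?(card_sqrt_sqr oddF r0) //.
  apply/setP => x; rewrite !inE rl andb_idl // => /eqP xl.
  by rewrite qr // h.
rewrite (_ : [set _ | _] = set0) ?cards0 //; apply/setP => x; rewrite !inE.
by apply/negbTE; apply: contra h => /andP[h1 /eqP /qr <-].
Qed.

(** The point at infinity and the three roots give 4 and each element of [A] gives 2; [A] is even by
    the involution [x -> l / x]. *)
Lemma dvd4_legendre_sum : (4 %| #|F|%:Z + 1 + legendre_sum th l)%Z.
Proof.
have : ~~ odd #|A|.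
  rewrite -(cardsID [set x | x ^+ 2 == l] A) oddD.
  rewrite (_ : A :&: _ = [set x in A | x ^+ 2 == l]); last by apply/setP => x; rewrite !inE.
  rewrite (_ : A :\: _ = [set x in A | x ^+ 2 != l]); last by apply/setP => x; rewrite !inE andbC.
  by rewrite (negbTE even_fixed) (negbTE even_unfixed).
suff -> : #|F|%:Z + 1 + legendre_sum th l = 4 + 2 * #|A|%:Z by lia.
rewrite addrAC; have <- : \sum_x (1 + qchar (f x)) = #|F|%:Z + legendre_sum th l.
  by rewrite big_split /= sumr_const natz.
suff : \sum_x (1 + qchar (f x)) = 3 + 2 * #|A|%:Z by move=> ->; ring.
rewrite (bigID (mem A)) /= (eq_bigr (fun=> 2)) => [|x]; last by rewrite inE => /eqP ->.
rewrite sumr_const -[_ *+ #|A|]mulr_natr [#|A|%:R]natz addrC; congr (_ + _).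
rewrite (eq_bigr (fun x => (x \in [:: 0; 1; l])%:Z)) => [|x]; last first.
  rewrite inE; have [fx|fx] := eqVneq (f x) 0.
    rewrite fx qchar0 => _; suff -> : x \in [:: 0; 1; l] by [].
    by move/eqP: fx; rewrite /f !mulf_eq0 (negbTE th0) !subr_eq0 !inE /= -orbA.
  case: (qchar_values oddF fx) => -> // _.
  suff /negbTE -> : x \notin [:: 0; 1; l] by [].
  by apply: contra fx; rewrite /f !mulf_eq0 !subr_eq0 !inE -orbA => ->; rewrite orbT.
transitivity (\sum_(x in [:: 0; 1; l]) 1 : int).
  rewrite [RHS]big_mkcond [LHS]big_mkcond /=; apply: eq_bigr => x _; rewrite !inE.
  have [/= |] := boolP [|| x == 0, x == 1 | x == l]; last by rewrite if_same.
  rewrite orbA -(subr_eq0 x 1) -(subr_eq0 x l) -!mulf_eq0 => /eqP E.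
  by rewrite /f E mulr0 qchar0.
rewrite sumr_const natz (_ : #|_| = 3%N) //.
suff /card_uniqP -> : uniq [:: 0; 1; l] by [].
by rewrite /= !inE ![0 == _]eq_sym oner_eq0 (negbTE l0) eq_sym (negbTE l1).
Qed.
End TwoTorsion.

(** * Splitting the character sums of the sextics *)

Section ProjectiveSums.
Variable F : finFieldType.
Hypothesis oddF : odd #|F|.

(* Forms of degree [2n + 2], whose quadratic character is a function on the projective
   line; [proj_sum] sums it. *)
Definition homogeneous2 (n : nat) (G : F -> F -> F) :=
  forall c x y, G (c * x) (c * y) = (c ^+ n.+1) ^+ 2 * G x y.

Definition proj_sum (G : F -> F -> F) : int := \sum_x qchar (G x 1) + qchar (G 1 0).

(** Every projective point carries [q - 1] nonzero vectors with the same character value. On the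
    affine plane, invariance under [GL2] is just a change of summation variable. *)
Lemma affine_cone_sum n G : homogeneous2 n G ->
  \sum_x \sum_y qchar (G x y) = #|F|.-1%:Z * proj_sum G.
Proof.
move=> hG; have G0 : G 0 0 = 0 by have := hG 0 0 0; rewrite !mulr0 !expr0n mul0r.
have hq c x y : c != 0 -> qchar (G (c * x) (c * y)) = qchar (G x y).
  by move=> c0; rewrite hG mulrC qcharMsqr // expf_neq0.
have sum_const (z : int) : \sum_(y : F | y != 0) z = #|F|.-1%:Z * z.
  rewrite sumr_const -mulr_natl natz (_ : #|_| = #|F|.-1) //.
  by have <- := cardsC1 (0 : F); apply: eq_card => y; rewrite !inE.
rewrite exchange_big (bigD1 0) //= (bigD1 0) //= G0 qchar0 add0r mulrDr addrC; congr (_ + _).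
  rewrite -sum_const; apply: eq_bigr => y y0.
  rewrite (reindex_inj (mulfI y0)) /=; apply: eq_bigr => x _.
  by rewrite -{2}(mulr1 y) hq.
rewrite -sum_const; apply: eq_bigr => x x0.
by have := hq x 1 0 x0; rewrite mulr1 mulr0.
Qed.

Lemma proj_sum_GL2 n G (a b c d : F) : a * d - b * c != 0 -> homogeneous2 n G ->
  proj_sum (fun x y => G (a * x + b * y) (c * x + d * y)) = proj_sum G.
Proof.
move=> det hG.
have hG2 : homogeneous2 n (fun x y => G (a * x + b * y) (c * x + d * y)).
  by move=> z x y; rewrite -hG; congr G; ring.
have q0 : #|F|.-1%:Z != 0 by rewrite card_odd //=; have := finNzRing_gt1 F; rewrite -[#|_|]/#|F| card_odd; lia.
apply: (mulfI q0); rewrite -!(@affine_cone_sum n) // !pair_bigA /=.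
rewrite [RHS](reindex_inj (h := fun v : F * F => (a * v.1 + b * v.2, c * v.1 + d * v.2))) //.
move=> [x y] [x' y'] /= [h1 h2].
have e1 : (a * d - b * c) * (x - x') = 0.
  have -> : (a * d - b * c) * (x - x') = d * ((a * x + b * y) - (a * x' + b * y')) - b * ((c * x + d * y) - (c * x' + d * y')) by ring.
  by rewrite h1 h2; ring.
have e2 : (a * d - b * c) * (y - y') = 0.
  have -> : (a * d - b * c) * (y - y') = a * ((c * x + d * y) - (c * x' + d * y')) - c * ((a * x + b * y) - (a * x' + b * y')) by ring.
  by rewrite h1 h2; ring.
by move/eqP: e1; move/eqP: e2; rewrite !mulf_eq0 (negbTE det) !subr_eq0 => /eqP -> /eqP ->.
Qed.

Lemma proj_sum_change n G G' (r a b c d : F) : r != 0 -> a * d - b * c != 0 -> homogeneous2 n G ->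
  (forall x y, G (a * x + b * y) (c * x + d * y) = G' x y * r ^+ 2) -> proj_sum G' = proj_sum G.
Proof.
move=> r0 det hG E; rewrite -(proj_sum_GL2 det hG) /proj_sum; congr (_ + _).
  by apply: eq_bigr => x _; rewrite E qcharMsqr.
by rewrite E qcharMsqr.
Qed.

Lemma legendre_sum_proj (th l : F) :
  legendre_sum th l = proj_sum (fun x y => th * (x * y * (x - y) * (x - l * y))).
Proof.
rewrite /proj_sum /= (mulr0 1) !mul0r mulr0 qchar0 addr0; apply: eq_bigr => x _.
by congr qchar; ring.
Qed.

(** The Moebius map [(a6 - b6)(x - b5) / ((a6 - b5)(x - b6))] sends [b5], [b6], [a6] to 0, infinity,
    1, and [a5] to the Legendre parameter. *)
Lemma quartic_sum (al a5 a6 b5 b6 : F) : uniq [:: a5; a6; b5; b6] ->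
  qchar al + \sum_x qchar (al * ((x - a5) * (x - a6) * (x - b5) * (x - b6))) =
  legendre_sum (al * (a5 - b6) * (a6 - b5)) (((a5 - b5) * (a6 - b6)) / ((a5 - b6) * (a6 - b5))).
Proof.
rewrite /= !inE !negb_or -!(subr_eq0 _ b5) -!(subr_eq0 _ b6) -!andbA.
move=> /and5P[_ h1 h2 h3 /andP[h4 /andP[h5 _]]].
rewrite legendre_sum_proj -(@proj_sum_change 1 _
  (fun x y => al * ((x - a5 * y) * (x - a6 * y) * (x - b5 * y) * (x - b6 * y)))
  ((a6 - b5) * (a6 - b6) * (b5 - b6)) (a6 - b6) (- (a6 - b6) * b5) (a6 - b5) (- (a6 - b5) * b6)).
- rewrite /proj_sum addrC; congr (_ + _); last by congr qchar; ring.
  by apply: eq_bigr => x _; congr qchar; ring.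
- by rewrite !mulf_neq0.
- have -> : (a6 - b6) * (- (a6 - b5) * b6) - - (a6 - b6) * b5 * (a6 - b5)
    = (a6 - b6) * (a6 - b5) * (b5 - b6) by ring.
  by rewrite !mulf_neq0.
- by move=> c x y; ring.
move=> x y; field.
by rewrite h2 h3.
Qed.

Lemma even_sextic_part (ka a b s : F) :
  let P := a + s in let Q := a - s in let M := a + s - 1 in let N := a - s - 1 in
  let c := ka / (64%:R * s ^+ 3 * a * (1 - a)) in
  a != 0 -> a != 1 -> b != 1 -> s != 0 -> Q != 0 -> N != 0 -> s ^+ 2 = a ^+ 2 - a * b ->
  \sum_v qchar (c * (v - 1) * (P ^+ 2 - Q ^+ 2 * v) * (M ^+ 2 - N ^+ 2 * v)) =
  legendre_sum (ka * (1 - b) / (1 - a)) ((1 - a) * (b - 2 * a + 2 * s) / (b - 1)).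
Proof.
move=> P Q M N c a0 a1 b1 s0 Q0 N0 hs.
have two0 := odd_card_two_neq0 oddF.
have hb : b = (a ^+ 2 - s ^+ 2) / a by rewrite hs; field.
have a1' : 1 - a != 0 by rewrite subr_eq0 eq_sym.
have b1' : b - 1 != 0 by rewrite subr_eq0.
have b1'' : 1 - b != 0 by rewrite subr_eq0 eq_sym.
have v01 : 4%:R * s * a * (1 - b) / (N ^+ 2 * Q ^+ 2) != 0.
  by rewrite !mulf_neq0 ?invr_eq0 ?mulf_neq0 ?expf_neq0 // -[4%N]/(2 * 2)%N natrM mulf_neq0.
(* The affine map takes 0, 1 and the Legendre parameter to the roots [M^2 / N^2], [P^2 / Q^2] and 1
   of the cubic in [v]. *)
have inj : injective (fun z => M ^+ 2 / N ^+ 2 + (4%:R * s * a * (1 - b) / (N ^+ 2 * Q ^+ 2)) * z).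
  by move=> x y /addrI /(mulfI v01).
rewrite (reindex_inj inj) /legendre_sum; apply: eq_bigr => z _ /=.
rewrite -[RHS](@qcharMsqr _ oddF _ (a * (1 - b) / (N ^+ 2 * Q ^+ 2))); last first.
  by rewrite !mulf_neq0 ?invr_eq0 ?mulf_neq0 ?expf_neq0.
congr qchar.
have ha : a ^+ 2 - s ^+ 2 + -1 * a != 0.
  have -> : a ^+ 2 - s ^+ 2 + -1 * a = a * (b - 1) by rewrite hs; ring.
  by rewrite mulf_neq0.
rewrite /c /P /Q /M /N hb; field.
rewrite Q0 N0 a0 ha a1' s0 -[64%N]/(2 ^ 6)%N natrX /=.
exact: expf_neq0.
Qed.

(* The Moebius map to the coordinate [W / Z] turns the sextic into a form even in [W], so
   the sum splits along the two quotients of the genus 2 curve by the lifts of [W -> - W]. *)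
Lemma sextic_sum_normal (ka a b s : F) :
  a != 0 -> a != 1 -> b != 0 -> b != 1 -> s != 0 -> 1 - 2 * a + a * b != 0 ->
  s ^+ 2 = a ^+ 2 - a * b ->
  proj_sum (fun U V => ka * (V * U * (U - V) * (U - a * V) * (U - b * V)
     * (U - a * (1 - b) / (1 - a) * V))) =
  legendre_sum (ka * (1 - b) / (1 - a)) ((1 - a) * (b - 2 * a + 2 * s) / (b - 1)) +
  legendre_sum (ka * (1 - b) / (1 - a)) ((1 - a) * (b - 2 * a - 2 * s) / (b - 1)).
Proof.
move=> a0 a1 b0 b1 s0 hab hs.
have two0 := odd_card_two_neq0 oddF.
have n64 : 64%:R != 0 :> F by rewrite -[64%N]/(2 ^ 6)%N natrX expf_neq0.
have a1' : 1 - a != 0 by rewrite subr_eq0 eq_sym.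
have hPQ : (a + s) * (a - s) != 0.
  have -> : (a + s) * (a - s) = a * b by rewrite mulrC -subr_sqr hs; ring.
  by rewrite mulf_neq0.
have hMN : (a + s - 1) * (a - s - 1) != 0.
  have -> : (a + s - 1) * (a - s - 1) = a ^+ 2 - s ^+ 2 - 2 * a + 1 by ring.
  by rewrite hs (_ : _ + 1 = 1 - 2 * a + a * b) //; ring.
move: hPQ hMN; rewrite !mulf_eq0 !negb_or => /andP[P0 Q0] /andP[M0 N0].
pose c := ka / (64%:R * s ^+ 3 * a * (1 - a)).
pose h v := c * (v - 1) * ((a + s) ^+ 2 - (a - s) ^+ 2 * v) * ((a + s - 1) ^+ 2 - (a - s - 1) ^+ 2 * v).
have E1 := even_sextic_part ka a0 a1 b1 s0 Q0 N0 hs; rewrite /= -/c in E1.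
have hs' : (- s) ^+ 2 = a ^+ 2 - a * b by rewrite sqrrN.
have ns0 : - s != 0 by rewrite oppr_eq0.
have P0' : a - - s != 0 by rewrite opprK.
have M0' : a - - s - 1 != 0 by rewrite opprK.
have E2 := even_sextic_part ka a0 a1 b1 ns0 P0' M0' hs'; rewrite /= opprK mulrN in E2.
rewrite -{}E1 -{}E2.
(* The involution [U -> a + s^2 / (U - a)] exchanges infinity with [a], 0 with [b], and 1 with
   [a (1 - b) / (1 - a)]. Its fixed points [a + s] and [a - s] are sent to 0 and infinity, so that
   it becomes [W -> - W]. *)
rewrite (@proj_sum_change 2 (fun W Z => c * (W ^+ 2 - Z ^+ 2) * ((a + s) ^+ 2 * Z ^+ 2 - (a - s) ^+ 2 * W ^+ 2)
   * ((a + s - 1) ^+ 2 * Z ^+ 2 - (a - s - 1) ^+ 2 * W ^+ 2)) _ 1 1 (- (a + s)) 1 (- (a - s))); first last.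
- move=> U V; rewrite /c expr1n mulr1.
  have -> : b = (a ^+ 2 - s ^+ 2) / a by rewrite hs; field.
  by field; rewrite ?a0 ?a1' ?s0 ?n64 ?oppr_eq0 ?s0.
- by move=> z x y; ring.
- by rewrite (_ : _ - _ = 2 * s) ?mulf_neq0 //; ring.
- exact: oner_neq0.
rewrite /proj_sum (eq_bigr (fun w => (fun v => qchar (h v)) (w ^+ 2))) => [|w _]; last first.
  by rewrite /= /h; congr qchar; ring.
rewrite (sum_sqr_comp (fun v => qchar (h v))) (eq_bigr _ (fun v _ => mulrDl _ _ _)) big_split /= -addrA.
congr (_ + _); first by apply: eq_bigr => v _; rewrite mul1r.
(* The factor [qchar v] kills the term at [v = 0]; the point [(1 : 0)] supplies the missing term of
   the second sum, and [v -> 1 / v] matches the others. *)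
rewrite (bigD1 0) //= qchar0 mul0r add0r [RHS](bigD1 0) //= addrC; congr (_ + _).
  by congr qchar; rewrite /c; field; rewrite ?a0 ?a1' ?s0 ?n64 ?oppr_eq0 ?s0.
rewrite (reindex_inj (h := GRing.inv)) /=; last exact: invr_inj.
apply: eq_big => [v|v v0]; first by rewrite invr_eq0.
rewrite invr_eq0 in v0.
rewrite -(qcharM oddF) -[LHS](@qcharMsqr _ oddF _ (v ^+ 2)) ?expf_neq0 //.
congr qchar; rewrite /h /c; field.
by rewrite v0 a0 a1' s0 n64 oppr_eq0 s0.
Qed.

(** In the coordinate sending [a1], [a2], [a3] to infinity, 0, 1, the relation places [a6] at
    [a (1 - b) / (1 - a)]: an involution then pairs [a1] with [a4], [a2] with [a5], [a3] with [a6].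
    The remaining conditions express that the six points are distinct. *)
Lemma sextic_params (a1 a2 a3 a4 a5 a6 s : F) :
  let a := ((a1 - a3) * (a2 - a4)) / ((a2 - a3) * (a1 - a4)) in
  let b := ((a1 - a3) * (a2 - a5)) / ((a2 - a3) * (a1 - a5)) in
  s ^+ 2 = a ^+ 2 - a * b -> uniq [:: a1; a2; a3; a4; a5; a6] ->
  (a2 - a4) * (a1 - a6) * (a3 - a5) = (a2 - a6) * (a1 - a5) * (a3 - a4) ->
  [/\ a != 0, a != 1, b != 0 & b != 1] /\
  [/\ s != 0, 1 - 2 * a + a * b != 0 &
    a * (1 - b) / (1 - a) = (a1 - a3) * (a2 - a6) / ((a2 - a3) * (a1 - a6))].
Proof.
move=> a b hs hu hrel.
have [d13 d23 d14 d15 d16] : [/\ a1 - a3 != 0, a2 - a3 != 0, a1 - a4 != 0, a1 - a5 != 0 & a1 - a6 != 0].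
  rewrite !subr_eq0; move: hu; rewrite /= !inE !negb_or -!andbA.
  by repeat case/andP => ?; split.
have [d12 d24 d25 d34 d35] : [/\ a1 - a2 != 0, a2 - a4 != 0, a2 - a5 != 0, a3 - a4 != 0 & a3 - a5 != 0].
  rewrite !subr_eq0; move: hu; rewrite /= !inE !negb_or -!andbA.
  by repeat case/andP => ?; split.
have [d36 d45 d26] : [/\ a3 - a6 != 0, a4 - a5 != 0 & a2 - a6 != 0].
  rewrite !subr_eq0; move: hu; rewrite /= !inE !negb_or -!andbA.
  by repeat case/andP => ?; split.
have a1E : 1 - a = - ((a1 - a2) * (a3 - a4)) / ((a2 - a3) * (a1 - a4)) by rewrite /a; field; rewrite d23 d14.
have b1E : 1 - b = - ((a1 - a2) * (a3 - a5)) / ((a2 - a3) * (a1 - a5)) by rewrite /b; field; rewrite d23 d15.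
have a1' : 1 - a != 0 by rewrite a1E !mulf_neq0 ?invr_eq0 ?oppr_eq0 ?mulf_neq0.
have b1' : 1 - b != 0 by rewrite b1E !mulf_neq0 ?invr_eq0 ?oppr_eq0 ?mulf_neq0.
have a0 : a != 0 by rewrite !mulf_neq0 ?invr_eq0 ?mulf_neq0.
have b0 : b != 0 by rewrite !mulf_neq0 ?invr_eq0 ?mulf_neq0.
have bE : a * (1 - b) / (1 - a) = (a1 - a3) * (a2 - a6) / ((a2 - a3) * (a1 - a6)).
  apply: (mulIf a1'); rewrite divfK // b1E a1E /a.
  apply: (@mulIf _ (a1 - a6)) => //.
  transitivity (- ((a1 - a3) * (a1 - a2) / ((a2 - a3) ^+ 2 * (a1 - a4) * (a1 - a5))) * ((a2 - a4) * (a1 - a6) * (a3 - a5))).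
    by field; rewrite d23 d14 d15.
  by rewrite hrel; field; rewrite d23 d14 d15 d16.
have s0 : s != 0.
  rewrite -sqrf_eq0 hs expr2 -mulrBr mulf_neq0 // /a /b.
  rewrite (_ : _ - _ = - ((a1 - a3) * (a1 - a2) * (a4 - a5)) / ((a2 - a3) * (a1 - a4) * (a1 - a5))).
    by rewrite !mulf_neq0 ?invr_eq0 ?oppr_eq0 ?mulf_neq0.
  by field; rewrite d23 d14 d15.
have hab : 1 - 2 * a + a * b != 0.
  have -> : 1 - 2 * a + a * b = (1 - a) * (1 - a * (1 - b) / (1 - a)) by field.
  rewrite mulf_neq0 // bE (_ : _ - _ = - ((a1 - a2) * (a3 - a6)) / ((a2 - a3) * (a1 - a6))).
    by rewrite !mulf_neq0 ?invr_eq0 ?oppr_eq0 ?mulf_neq0.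
  by field; rewrite d23 d16.
by split; split=> //; rewrite eq_sym -subr_eq0.
Qed.

(** Up to nonzero factors, [l] and [l - 1] are the squares of [a - s] and [a - s - 1], which divide
    [a b] and [1 - 2 a + a b]. *)
Lemma legendre_param_neq (a b s : F) :
  a != 0 -> a != 1 -> b != 0 -> b != 1 -> 1 - 2 * a + a * b != 0 -> s ^+ 2 = a ^+ 2 - a * b ->
  let l := (1 - a) * (b - 2 * a + 2 * s) / (b - 1) in l != 0 /\ l != 1.
Proof.
move=> a0 a1 b0 b1 hab hs l; have b1' : b - 1 != 0 by rewrite subr_eq0.
have a1' : 1 - a != 0 by rewrite subr_eq0 eq_sym.
split.
  have Q0 : a - s != 0.
    have : (a - s) * (a + s) != 0 by rewrite -subr_sqr hs opprB addrCA subrr addr0 mulf_neq0.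
    by rewrite mulf_eq0 negb_or => /andP[].
  have -> : l = - ((1 - a) * (a - s) ^+ 2) / (a * (b - 1)).
    rewrite /l (_ : (a - s) ^+ 2 = - a * (b - 2 * a + 2 * s)); first by field; rewrite a0 b1'.
    by rewrite sqrrB hs; ring.
  by rewrite !mulf_neq0 ?invr_eq0 ?oppr_eq0 ?mulf_neq0 ?expf_neq0.
have N0 : a - s - 1 != 0.
  have : (a - s - 1) * (a + s - 1) != 0.
    have -> : (a - s - 1) * (a + s - 1) = a ^+ 2 - s ^+ 2 - 2 * a + 1 by ring.
    by rewrite hs (_ : _ + 1 = 1 - 2 * a + a * b) //; ring.
  by rewrite mulf_eq0 negb_or => /andP[].
rewrite -subr_eq0 (_ : l - 1 = (a - s - 1) ^+ 2 / (b - 1)).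
  by rewrite mulf_neq0 ?invr_eq0 ?expf_neq0.
have -> : (a - s - 1) ^+ 2 = a ^+ 2 + s ^+ 2 + 1 - 2 * a * s - 2 * a + 2 * s by ring.
by rewrite hs /l; field.
Qed.

Lemma sextic_sum (al a1 a2 a3 a4 a5 a6 : F) :
  let a := ((a1 - a3) * (a2 - a4)) / ((a2 - a3) * (a1 - a4)) in
  let b := ((a1 - a3) * (a2 - a5)) / ((a2 - a3) * (a1 - a5)) in
  let be := al * (a2 - a3) * (a1 - a4) * (a1 - a5) * (a1 - a6) in
  let th := be * (1 - b) / (1 - a) in
  forall s, s ^+ 2 = a ^+ 2 - a * b -> uniq [:: a1; a2; a3; a4; a5; a6] ->
  (a2 - a4) * (a1 - a6) * (a3 - a5) = (a2 - a6) * (a1 - a5) * (a3 - a4) ->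
  qchar al + \sum_x qchar (al * ((x - a1) * (x - a2) * (x - a3) * (x - a4) * (x - a5) * (x - a6))) =
  legendre_sum th ((1 - a) * (b - 2 * a + 2 * s) / (b - 1)) +
  legendre_sum th ((1 - a) * (b - 2 * a - 2 * s) / (b - 1)).
Proof.
move=> a b be th s hs hu hrel.
have [[a0 a1' b0 b1'] [s0 hab bE]] := sextic_params hs hu hrel.
have [d13 d23 d14 d15 d16] : [/\ a1 - a3 != 0, a2 - a3 != 0, a1 - a4 != 0, a1 - a5 != 0 & a1 - a6 != 0].
  rewrite !subr_eq0; move: hu; rewrite /= !inE !negb_or -!andbA.
  by repeat case/andP => ?; split.
have d12 : a1 - a2 != 0.
  by rewrite subr_eq0; move: hu; rewrite /= !inE !negb_or -!andbA => /andP[].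
rewrite -sextic_sum_normal //.
(* The coordinate is [(a1 - a3)(x - a2) / ((a2 - a3)(x - a1))], whose values at [a4] and [a5] are
   [a] and [b]. *)
rewrite -(@proj_sum_change 2 _ (fun x y => al * ((x - a1 * y) * (x - a2 * y) * (x - a3 * y) * (x - a4 * y) * (x - a5 * y) * (x - a6 * y)))
  ((a1 - a3) ^+ 2 * (a2 - a1) ^+ 2 * (a2 - a3)) (- (a1 - a3)) ((a1 - a3) * a2) (- (a2 - a3)) ((a2 - a3) * a1)).
- rewrite /proj_sum addrC; congr (_ + _); last by congr qchar; ring.
  by apply: eq_bigr => x _; congr qchar; ring.
- by rewrite !mulf_neq0 ?expf_neq0 // -opprB oppr_eq0.
- by rewrite (_ : _ - _ = - ((a1 - a3) * (a2 - a3) * (a1 - a2))) ?oppr_eq0 ?mulf_neq0 //; ring.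
- by move=> z x y; ring.
move=> x y; rewrite bE /a /b /be; field.
by rewrite d23 d14 d15 d16.
Qed.
End ProjectiveSums.

From mathcomp Require Import boolp classical_sets functions cardinality.

(** * Rational points of the fibre product *)

(** A relation instead of a map to a residue field: it needs no quotient, and no value outside the
    valuation ring. *)
Definition residue (F K : fieldType) (cst : {rmorphism F -> K}) (O : K -> bool)
    (z : K) (c : F) : Prop := z - cst c \in max_ideal O.

Section ValuationRing.
Variables (F K : fieldType) (cst : {rmorphism F -> K}) (O : K -> bool).
Hypothesis hO : valuation_ring cst O.
Implicit Types (z w : K) (c d : F).

Let subO : subring_closed O. Proof. by case: hO. Qed.
Let totO z : z != 0 -> (z \in O) || (z^-1 \in O). Proof. by case: hO => _ _ _; apply. Qed.

Lemma val_cst c : cst c \in O. Proof. by case: hO. Qed.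
Lemma val_B z w : z \in O -> w \in O -> z - w \in O. Proof. by case: subO => _ + _; apply. Qed.
Lemma val_M z w : z \in O -> w \in O -> z * w \in O. Proof. by case: subO => _ _; apply. Qed.
Lemma val_1 : 1 \in O. Proof. by case: subO. Qed.
Lemma val_0 : 0 \in O. Proof. by rewrite -(subrr 1) val_B ?val_1. Qed.
Lemma val_N z : z \in O -> - z \in O. Proof. by move=> ?; rewrite -sub0r val_B ?val_0. Qed.
Lemma val_D z w : z \in O -> w \in O -> z + w \in O.
Proof. by move=> ? ?; rewrite -[w]opprK val_B ?val_N. Qed.
Lemma val_X z n : z \in O -> z ^+ n \in O.
Proof. by move=> zO; elim: n => [|n IH]; rewrite ?expr0 ?val_1 // exprS val_M. Qed.

Lemma max_sub z : z \in max_ideal O -> z \in O.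
Proof.
rewrite inE => /orP[/eqP->|zO]; first exact: val_0.
have [->|z0] := eqVneq z 0; first exact: val_0.
by have := totO z0; rewrite (negbTE zO) orbF.
Qed.

Lemma max_M z w : z \in max_ideal O -> w \in O -> z * w \in max_ideal O.
Proof.
rewrite !inE => /orP[/eqP->|zO] wO; first by rewrite mul0r eqxx.
have [//|zw /=] := eqVneq (z * w) 0; apply: contra zO => h.
have w0 : w != 0 by apply: contraNneq zw => ->; rewrite mulr0.
by have -> : z^-1 = w * (z * w)^-1 by [rewrite invfM mulrCA divff // mulr1]; rewrite val_M.
Qed.

Lemma max_N z : z \in max_ideal O -> - z \in max_ideal O.
Proof. by move=> h; rewrite -mulrN1 max_M // val_N // val_1. Qed.

Lemma max_D z w : z \in max_ideal O -> w \in max_ideal O -> z + w \in max_ideal O.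
Proof.
have [->|z0] := eqVneq z 0; first by rewrite add0r.
have [->|w0] := eqVneq w 0; first by rewrite addr0.
move=> zm wm; have := totO (mulf_neq0 z0 (invr_neq0 w0)); rewrite invfM invrK => /orP[h|h].
  by rewrite (_ : z + w = w * (z / w + 1)) ?max_M ?val_D ?val_1 // mulrDr mulr1 mulrCA divff // mulr1.
by rewrite (_ : z + w = z * (z^-1 * w + 1)) ?max_M ?val_D ?val_1 // mulrDr mulr1 mulrA divff // mul1r addrC.
Qed.

Lemma max_cst c : cst c \in max_ideal O -> c = 0.
Proof.
rewrite inE fmorph_eq0 => /orP[/eqP //|/negP []].
by rewrite -fmorphV val_cst.
Qed.

Lemma val_unit z : z \in O -> z \notin max_ideal O -> z != 0 /\ z^-1 \in O.
Proof. by move=> zO; rewrite inE negb_or negbK => /andP[]. Qed.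

Lemma val_sqr z : z ^+ 2 \in O -> z \in O.
Proof.
have [->|z0] := eqVneq z 0; first by rewrite val_0.
by have /orP[//|h] := totO z0 => h2; rewrite -(mulKf z0 z) -expr2 val_M.
Qed.

Lemma val_nontrivial : exists z, z \notin O. Proof. by case: hO. Qed.

Local Notation res := (residue cst O).

Lemma residue_val z c : res z c -> z \in O.
Proof. by move=> /max_sub h; rewrite -(subrK (cst c) z) val_D ?val_cst. Qed.

Lemma residue_uniq z c d : res z c -> res z d -> c = d.
Proof.
move=> hc hd; apply/eqP; rewrite -subr_eq0; apply/eqP/max_cst.
rewrite rmorphB (_ : _ - _ = (z - cst d) + - (z - cst c)); last by ring.
by rewrite max_D // max_N.
Qed.

Lemma residue_cst c : res (cst c) c.
Proof. by rewrite /residue subrr inE eqxx. Qed.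

Lemma residue0 z : res z 0 <-> z \in max_ideal O.
Proof. by rewrite /residue rmorph0 subr0. Qed.

Lemma residue1 : res 1 1.
Proof. by rewrite -[X in residue _ _ X _](rmorph1 cst); apply: residue_cst. Qed.

Lemma residueD z w c d : res z c -> res w d -> res (z + w) (c + d).
Proof.
move=> hz hw; rewrite /residue rmorphD (_ : _ - _ = (z - cst c) + (w - cst d)); last by ring.
exact: max_D.
Qed.

Lemma residueN z c : res z c -> res (- z) (- c).
Proof. by move=> h; rewrite /residue rmorphN -opprD max_N. Qed.

Lemma residueB z w c d : res z c -> res w d -> res (z - w) (c - d).
Proof. by move=> hz hw; exact: (residueD hz (residueN hw)). Qed.

Lemma residueM z w c d : res z c -> res w d -> res (z * w) (c * d).
Proof.
move=> hz hw; rewrite /residue rmorphM.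
rewrite (_ : _ - _ = (z - cst c) * w + (w - cst d) * cst c); last by ring.
by rewrite max_D // max_M // ?val_cst // (residue_val hw).
Qed.

Lemma residue_unit z c : res z c -> c != 0 -> z != 0 /\ z^-1 \in O.
Proof.
move=> hz c0; apply: (val_unit (residue_val hz)).
by apply: contra c0 => /residue0 h; rewrite (residue_uniq hz h).
Qed.

Lemma residueV z c : res z c -> c != 0 -> res z^-1 c^-1.
Proof.
move=> hz c0; have [z0 zO] := residue_unit hz c0.
rewrite /residue (_ : _ - _ = - (z - cst c) * (z^-1 * cst c^-1)); last first.
  by rewrite fmorphV; field; rewrite z0 fmorph_eq0 c0.
by rewrite max_M ?max_N // val_M // val_cst.
Qed.

Lemma residue_horner z c (p : {poly F}) : res z c -> res (map_poly cst p).[z] p.[c].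
Proof.
move=> h; elim/poly_ind: p => [|p d IH]; first by rewrite rmorph0 !horner0 -(rmorph0 cst); apply: residue_cst.
rewrite rmorphD rmorphM /= map_polyX map_polyC !hornerE.
by apply: residueD (residue_cst d); apply: residueM.
Qed.

Definition uniformizer (u : K) : Prop :=
  [/\ u != 0, u \in max_ideal O & forall z, z != 0 ->
    exists n : int, exists w, [/\ w \in O, w \notin max_ideal O & z = w * u ^ n]].
End ValuationRing.

Section Rational.
Variables (F K : fieldType) (cst : {rmorphism F -> K}).

Lemma rational_points_val O : rational_points cst O -> valuation_ring cst O.
Proof. by case. Qed.

Lemma rational_points_res O z : rational_points cst O -> z \in O -> exists c, residue cst O z c.
Proof. by move=> [_ h] /h. Qed.

(** A discrete valuation ring is maximal: any element outside [O] would bring [u^-1], and with it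
    the whole field, into [O']. Equality of places thus reduces to one inclusion. *)
Lemma uniformizer_max (O O' : K -> bool) (u : K) :
  valuation_ring cst O -> uniformizer O u -> valuation_ring cst O' ->
  (forall z, z \in O -> z \in O') -> O = O'.
Proof.
move=> vO [u0 um hu] vO' sub; apply/funext => z; rewrite -[O z]/(z \in O) -[O' z]/(z \in O').
apply/idP/idP => [|zO']; first exact: sub.
have uO' : u \in O' by apply/sub/(max_sub vO).
have [-> | z0] := eqVneq z 0; first exact: (val_0 vO).
have [n [w [wO wm zE]]] := hu z z0; have [w0 wV] := val_unit wO wm.
case: n zE => n zE; first by rewrite zE (val_M vO) // -exprnP (val_X vO) // (max_sub vO).
have uV : u^-1 \in O'.
  have -> : u^-1 = z * w^-1 * u ^+ n.
    by rewrite zE NegzE -exprnN exprSr; field; rewrite u0 w0 expf_neq0.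
  by rewrite !(val_M vO') // ?(val_X vO') //; exact: sub.
have [y] := val_nontrivial vO'; case/negP.
have [-> | y0] := eqVneq y 0; first exact: (val_0 vO').
have [k [v [vO2 _ ->]]] := hu y y0; rewrite (val_M vO') //; first exact: sub.
by case: k => k; rewrite ?NegzE -?exprnN -?exprVn -?exprnP (val_X vO').
Qed.
End Rational.

(* [e] is the graph of an evaluation homomorphism from a subring of [K] to [F]; the ring
   of the place is the localization of that subring at the kernel. *)
Lemma local_ring (F K : fieldType) (cst : {rmorphism F -> K}) (e : K -> F -> Prop) (u : K) :
  (forall c, e (cst c) c) ->
  (forall z w c d, e z c -> e w d -> e (z - w) (c - d)) ->
  (forall z w c d, e z c -> e w d -> e (z * w) (c * d)) ->
  (forall c, e 0 c -> c = 0) -> u != 0 -> e u 0 ->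
  (forall z, z != 0 -> exists (n : int) g h c d,
    [/\ e g c, e h d, c != 0, d != 0 & z = g / h * u ^ n]) ->
  exists O : K -> bool, [/\ rational_points cst O, uniformizer O u,
    forall z c, e z c -> residue cst O z c &
    forall O', rational_points cst O' -> (forall z c, e z c -> residue cst O' z c) -> O' = O].
Proof.
move=> eC eB eM e0 u0 eu edec.
pose P z := exists g h c d, [/\ e g c, e h d, d != 0 & z = g / h].
pose O z := `[< P z >].
have OP z : z \in O -> P z by move/asboolP.
have PO g h c d : e g c -> e h d -> d != 0 -> g / h \in O.
  by move=> eg eh d0; apply/asboolP; exists g, h, c, d.
have e1 : e 1 1 by rewrite -[X in e X _](rmorph1 cst); apply: eC.
have eX z c n : e z c -> e (z ^+ n) (c ^+ n).
  by move=> h; elim: n => [|n IH]; rewrite ?expr0 // !exprS; apply: eM.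
have enz h d : e h d -> d != 0 -> h != 0.
  by move=> eh; apply: contra => /eqP h0; rewrite h0 in eh; rewrite (e0 _ eh).
have emax z : e z 0 -> z \in max_ideal O.
  move=> ez; rewrite inE; have [//|z0 /=] := eqVneq z 0.
  apply/negP => /OP[g [h [c [d [eg eh d0 E]]]]].
  have hE : h = z * g by rewrite -[g](divfK (enz _ _ eh d0)) -E mulVKf.
  have : e (h - z * g) (d - 0 * c) by apply: eB => //; apply: eM.
  by rewrite hE subrr mul0r subr0 => /e0 dd; rewrite dd eqxx in d0.
have vO : valuation_ring cst O.
  split.
  - split=> [|z w /OP[g [h [c [d [eg eh d0 ->]]]]] /OP[g' [h' [c' [d' [eg' eh' d0' ->]]]]]
      |z w /OP[g [h [c [d [eg eh d0 ->]]]]] /OP[g' [h' [c' [d' [eg' eh' d0' ->]]]]]].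
    + by rewrite -(divr1 1); exact: (PO _ _ _ _ e1 e1 (oner_neq0 _)).
    + have -> : g / h - g' / h' = (g * h' - g' * h) / (h * h').
        by field; rewrite (enz _ _ eh d0) (enz _ _ eh' d0').
      exact: (PO _ _ _ _ (eB _ _ _ _ (eM _ _ _ _ eg eh') (eM _ _ _ _ eg' eh)) (eM _ _ _ _ eh eh') (mulf_neq0 d0 d0')).
    + have -> : g / h * (g' / h') = (g * g') / (h * h').
        by field; rewrite (enz _ _ eh d0) (enz _ _ eh' d0').
      exact: (PO _ _ _ _ (eM _ _ _ _ eg eg') (eM _ _ _ _ eh eh') (mulf_neq0 d0 d0')).
  - by move=> c; rewrite -(divr1 (cst c)); exact: (PO _ _ _ _ (eC c) e1 (oner_neq0 _)).
  - by exists u^-1; have := emax _ eu; rewrite inE (negbTE u0).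
  move=> z z0; have [n [g [h [c [d [eg eh c0 d0 ->]]]]]] := edec z z0.
  have [g0 h0] := (enz _ _ eg c0, enz _ _ eh d0).
  case: n => n; apply/orP; [left|right].
    have -> : g / h * u ^ n = (g * u ^+ n) / h by rewrite -exprnP; field.
    exact: PO (eM _ _ _ _ eg (eX _ _ n eu)) eh d0.
  have -> : (g / h * u ^ (Negz n))^-1 = (h * u ^+ n.+1) / g.
    by rewrite NegzE -exprnN; move: (expf_neq0 n.+1 u0) => un0; field; rewrite g0 h0 un0.
  exact: PO (eM _ _ _ _ eh (eX _ _ n.+1 eu)) eg c0.
have eres z c : e z c -> residue cst O z c.
  by move=> ez; apply: emax; rewrite -(subrr c); apply: eB.
have rO : rational_points cst O.
  split=> // z /OP[g [h [c [d [eg eh d0 ->]]]]]; exists (c / d).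
  exact: (residueM vO (eres _ _ eg) (residueV vO (eres _ _ eh) d0)).
have uO : uniformizer O u.
  split=> //; first exact: emax.
  move=> z z0; have [n [g [h [c [d [eg eh c0 d0 ->]]]]]] := edec z z0.
  exists n, (g / h); split=> //; first exact: PO eg eh d0.
  rewrite inE negb_or negbK (_ : (g / h)^-1 = h / g) ?(PO _ _ _ _ eh eg c0) ?andbT; last first.
    by rewrite invfM invrK mulrC.
  by rewrite mulf_neq0 ?invr_eq0 ?(enz _ _ eg c0) ?(enz _ _ eh d0).
exists O; split=> // O' rO' h; apply/esym/(uniformizer_max vO uO (rational_points_val rO')).
move=> z /OP[g [k [c [d [eg ek d0 ->]]]]].
have vO' := rational_points_val rO'.
rewrite (val_M vO') ?(residue_val vO' (h _ _ eg)) //.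
by have [] := residue_unit vO' (h _ _ ek) d0.
Qed.

Lemma transcendental_horner (F K : fieldType) (cst : {rmorphism F -> K}) (x : K) (p : {poly F}) :
  ~ algebraicOver cst x -> (map_poly cst p).[x] = 0 -> p = 0.
Proof.
move=> tx px; apply/eqP; apply: contra_notT tx => p0.
by exists p => //; rewrite rootE px.
Qed.

Lemma rational_function_place (F L : fieldType) (cst : {rmorphism F -> L}) (x : L) (a : F) :
  ~ algebraicOver cst x ->
  (forall z, exists p q : {poly F}, z = (map_poly cst p).[x] / (map_poly cst q).[x]) ->
  exists O : L -> bool, [/\ rational_points cst O, uniformizer O (x - cst a),
    residue cst O x a &
    forall O', rational_points cst O' -> residue cst O' x a -> O' = O].
Proof.
move=> tx gen; pose ev p := (map_poly cst p).[x].
have ev0 p : ev p = 0 -> p = 0 by exact: transcendental_horner.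
have evX : ev ('X - a%:P) = x - cst a by rewrite /ev rmorphB /= map_polyX map_polyC /= !hornerE.
pose e z c := exists p, z = ev p /\ c = p.[a].
have [|||||||O [rO uO eO OO]] := @local_ring F L cst e (x - cst a).
- by move=> c; exists c%:P; rewrite /ev map_polyC !hornerE.
- move=> _ _ _ _ [p [-> ->]] [q [-> ->]]; exists (p - q).
  by rewrite /ev rmorphB !hornerE.
- move=> _ _ _ _ [p [-> ->]] [q [-> ->]]; exists (p * q).
  by rewrite /ev rmorphM !hornerE.
- by move=> c [p [/esym/ev0 -> ->]]; rewrite horner0.
- by rewrite -evX; apply/eqP => /ev0/eqP; rewrite polyXsubC_eq0.
- by exists ('X - a%:P); rewrite evX !hornerE subrr.
- move=> z z0; have [p [q zE]] := gen z.
  have q0 : q != 0 by apply: contraNneq z0 => q0; rewrite zE q0 rmorph0 horner0 invr0 mulr0.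
  have p0 : p != 0 by apply: contraNneq z0 => p0; rewrite zE p0 rmorph0 horner0 mul0r.
  have [m [p1]] := multiplicity_XsubC p a; rewrite p0 /= => rp pE.
  have [n [q1]] := multiplicity_XsubC q a; rewrite q0 /= => rq qE.
  have u0 : x - cst a != 0 by rewrite -evX; apply/eqP => /ev0/eqP; rewrite polyXsubC_eq0.
  exists (m%:Z - n%:Z), (ev p1), (ev q1), p1.[a], q1.[a]; split=> //; try by [exists p1|exists q1].
  have evM r k : ev (r * ('X - a%:P) ^+ k) = ev r * (x - cst a) ^+ k.
    by rewrite -evX /ev rmorphM rmorphXn hornerM horner_exp.
  rewrite expfzDr // -exprnP -exprnN zE -/(ev p) -/(ev q) pE qE !evM invfM.
  by rewrite mulrACA.
exists O; split=> //; first by apply: eO; exists 'X; rewrite /ev map_polyX !hornerX.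
move=> O' rO' xa; apply: OO => // _ _ [p [-> ->]].
exact: (residue_horner (rational_points_val rO')).
Qed.

(** * Places in a quadratic extension *)

Section QuadraticStep.
Variables (F L K : fieldType) (cL : {rmorphism F -> L}) (cK : {rmorphism F -> K}).
Variables (j : {rmorphism L -> K}) (y : K) (d : L).
Hypotheses (jc : forall c, j (cL c) = cK c) (yd : y ^+ 2 = j d).
Hypothesis gen : forall z, exists a b, z = j a + j b * y.

Lemma restrict_place O : rational_points cK O -> rational_points cL (O \o j).
Proof.
move=> rO; have vO := rational_points_val rO.
have memE a : (a \in O \o j) = (j a \in O) by [].
have maxE a : (a \in max_ideal (O \o j)) = (j a \in max_ideal O).
  by rewrite !inE fmorph_eq0 -fmorphV.
split.
  split.
  - split; first by rewrite memE rmorph1; exact: (val_1 vO).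
    + by move=> a b ha hb; rewrite memE rmorphB; exact: (val_B vO).
    + by move=> a b ha hb; rewrite memE rmorphM; exact: (val_M vO).
  - by move=> c; rewrite memE jc; exact: (val_cst vO).
  (* If [O] contained all of [L], it would contain [y], whose square lies in [L], and hence all of
     [K]. *)
  - apply/not_existsP => hj; have {}hj a : j a \in O by have := hj a => /negP; rewrite negbK.
    have [z] := val_nontrivial vO; case/negP; have [a [b ->]] := gen z.
    rewrite (val_D vO) ?(val_M vO) ?hj //; apply: (val_sqr vO); rewrite yd; exact: hj.
  move=> a a0; have [_ _ _ /(_ (j a))] := vO; rewrite fmorph_eq0 => /(_ a0).
  by rewrite -fmorphV.
move=> a aO; have [c hc] := rational_points_res rO aO; exists c.
by rewrite maxE rmorphB jc.
Qed.

Lemma restrict_residue O a c : residue cL (O \o j) a c <-> residue cK O (j a) c.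
Proof. by rewrite /residue !inE -jc -rmorphB fmorph_eq0 -fmorphV. Qed.

Hypothesis two0 : 2 != 0 :> F.
Hypothesis yL : forall a, y <> j a.

Lemma quad_decomp_uniq a b : j a + j b * y = 0 -> a = 0 /\ b = 0.
Proof.
have [->|b0] := eqVneq b 0; first by rewrite rmorph0 mul0r addr0 => /eqP; rewrite fmorph_eq0 => /eqP.
move=> h; have := @yL (- (a / b)); case.
rewrite rmorphN fmorph_div; apply: (mulfI (_ : j b != 0)); first by rewrite fmorph_eq0.
by rewrite mulrN mulrCA divff ?fmorph_eq0 // mulr1 -[RHS]addr0 -h; ring.
Qed.

(** For [r != 0] the place is unramified and [u] remains a uniformizer. For [r = 0] the condition on
    [d] says that it is itself a uniformizer, so the extension ramifies and [y] takes over. *)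
Lemma quadratic_place (O : L -> bool) (u : L) (r : F) :
  rational_points cL O -> uniformizer O u -> residue cL O d (r ^+ 2) ->
  (r = 0 -> exists w om, [/\ d = u * w, residue cL O w om & om != 0]) ->
  exists O' : K -> bool, [/\ rational_points cK O', uniformizer O' (if r == 0 then y else j u),
    O' \o j = O, residue cK O' y r &
    forall O2, rational_points cK O2 -> O2 \o j = O -> residue cK O2 y r -> O2 = O'].
Proof.
move=> rO uO dr hr0; have vO := rational_points_val rO.
have [u0 um udec] := uO.
pose e z c := exists a b al be, [/\ z = j a + j b * y, residue cL O a al,
   residue cL O b be & c = al + be * r].
pose v := if r == 0 then y else j u.
have eE a b al be : residue cL O a al -> residue cL O b be -> e (j a + j b * y) (al + be * r).
  by move=> ha hb; exists a, b, al, be.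
have res00 : residue cL O 0 0 by rewrite /residue rmorph0 subrr inE eqxx.
have eJ a al : residue cL O a al -> e (j a) al.
  by move=> ha; have := eE _ _ _ _ ha res00; rewrite rmorph0 !mul0r !addr0.
have ey : e y r.
  by have := eE _ _ _ _ res00 (residue1 cL O); rewrite rmorph0 rmorph1 !mul1r !add0r.
have eM z w c c' : e z c -> e w c' -> e (z * w) (c * c').
  move=> [a [b [al [be [-> ha hb ->]]]]] [a' [b' [al' [be' [-> ha' hb' ->]]]]].
  have := eE _ _ _ _ (residueD vO (residueM vO ha ha') (residueM vO (residueM vO hb hb') dr))
    (residueD vO (residueM vO ha hb') (residueM vO ha' hb)).
  rewrite !rmorphD !rmorphM -yd; congr e; ring.
have e0 c : e 0 c -> c = 0.
  move=> [a [b [al [be [/esym/quad_decomp_uniq[-> ->] ha hb ->]]]]].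
  by rewrite (residue_uniq vO ha res00) (residue_uniq vO hb res00) mul0r addr0.
have y0 : y != 0 by apply/eqP => y0; apply: (@yL 0); rewrite rmorph0.
have v0 : v != 0 by rewrite /v; case: ifP => _ //; rewrite fmorph_eq0.
have ev : e v 0.
  by rewrite /v; case: eqP => [<- //|_]; apply/eJ/(residue0 cL).
have e1 : e 1 1 by rewrite -(rmorph1 j); apply/eJ/(residue1 cL O).
have edec z : z != 0 -> exists (n : int) g h c c',
    [/\ e g c, e h c', c != 0, c' != 0 & z = g / h * v ^ n].
  (* The power of [u] in the less divisible of the two coefficients is pulled out, which leaves
     integral coefficients with residues not both 0. *)
  move=> z0; have [k [a [b [al [be [zE ha hb hab]]]]]] : exists (k : int) a b al be,
     [/\ z = (j a + j b * y) * j u ^ k, residue cL O a al, residue cL O b be & (al != 0) || (be != 0)].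
    have unit_res w : w \in O -> w \notin max_ideal O -> exists2 c, residue cL O w c & c != 0.
      move=> wO wm; have [c hc] := rational_points_res rO wO; exists c => //.
      by apply: contra wm => /eqP c0; rewrite c0 in hc; apply/(residue0 cL).
    have [a [b zE]] := gen z.
    have [b0|b0] := eqVneq b 0.
      have a0 : a != 0 by apply: contraNneq z0 => a0; rewrite zE a0 b0 rmorph0 mul0r addr0.
      have [n [w [wO wm aE]]] := udec a a0; have [c hc c0] := unit_res w wO wm.
      by exists n, w, 0, c, 0; split=> //; rewrite ?c0 // zE aE b0 !rmorph0 !mul0r !addr0 rmorphM fmorphXz.
    have [a0|a0] := eqVneq a 0.
      have [n [w [wO wm bE]]] := udec b b0; have [c hc c0] := unit_res w wO wm.
      exists n, 0, w, 0, c; split=> //; rewrite ?c0 ?orbT //.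
      by rewrite zE bE a0 !rmorph0 !add0r rmorphM fmorphXz mulrAC.
    have [_ _ _ /(_ (a / b))] := vO; rewrite mulf_neq0 ?invr_eq0 // invfM invrK => /(_ isT)/orP[] q.
      have [n [w [wO wm bE]]] := udec b b0; have [c hc c0] := unit_res w wO wm.
      have [c' hc'] := rational_points_res rO q.
      exists n, (a / b * w), w, (c' * c), c; split=> //; rewrite ?c0 ?orbT //; last exact: (residueM vO hc' hc).
      rewrite zE -{1}(divfK b0 a); move: (a / b) => t; rewrite bE !rmorphM fmorphXz; ring.
    have [n [w [wO wm aE]]] := udec a a0; have [c hc c0] := unit_res w wO wm.
    have [c' hc'] := rational_points_res rO q.
    exists n, w, (a^-1 * b * w), c, (c' * c); split=> //; rewrite ?c0 ?orbT //; last exact: (residueM vO hc' hc).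
    have bE : b = (a^-1 * b) * a by field.
    rewrite zE {1}bE; move: (a^-1 * b) => t; rewrite aE !rmorphM fmorphXz; ring.
  have zab0 : j a + j b * y != 0 by apply: contraNneq z0 => h; rewrite zE h mul0r.
  rewrite /v; case: eqP => [r0|/eqP r0].
    have [w [om [dE hw om0]]] := hr0 r0.
    have w0 : w != 0 by have [] := residue_unit vO hw om0.
    have uE : j u = y ^+ 2 / j w.
      by rewrite yd dE rmorphM mulfK // fmorph_eq0.
    have hwk : e (j (w ^ (- k))) (om ^ (- k)).
      apply: eJ; case: (- k) => n; first by elim: n => [|n IH]; [exact: (residue1 cL O)|rewrite -!exprnP !exprS; exact: (residueM vO)].
      rewrite NegzE -!exprnN; apply: (residueV vO); last by rewrite expf_neq0.
      by elim: n => [|n IH]; [rewrite !expr1|rewrite exprS [om ^+ _]exprS; exact: (residueM vO)].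
    have uk : j u ^ k = j (w ^ (- k)) * y ^ (2 * k).
      rewrite uE expfzMl mulrC exprz_inv fmorphXz; congr (_ * _).
      by rewrite -exprz_exp.
    have omk : om ^ (- k) != 0 by rewrite expfz_neq0.
    (* Ramified case: [j a + j b * y] has residue [al]. If this is 0, then [a = u a2] with
       [u = y^2 / w], and taking out one factor [y] leaves the residue [be]. *)
    have [al0|al0] := eqVneq al 0; last first.
      exists (2 * k), ((j a + j b * y) * j (w ^ (- k))), 1, (al * om ^ (- k)), 1; split=> //.
      - by apply: eM => //; have := eE _ _ _ _ ha hb; rewrite r0 mulr0 addr0.
      - by rewrite mulf_neq0.
      - exact: oner_neq0.
      by rewrite zE uk divr1 mulrA.
    rewrite al0 eqxx /= in hab; rewrite al0 in ha.
    have [a2 aE a2O] : exists2 a2, a = u * a2 & a2 \in O.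
      have [->|a0] := eqVneq a 0; first by exists 0; rewrite ?mulr0 ?(val_0 vO).
      have [n [t [tO tm aE]]] := udec a a0; have am : a \in max_ideal O by apply/(residue0 cL).
      case: n aE => [[|n]|n] aE.
      - by rewrite aE mulr1 (negbTE tm) in am.
      - exists (t * u ^+ n); first by rewrite aE -exprnP exprS mulrCA.
        by rewrite (val_M vO) // (val_X vO) // (max_sub vO).
      case/negP: tm; have -> : t = a * u ^+ n.+1.
        by rewrite aE NegzE -exprnN mulfVK // expf_neq0.
      by rewrite (max_M vO) // (val_X vO) // (max_sub vO).
    have [rho hrho] := rational_points_res rO a2O.
    exists (2 * k + 1), ((j b + j (a2 / w) * y) * j (w ^ (- k))), 1, (be * om ^ (- k)), 1; split=> //.
    - apply: eM => //; have := eE _ _ _ _ hb (residueM vO hrho (residueV vO hw om0)).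
      by rewrite r0 mulr0 addr0.
    - by rewrite mulf_neq0.
    - exact: oner_neq0.
    rewrite zE uk divr1 aE expfzDr // expr1z rmorphM uE fmorph_div.
    by field; rewrite fmorph_eq0.
  (* Unramified case: if the residue vanishes, that of the conjugate does not, as 2 and [r] are
     nonzero. The element is then its norm, which lies in [L], divided by the conjugate. *)
  have [s0|s0] := eqVneq (al + be * r) 0; last first.
    by exists k, (j a + j b * y), 1, (al + be * r), 1; rewrite divr1 oner_neq0; split=> //; apply: eE.
  have s1 : al + (- be) * r != 0.
    apply/eqP => s1; have al0 : al = 0.
      apply: (mulfI two0); rewrite mulr0 -[RHS]addr0 -{1}s0 -s1; ring.
    move: s0 hab; rewrite al0 eqxx add0r /= => /eqP; rewrite mulf_eq0 (negbTE r0) orbF => /eqP ->.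
    by rewrite eqxx.
  pose z' := j a + j (- b) * y.
  have z'0 : z' != 0.
    apply/eqP => /quad_decomp_uniq[a0 /eqP]; rewrite oppr_eq0 => /eqP b0.
    by case/eqP: zab0; rewrite a0 b0 rmorph0 mul0r addr0.
  have zN : (j a + j b * y) * z' = j (a ^+ 2 - b ^+ 2 * d).
    by rewrite /z' rmorphN rmorphB [j (_ * d)]rmorphM !rmorphXn -yd; ring.
  have N0 : a ^+ 2 - b ^+ 2 * d != 0 by rewrite -(fmorph_eq0 j) -zN mulf_neq0.
  have [n [w [wO wm NE]]] := udec _ N0.
  have [om hom] := rational_points_res rO wO.
  exists (n + k), (j w), z', om, (al + - be * r); split=> //.
  - exact: eJ.
  - exact: (eE _ _ _ _ ha (residueN vO hb)).
  - by apply: contra wm => /eqP om0; rewrite om0 in hom; apply/(residue0 cL).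
  rewrite zE expfzDr ?fmorph_eq0 // mulrA; congr (_ * _).
  apply: (mulIf z'0); rewrite zN NE rmorphM fmorphXz mulrAC divfK //.
have [|||||||O' [rO' uO' resO' unO']] := @local_ring F K cK e v.
- by move=> c; rewrite -jc; apply/eJ/residue_cst.
- move=> _ _ _ _ [a [b [al [be [-> ha hb ->]]]]] [a' [b' [al' [be' [-> ha' hb' ->]]]]].
  have := eE _ _ _ _ (residueB vO ha ha') (residueB vO hb hb').
  rewrite !rmorphB; congr e; ring.
- exact: eM.
- exact: e0.
- exact: v0.
- exact: ev.
- exact: edec.
have O'j : O' \o j = O.
  have rOj := restrict_place rO'.
  apply/esym/(uniformizer_max vO uO (rational_points_val rOj)) => a aO.
  have [c hc] := rational_points_res rO aO.
  exact: (residue_val (rational_points_val rO') (resO' _ _ (eJ _ _ hc))).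
exists O'; split=> //; first exact: resO'.
move=> O2 rO2 O2j resy; apply: unO' => // _ _ [a [b [al [be [-> ha hb ->]]]]].
have vO2 := rational_points_val rO2; rewrite -O2j in ha hb.
apply: (residueD vO2); first exact/restrict_residue.
by apply: (residueM vO2) resy; apply/restrict_residue.
Qed.
End QuadraticStep.

(** * The tower of function fields *)

Section SubfieldType.
Variables (K : fieldType) (S : {pred K}) (hS : divring_closed S).
(** The proof argument keeps [hS] inside the term, so that the closure instance can be attached to
    it and inferred. *)
Definition subfield_pred of divring_closed S : {pred K} := S.
HB.instance Definition _ := GRing.isDivringClosed.Build K (subfield_pred hS) hS.
Record subfield_sort := SubfieldSort {
  subfield_val : K; _ : subfield_val \in subfield_pred hS }.
HB.instance Definition _ := [isSub for subfield_val].
HB.instance Definition _ := [Choice of subfield_sort by <:].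
HB.instance Definition _ := [SubChoice_isSubIntegralDomain of subfield_sort by <:].
HB.instance Definition _ := [SubIntegralDomain_isSubField of subfield_sort by <:].
End SubfieldType.

Lemma subfield_type (K : fieldType) (S : {pred K}) : divring_closed S ->
  exists (L : fieldType) (i : {rmorphism L -> K}), forall z, z \in S <-> exists a, z = i a.
Proof.
move=> hS; exists (subfield_sort hS), [the {rmorphism _ -> _} of val] => z.
by split=> [zS|[[a aS] ->]] //; exists (SubfieldSort (zS : z \in subfield_pred hS)).
Qed.

Lemma factor_rmorphism (A L K : fieldType) (i : {rmorphism A -> K}) (j : {rmorphism L -> K}) :
  (forall a, exists b, i a = j b) -> exists k : {rmorphism A -> L}, forall a, j (k a) = i a.
Proof.
move=> /choice[k hk].
have kB : zmod_morphism k by move=> a b; apply: (fmorph_inj j); rewrite rmorphB -!hk rmorphB.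
have kM : monoid_morphism k.
  by split=> [|a b]; apply: (fmorph_inj j); rewrite ?rmorph1 ?rmorphM -!hk ?rmorph1 ?rmorphM.
pose k' : {rmorphism A -> L} := HB.pack k (GRing.isZmodMorphism.Build A L k kB)
  (GRing.isMonoidMorphism.Build A L k kM).
by exists k' => a; rewrite -hk.
Qed.

Lemma divring_closedP (K : fieldType) (S : {pred K}) :
  1 \in S -> (forall z w, z \in S -> w \in S -> z - w \in S) ->
  (forall z w, z \in S -> w \in S -> z * w \in S) ->
  (forall z, z \in S -> z^-1 \in S) -> divring_closed S.
Proof. by move=> S1 SB SM SV; split=> // z w zS wS; apply/SM/SV. Qed.

Lemma quadratic_subfield (L K : fieldType) (j : {rmorphism L -> K}) (y : K) (d : L) :
  y ^+ 2 = j d -> (forall a, y <> j a) ->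
  divring_closed [pred z | `[< exists a b, z = j a + j b * y >]].
Proof.
move=> yd yL.
have mem a b : j a + j b * y \in [pred z | `[< exists a b, z = j a + j b * y >]].
  by apply/asboolP; exists a, b.
apply: divring_closedP.
- by have := mem 1 0; rewrite rmorph1 rmorph0 mul0r addr0.
- move=> _ _ /asboolP[a [b ->]] /asboolP[a' [b' ->]].
  have -> : j a + j b * y - (j a' + j b' * y) = j (a - a') + j (b - b') * y by rewrite !rmorphB; ring.
  exact: mem.
- move=> _ _ /asboolP[a [b ->]] /asboolP[a' [b' ->]].
  have -> : (j a + j b * y) * (j a' + j b' * y) = j (a * a' + b * b' * d) + j (a * b' + a' * b) * y.
    by rewrite !rmorphD !rmorphM -yd; ring.
  exact: mem.
move=> z /asboolP[a [b zE]].
have [z0|z0] := eqVneq z 0; first by rewrite z0 invr0; have := mem 0 0; rewrite !rmorph0 mul0r addr0.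
have N0 : a ^+ 2 - b ^+ 2 * d != 0.
  apply: contraNneq z0 => N0.
  apply/eqP; rewrite zE; suff [-> ->] : a = 0 /\ b = 0 by rewrite !rmorph0 mul0r addr0.
  have [z'0|z'0] := eqVneq (j a + j (- b) * y) 0.
    by have [-> /eqP] := quad_decomp_uniq yL z'0; rewrite oppr_eq0 => /eqP ->.
  apply: (quad_decomp_uniq yL); apply: (mulIf z'0).
  rewrite mul0r -(rmorph0 j) -N0 rmorphN rmorphB [j (_ * d)]rmorphM !rmorphXn -yd; ring.
have -> : z^-1 = j (a / (a ^+ 2 - b ^+ 2 * d)) + j (- b / (a ^+ 2 - b ^+ 2 * d)) * y.
  apply: (mulfI z0); rewrite divff // zE !fmorph_div rmorphN.
  have jN : j (a ^+ 2 - b ^+ 2 * d) = (j a + j b * y) * (j a - j b * y).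
    by rewrite rmorphB [j (_ * d)]rmorphM !rmorphXn -yd; ring.
  have n0 : j (a ^+ 2 - b ^+ 2 * d) != 0 by rewrite fmorph_eq0.
  apply: (mulIf n0); move: (j (a ^+ 2 - b ^+ 2 * d)) n0 jN => n n0 jN.
  rewrite mul1r {1}jN; field.
  exact: n0.
exact: mem.
Qed.

Definition simple_root (F : fieldType) (f : {poly F}) (a : F) : Prop :=
  exists2 g, f = ('X - a%:P) * g & g.[a] != 0.

(** The multiplicity of [a] is odd on the left and even on the right. *)
Lemma simple_root_nonsquare (F : fieldType) (f p q : {poly F}) (a : F) :
  simple_root f a -> q != 0 -> f * q ^+ 2 <> p ^+ 2.
Proof.
move=> [g -> ga] q0 E.
have g0 : g != 0 by apply: contraNneq ga => ->; rewrite horner0.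
have X0 := polyXsubC_eq0 a.
have p0 : p != 0.
  by rewrite -sqrf_eq0 -E !mulf_neq0 ?expf_neq0 // X0.
have mX : mup a ('X - a%:P) = 1%N by rewrite -[_ - _]expr1 mup_XsubCX eqxx.
have := congr1 (mup a) E; rewrite !expr2 !mupM ?mulf_neq0 ?X0 // mX.
rewrite (_ : mup a g = 0%N) //; last first.
  apply/eqP; rewrite -leqn0 mup_leq // expr1; apply: contra ga => /dvdpP[h ->].
  by rewrite !hornerE subrr mulr0.
by lia.
Qed.

Section FibreTower.
Variables (F K : fieldType) (cst : {rmorphism F -> K}) (x y1 y2 : K) (f1 f2 : {poly F}).
Hypotheses (tx : ~ algebraicOver cst x)
  (y1E : y1 ^+ 2 = (map_poly cst f1).[x]) (y2E : y2 ^+ 2 = (map_poly cst f2).[x]).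
Hypothesis gen : forall S : {pred K}, divring_closed S -> (forall c, cst c \in S) ->
  x \in S -> y1 \in S -> y2 \in S -> forall z, z \in S.
Hypothesis two0 : 2 != 0 :> F.
Variables (rho1 rho2 : F).
Hypotheses (simple1 : simple_root f1 rho1) (simple2 : simple_root f2 rho2).
Hypothesis (f2rho1 : f2.[rho1] != 0).

(** Degree 4 over [F(x)] requires [f1], [f2] and [f1 * f2] to be non-squares. The simple roots
    [rho1] and [rho2] witness this, [rho1] also for the product because [f2] does not vanish
    there. *)
Lemma fibre_tower : exists (L0 L1 : fieldType) (c0 : {rmorphism F -> L0}) (c1 : {rmorphism F -> L1})
  (j : {rmorphism L0 -> L1}) (i : {rmorphism L1 -> K}) (x0 : L0) (y : L1),
  [/\ [/\ ~ algebraicOver c0 x0,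
      forall z, exists p q, z = (map_poly c0 p).[x0] / (map_poly c0 q).[x0],
      forall c, j (c0 c) = c1 c, forall c, i (c1 c) = cst c & i (j x0) = x],
    i y = y1,
    (forall z, exists a b, z = j a + j b * y) /\ (forall a, y <> j a) &
    (forall z, exists a b, z = i a + i b * y2) /\ (forall a, y2 <> i a)].
Proof.
pose ev p := (map_poly cst p).[x].
have evB p q : ev (p - q) = ev p - ev q by rewrite /ev rmorphB !hornerE.
have evM p q : ev (p * q) = ev p * ev q by rewrite /ev rmorphM !hornerE.
have evC c : ev c%:P = cst c by rewrite /ev map_polyC !hornerE.
have evX : ev 'X = x by rewrite /ev map_polyX hornerX.
have ev_inj p q : ev p = ev q -> p = q.
  move=> /eqP; rewrite -subr_eq0 -evB => /eqP h; apply/eqP; rewrite -subr_eq0; apply/eqP.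
  exact: transcendental_horner tx h.
have ev0 p : p != 0 -> ev p != 0.
  by apply: contraNneq => h; apply/eqP/ev_inj; rewrite h /ev rmorph0 horner0.
pose S0 := [pred z : K | `[< exists p q, z = ev p / ev q >]].
have S0P p q : ev p / ev q \in S0 by apply/asboolP; exists p, q.
have ev1 : ev 1 = 1 by rewrite -(polyC1 F) evC rmorph1.
have S0c : divring_closed S0.
  apply: divring_closedP.
  - by have := S0P 1 1; rewrite ev1 divr1.
  - move=> z w /asboolP[p [q zE]] /asboolP[p' [q' wE]].
    have [q0|q0] := eqVneq q 0.
      have -> : z - w = ev (- p') / ev q'.
        by rewrite zE q0 /ev rmorph0 horner0 invr0 mulr0 sub0r wE rmorphN hornerN mulNr.
      exact: S0P.
    have [q'0|q'0] := eqVneq q' 0.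
      have -> : z - w = ev p / ev q.
        by rewrite wE q'0 /ev rmorph0 horner0 invr0 mulr0 subr0 zE.
      exact: S0P.
    have -> : z - w = ev (p * q' - p' * q) / ev (q * q').
      by rewrite zE wE evB !evM; field; rewrite !ev0.
    exact: S0P.
  - move=> _ _ /asboolP[p [q ->]] /asboolP[p' [q' ->]].
    by rewrite mulrACA -invfM -!evM.
  by move=> _ /asboolP[p [q ->]]; rewrite invfM invrK mulrC.
have [L0 [i0 i0P]] := subfield_type S0c.
have [|c0 c0E] := @factor_rmorphism F L0 K cst i0.
  by move=> c; apply/i0P; rewrite -(divr1 (cst c)) -evC -ev1.
have [x0 x0E] : exists a, x = i0 a by apply/i0P; rewrite -(divr1 x) -evX -ev1.
have i0ev p : i0 (map_poly c0 p).[x0] = ev p.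
  rewrite -horner_map /= -x0E /ev -map_poly_comp; congr (_.[_]).
  by apply: eq_map_poly => c; rewrite /= c0E.
have gen0 z : exists p q, z = (map_poly c0 p).[x0] / (map_poly c0 q).[x0].
  have /asboolP[p [q zE]] : i0 z \in S0 by apply/i0P; exists z.
  by exists p, q; apply: (fmorph_inj i0); rewrite fmorph_div !i0ev.
have frac_eq (a : L0) : exists p q, q != 0 /\ i0 a * ev q = ev p.
  have [p [q ->]] := gen0 a; have [q0|q0] := eqVneq q 0.
    by exists 0, 1; rewrite oner_neq0 q0 rmorph0 horner0 invr0 mulr0 rmorph0 mul0r /ev rmorph0 horner0.
  by exists p, q; split=> //; rewrite fmorph_div !i0ev divfK // ev0.
have y1L a : y1 <> i0 a.
  move=> h; have [p [q [q0 E]]] := frac_eq a; apply: (simple_root_nonsquare (p := p) simple1 q0).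
  by apply: ev_inj; rewrite evM !expr2 !evM -E -h -/(ev f1) {1}/ev -y1E; ring.
have y1d : y1 ^+ 2 = i0 (map_poly c0 f1).[x0] by rewrite y1E i0ev.
have [L1 [i1 i1P]] := subfield_type (quadratic_subfield y1d y1L).
have i1P' a b : exists z, i0 a + i0 b * y1 = i1 z by apply/i1P/asboolP; exists a, b.
have [|j jE] := @factor_rmorphism L0 L1 K i0 i1.
  by move=> a; have := i1P' a 0; rewrite rmorph0 mul0r addr0.
have [y yE] : exists z, y1 = i1 z by have := i1P' 0 1; rewrite rmorph0 rmorph1 mul1r add0r.
pose c1 : {rmorphism F -> L1} := [the {rmorphism _ -> _} of j \o c0].
have gen1 z : exists a b, z = j a + j b * y.
  have /asboolP[a [b zE]] : i1 z \in [pred z | `[< exists a b, z = i0 a + i0 b * y1 >]] by apply/i1P; exists z.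
  by exists a, b; apply: (fmorph_inj i1); rewrite rmorphD rmorphM !jE -yE.
have yL a : y <> j a by move=> h; apply: (y1L a); rewrite yE h jE.
have yd : y ^+ 2 = j (map_poly c0 f1).[x0] by apply: (fmorph_inj i1); rewrite rmorphXn -yE y1d jE.
have L20 : 2 != 0 :> L0 by have := two0; rewrite -(fmorph_eq0 c0) rmorph_nat.
have y2L a : y2 <> i1 a.
  move=> h; have [a0 [b0 aE]] := gen1 a.
  have h2 : a ^+ 2 = j (map_poly c0 f2).[x0].
    by apply: (fmorph_inj i1); rewrite rmorphXn -h y2E jE i0ev.
  have /(quad_decomp_uniq yL)[hN /eqP] :
      j (a0 ^+ 2 + b0 ^+ 2 * (map_poly c0 f1).[x0] - (map_poly c0 f2).[x0]) + j (2 * a0 * b0) * y = 0.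
    rewrite rmorphB rmorphD -h2 aE rmorphXn [j (_ * _.[_])]rmorphM -yd rmorphXn !rmorphM rmorph_nat.
    ring.
  (* An element [a0 + b0 y] with square in [L0] has [a0 = 0] or [b0 = 0], which makes [f1 * f2] or
     [f2] a square in [F(x)]. *)
  rewrite !mulf_eq0 (negbTE L20) /= => /orP[]/eqP ab0.
    have E1 : i0 b0 ^+ 2 * ev f1 = ev f2.
      have /eqP := hN; rewrite ab0 expr0n add0r subr_eq0 => /eqP h3.
      by rewrite -!i0ev -h3 rmorphM rmorphXn.
    have [p [q [q0 E]]] := frac_eq b0.
    have simple12 : simple_root (f1 * f2) rho1.
      have [g -> ga] := simple1; exists (g * f2); first by rewrite mulrA.
      by rewrite hornerM mulf_neq0.
    apply: (simple_root_nonsquare (p := p * f1) simple12 q0).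
    by apply: ev_inj; rewrite !expr2 !evM -E -E1; ring.
  have E1 : i0 a0 ^+ 2 = ev f2.
    have /eqP := hN; rewrite ab0 expr0n mul0r addr0 subr_eq0 => /eqP h3.
    by rewrite -!i0ev -h3 rmorphXn.
  have [p [q [q0 E]]] := frac_eq a0; apply: (simple_root_nonsquare (p := p) simple2 q0).
  by apply: ev_inj; rewrite !expr2 !evM -E -E1; ring.
have y2d : y2 ^+ 2 = i1 (j (map_poly c0 f2).[x0]) by rewrite y2E jE i0ev.
exists L0, L1, c0, c1, j, i1, x0, y; split=> //.
- split=> //; last by rewrite jE.
  + move=> [p p0 pr]; apply: tx; exists p => //; move: pr; rewrite !rootE -/(ev p) -i0ev fmorph_eq0 //.
  + by move=> c; rewrite /= jE c0E.
split=> // z; apply/asboolP.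
apply: (gen (S := [pred z | `[< exists a b, z = i1 a + i1 b * y2 >]])).
- exact: quadratic_subfield y2d y2L.
- by move=> c; apply/asboolP; exists (c1 c), 0; rewrite rmorph0 mul0r addr0 /= jE c0E.
- by apply/asboolP; exists (j x0), 0; rewrite rmorph0 mul0r addr0 jE.
- by apply/asboolP; exists y, 0; rewrite rmorph0 mul0r addr0.
by apply/asboolP; exists 0, 1; rewrite rmorph0 rmorph1 mul1r add0r.
Qed.
End FibreTower.

Section LocalPoints.
Variables (F K : fieldType) (cst : {rmorphism F -> K}) (x y1 y2 : K) (f1 f2 : {poly F}).
Hypotheses (tx : ~ algebraicOver cst x)
  (y1E : y1 ^+ 2 = (map_poly cst f1).[x]) (y2E : y2 ^+ 2 = (map_poly cst f2).[x]).
Hypothesis gen : forall S : {pred K}, divring_closed S -> (forall c, cst c \in S) ->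
  x \in S -> y1 \in S -> y2 \in S -> forall z, z \in S.
Hypothesis two0 : 2 != 0 :> F.
Variables (rho1 rho2 a : F).
Hypotheses (simple1 : simple_root f1 rho1) (simple2 : simple_root f2 rho2).
Hypothesis (f2rho1 : f2.[rho1] != 0).
Hypotheses (f1a : f1.[a] = 0 -> simple_root f1 a) (f2a : f2.[a] = 0 -> simple_root f2 a).

(* The points over [x = a] correspond to the pairs of square roots of [f1(a)] and [de],
   where [z2] is [y2], replaced by [y2 / y1] when [a] is a common root of [f1] and [f2]. *)
Lemma local_points : exists (z2 : K) (de : F),
  [/\ (f1.[a] != 0) || (f2.[a] != 0) -> de = f2.[a],
      forall g1 g2, f1 = ('X - a%:P) * g1 -> f2 = ('X - a%:P) * g2 -> de = g2.[a] / g1.[a],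
      forall O, rational_points cst O -> residue cst O x a ->
        exists r1 r2, [/\ r1 ^+ 2 = f1.[a], r2 ^+ 2 = de, residue cst O y1 r1 & residue cst O z2 r2],
      forall r1 r2, r1 ^+ 2 = f1.[a] -> r2 ^+ 2 = de ->
        exists O, [/\ rational_points cst O, residue cst O x a, residue cst O y1 r1 & residue cst O z2 r2] &
      forall O O' r1 r2, rational_points cst O -> rational_points cst O' ->
        residue cst O x a -> residue cst O' x a -> residue cst O y1 r1 -> residue cst O' y1 r1 ->
        residue cst O z2 r2 -> residue cst O' z2 r2 -> O = O'].
Proof.
have [L0 [L1 [c0 [c1 [j [i [x0 [y [[tx0 gen0 jc ic xE] yE [gen1 yL] [gen2 y2L]]]]]]]]]] :=
  fibre_tower tx y1E y2E gen two0 simple1 simple2 f2rho1.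
pose ev p := (map_poly c0 p).[x0].
have evM p q : ev (p * q) = ev p * ev q by rewrite /ev rmorphM !hornerE.
have evX : ev ('X - a%:P) = x0 - c0 a by rewrite /ev rmorphB /= map_polyX map_polyC /= !hornerE.
have ijev p : i (j (ev p)) = (map_poly cst p).[x].
  rewrite /ev -!horner_map /= xE -!map_poly_comp; congr (_.[_]).
  by apply: eq_map_poly => c; rewrite /= jc ic.
have yd : y ^+ 2 = j (ev f1) by apply: (fmorph_inj i); rewrite rmorphXn yE y1E ijev.
have [O0 [rO0 uO0 xa0 unO0]] := rational_function_place a tx0 gen0.
have res0 p : residue c0 O0 (ev p) p.[a].
  exact: (residue_horner (rational_points_val rO0)).
have y0 : y != 0 by apply/eqP => h; apply: (yL 0); rewrite rmorph0.
have step1 r1 : r1 ^+ 2 = f1.[a] -> exists O1, [/\ rational_points c1 O1,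
    uniformizer O1 (if r1 == 0 then y else j (x0 - c0 a)), O1 \o j = O0, residue c1 O1 y r1 &
    forall O2, rational_points c1 O2 -> O2 \o j = O0 -> residue c1 O2 y r1 -> O2 = O1].
  move=> r1E; apply: (quadratic_place jc yd gen1 two0 yL rO0 uO0); first by rewrite r1E.
  move=> r10; have [g gE ga] : simple_root f1 a by apply: f1a; rewrite -r1E r10 expr0n.
  by exists (ev g), g.[a]; rewrite gE evM evX.
have resJ O1 p : rational_points c1 O1 -> O1 \o j = O0 -> residue c1 O1 (j (ev p)) p.[a].
  by move=> rO1 hO; apply/(restrict_residue jc); rewrite hO.
have [z2 [d2 [de [hde1 hde2 [z2d gen2' z2L] [res2 hr0]]]]] : exists z2 d2 de,
  [/\ (f1.[a] != 0) || (f2.[a] != 0) -> de = f2.[a],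
      forall g1 g2, f1 = ('X - a%:P) * g1 -> f2 = ('X - a%:P) * g2 -> de = g2.[a] / g1.[a],
      [/\ z2 ^+ 2 = i d2, (forall z, exists b c, z = i b + i c * z2) & (forall b, z2 <> i b)] &
      (forall O1, rational_points c1 O1 -> O1 \o j = O0 -> residue c1 O1 d2 de) /\
      (forall O1 r1 r2, rational_points c1 O1 -> O1 \o j = O0 -> r1 ^+ 2 = f1.[a] -> r2 ^+ 2 = de ->
        r2 = 0 -> exists w om, [/\ d2 = (if r1 == 0 then y else j (x0 - c0 a)) * w,
           residue c1 O1 w om & om != 0])].
  have [h|] := boolP ((f1.[a] != 0) || (f2.[a] != 0)).
    exists y2, (j (ev f2)), f2.[a]; split=> //.
    - move=> g1 g2 E1 E2; move: h; rewrite E1 E2 !hornerE subrr !mul0r eqxx //.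
    - by split=> //; rewrite y2E ijev.
    split=> [O1 rO1 hO|O1 r1 r2 rO1 hO r1E r2E r20]; first exact: resJ.
    have f2a0 : f2.[a] = 0 by rewrite -r2E r20 expr0n.
    have f1a0 : f1.[a] != 0 by move: h; rewrite f2a0 eqxx orbF.
    (* Since [f1] does not vanish at [a], the first step is unramified, and [x - a], which divides
       [f2] exactly once, is still the uniformizer. *)
    have -> : (r1 == 0) = false by apply/negbTE; rewrite -sqrf_eq0 r1E.
    have [g gE ga] := f2a f2a0; exists (j (ev g)), g.[a]; split=> //; last exact: resJ.
    by rewrite gE evM evX rmorphM.
  rewrite negb_or !negbK => /andP[/eqP f1a0 /eqP f2a0].
  have [g1 g1E g1a] := f1a f1a0; have [g2 g2E g2a] := f2a f2a0.
  have iy0 : i y != 0 by rewrite fmorph_eq0.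
  have X0 : 'X - a%:P != 0 :> {poly F} by rewrite polyXsubC_eq0.
  have u0 : x0 - c0 a != 0 by case: uO0.
  (* The first step already ramifies; [y2 / y1] is a square root of the unit [g2 / g1], so the
     second step is unramified. *)
  exists (y2 / i y), (j (ev g2) / j (ev g1)), (g2.[a] / g1.[a]); split.
  - by [].
  - by move=> h1 h2; rewrite g1E g2E => /(mulfI X0) -> /(mulfI X0) ->.
  - split.
    + rewrite expr_div_n y2E -ijev -rmorphXn yd -fmorph_div; congr (i _).
      rewrite g1E g2E !evM evX !rmorphM.
      have ju0 : j (x0 - c0 a) != 0 by rewrite fmorph_eq0.
      have jg1 : j (ev g1) != 0.
        have [O1] : exists O1, rational_points c1 O1 /\ O1 \o j = O0.
          by have [|O1 [h1 _ h2 _ _]] := step1 0; [rewrite f1a0 expr0n|exists O1].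
        case=> rO1 hO; have [] := residue_unit (rational_points_val rO1) (resJ O1 g1 rO1 hO) g1a.
        by [].
      move: (j (x0 - c0 a)) ju0 (j (ev g1)) jg1 (j (ev g2)) => v v0 w w0 t.
      by field; rewrite v0 w0.
    + move=> z; have [b [c ->]] := gen2 z; exists b, (c * y).
      by rewrite rmorphM -mulrA [i y * _]mulrC divfK.
    by move=> b h; apply: (y2L (b * y)); rewrite rmorphM -h divfK.
  split=> [O1 rO1 hO|O1 r1 r2 rO1 hO r1E r2E r20].
    have vO1 := rational_points_val rO1.
    by apply: (residueM vO1); [exact: resJ|apply: (residueV vO1) => //; exact: resJ].
  by move: r2E; rewrite r20 expr0n => /esym/eqP; rewrite mulf_eq0 invr_eq0 (negbTE g1a) (negbTE g2a).
have down O : rational_points cst O -> residue cst O x a ->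
    rational_points c1 (O \o i) /\ (O \o i) \o j = O0.
  move=> rO xa; have rOi := restrict_place ic z2d gen2' rO; split=> //.
  apply: unO0; first exact: (restrict_place jc yd gen1 rOi).
  by apply/(restrict_residue jc)/(restrict_residue ic); rewrite xE.
exists z2, de; split=> //.
- move=> O rO xa; have [rOi hO] := down O rO xa; have vO := rational_points_val rO.
  have vOi := rational_points_val rOi.
  have yO : y \in O \o i.
    by apply: (val_sqr vOi); rewrite yd; exact: (residue_val vOi (resJ _ f1 rOi hO)).
  have [r1 hr1] := rational_points_res rOi yO.
  have zO : z2 \in O.
    apply: (val_sqr vO); rewrite z2d; exact: (residue_val vOi (res2 _ rOi hO)).
  have [r2 hr2] := rational_points_res rO zO.
  exists r1, r2; split=> //.
  + apply: (residue_uniq vOi (residueM vOi hr1 hr1)); rewrite -expr2 yd; exact: resJ.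
  + apply: (residue_uniq vO (residueM vO hr2 hr2)); rewrite -expr2 z2d.
    by apply/(restrict_residue ic); exact: res2.
  by rewrite -yE; apply/(restrict_residue ic).
- move=> r1 r2 r1E r2E; have [O1 [rO1 uO1 hO1 yr1 _]] := step1 r1 r1E.
  have [||O [rO _ hO zr2 _]] := quadratic_place ic z2d gen2' two0 z2L rO1 uO1 (r := r2).
  + by rewrite r2E; exact: res2.
  + by apply: hr0.
  exists O; split=> //.
  + by rewrite -xE; apply/(restrict_residue ic); rewrite hO; apply/(restrict_residue jc); rewrite hO1.
  by rewrite -yE; apply/(restrict_residue ic); rewrite hO.
move=> O O' r1 r2 rO rO' xa xa' yr yr' zr zr'.
have [rOi hO] := down O rO xa; have [rOi' hO'] := down O' rO' xa'.
have vOi := rational_points_val rOi; have vO := rational_points_val rO.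
rewrite -yE in yr yr'; move/(restrict_residue ic): yr => yr; move/(restrict_residue ic): yr' => yr'.
have r1E : r1 ^+ 2 = f1.[a].
  by apply: (residue_uniq vOi (residueM vOi yr yr)); rewrite -expr2 yd; exact: resJ.
have r2E : r2 ^+ 2 = de.
  apply: (residue_uniq vO (residueM vO zr zr)); rewrite -expr2 z2d.
  by apply/(restrict_residue ic); exact: res2.
have [O1 [rO1 uO1 hO1 yr1 unO1]] := step1 r1 r1E.
have E1 := unO1 _ rOi hO yr; have E1' := unO1 _ rOi' hO' yr'.
have [||O2 [_ _ _ _ unO2]] := quadratic_place ic z2d gen2' two0 z2L rO1 uO1 (r := r2).
- by rewrite r2E; exact: res2.
- by apply: hr0.
by rewrite (unO2 O) // (unO2 O').
Qed.
End LocalPoints.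

(** * Counting the places *)

Lemma num_points_bij (F K : fieldType) (cst : {rmorphism F -> K}) (T : finType) (A : {set T})
    (P : T -> (K -> bool) -> Prop) :
  (forall t, t \in A -> exists2 O, rational_points cst O & P t O) ->
  (forall O, rational_points cst O -> exists2 t, t \in A & P t O) ->
  (forall t O O', rational_points cst O -> rational_points cst O' -> P t O -> P t O' -> O = O') ->
  (forall t t' O, rational_points cst O -> P t O -> P t' O -> t = t') ->
  num_points cst #|A|.
Proof.
move=> ex cover uniqO uniqT.
have /choice[g hg] : forall i : 'I_#|A|, exists O, rational_points cst O /\ P (enum_val i) O.
  by move=> i; have [O rO PO] := ex _ (enum_valP i); exists O.
have ginj : {in setT &, injective g}.
  move=> i i' _ _ E; apply: enum_val_inj; apply: (uniqT _ _ (g i)); first by case: (hg i).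
    by case: (hg i).
  by rewrite E; case: (hg i').
rewrite /num_points; have -> : rational_points cst = (g @` [set: 'I_#|A|])%classic.
  apply/seteqP; split=> [O rO|_ [i _ <-]]; last by case: (hg i).
  have [t tA Pt] := cover O rO; exists (enum_rank_in tA t) => //.
  have [rg Pg] := hg (enum_rank_in tA t); rewrite enum_rankK_in // in Pg.
  exact: (uniqO t).
apply: card_eq_trans (inj_card_eq ginj) _.
by apply: card_esym; exact: card_II.
Qed.

Lemma num_points_uniq (F K : fieldType) (cst : {rmorphism F -> K}) (N N' : nat) :
  num_points cst N -> num_points cst N' -> N = N'.
Proof. by move=> h h'; apply/card_eq_II/(card_eq_trans _ h')/card_esym. Qed.

Definition split_poly (F : fieldType) (al : F) (s : seq F) : {poly F} :=
  al *: \prod_(r <- s) ('X - r%:P).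

(** The polynomial in the coordinate [1/x] at infinity; a root 0 turns into the factor 1. *)
Definition split_poly_rev (F : fieldType) (al : F) (s : seq F) : {poly F} :=
  al *: \prod_(r <- s) (1 - r *: 'X).

Section SplitPoly.
Variable F : fieldType.
Implicit Types (al a r : F) (s : seq F).

Lemma horner_split al s a : (split_poly al s).[a] = al * \prod_(r <- s) (a - r).
Proof.
by rewrite hornerZ horner_prod; congr (_ * _); apply: eq_bigr => r _; rewrite hornerXsubC.
Qed.

Lemma horner_split_rev al s a : (split_poly_rev al s).[a] = al * \prod_(r <- s) (1 - r * a).
Proof.
by rewrite hornerZ horner_prod; congr (_ * _); apply: eq_bigr => r _; rewrite !hornerE.
Qed.

Lemma prod_sub_eq0 s a : (\prod_(r <- s) (a - r) == 0) = (a \in s).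
Proof.
elim: s => [|r s IH]; first by rewrite big_nil oner_eq0.
by rewrite big_cons mulf_eq0 subr_eq0 IH inE.
Qed.

Lemma split_eq0 al s a : al != 0 -> ((split_poly al s).[a] == 0) = (a \in s).
Proof. by move=> al0; rewrite horner_split mulf_eq0 (negbTE al0) prod_sub_eq0. Qed.

Lemma split_factor al s a : a \in s ->
  split_poly al s = ('X - a%:P) * split_poly al (rem a s).
Proof.
by move=> h; rewrite /split_poly (perm_big _ (perm_to_rem h)) big_cons /= scalerAr.
Qed.

Lemma split_simple_root al s a : al != 0 -> uniq s -> a \in s -> simple_root (split_poly al s) a.
Proof.
move=> al0 us h; exists (split_poly al (rem a s)); first exact: split_factor.
by rewrite split_eq0 // mem_rem_uniq // !inE eqxx.
Qed.

Lemma split_rev_simple_root al s a : al != 0 -> uniq s -> a \in s -> a != 0 ->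
  simple_root (split_poly_rev al s) a^-1.
Proof.
move=> al0 us h a0; exists (split_poly_rev (- a * al) (rem a s)).
  rewrite /split_poly_rev (perm_big _ (perm_to_rem h)) big_cons /=.
  move: (\prod_(r <- _) _) => Q; have hP : a%:P * a^-1%:P = 1 by rewrite -polyCM divff.
  rewrite -!mul_polyC polyCM polyCN.
  transitivity (al%:P * ((a%:P * a^-1%:P - a%:P * 'X) * Q)); first by rewrite hP.
  by ring.
rewrite horner_split_rev !mulf_neq0 ?oppr_eq0 //.
rewrite big_seq prodf_seq_neq0 /=; apply/allP => r rs; apply/implyP => _.
have ra : r != a by apply: contraTneq rs => ->; rewrite mem_rem_uniq // !inE eqxx.
by apply: contra ra; rewrite subr_eq0 eq_sym => /eqP h2; rewrite -(divfK a0 r) h2 mul1r.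
Qed.

Lemma split_rev_neq0 al s a : al != 0 -> a \notin s -> a != 0 -> (split_poly_rev al s).[a^-1] != 0.
Proof.
move=> al0 h a0; rewrite horner_split_rev mulf_neq0 //.
rewrite big_seq prodf_seq_neq0 /=; apply/allP => r rs; apply/implyP => _.
have ra : r != a by apply: contraTneq rs => ->.
by apply: contra ra; rewrite subr_eq0 eq_sym => /eqP h2; rewrite -(divfK a0 r) h2 mul1r.
Qed.

Lemma map_split (K : fieldType) (phi : {rmorphism F -> K}) al s :
  map_poly phi (split_poly al s) = split_poly (phi al) (map phi s).
Proof.
rewrite /split_poly -mul_polyC rmorphM /= map_polyC mul_polyC rmorph_prod big_map /=.
by congr (_ *: _); apply: eq_bigr => r _; rewrite map_polyXsubC.
Qed.

Lemma map_split_rev (K : fieldType) (phi : {rmorphism F -> K}) al s :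
  map_poly phi (split_poly_rev al s) = split_poly_rev (phi al) (map phi s).
Proof.
rewrite /split_poly_rev -mul_polyC rmorphM /= map_polyC mul_polyC rmorph_prod big_map /=.
congr (_ *: _); apply: eq_bigr => r _.
by rewrite rmorphB rmorph1 /= -!mul_polyC rmorphM /= map_polyC map_polyX.
Qed.

Lemma split_rev_inv al s a : a != 0 ->
  (split_poly_rev al s).[a^-1] * a ^+ size s = (split_poly al s).[a].
Proof.
move=> a0; rewrite horner_split horner_split_rev -mulrA; congr (_ * _).
elim: s => [|r s IH]; first by rewrite !big_nil mulr1.
rewrite !big_cons -IH exprS /= mulrACA mulrBl mul1r mulfVK //.
Qed.
End SplitPoly.

Section CountPoints.
Variables (F : finFieldType) (al1 al2 : F) (c d1 d2 : seq F).
Hypotheses (oddF : odd #|F|) (al10 : al1 != 0) (al20 : al2 != 0).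
Hypotheses (uniq_pts : uniq (c ++ d1 ++ d2)).
Hypotheses (size_c : size c = 4%N) (size_d1 : size d1 = 2%N) (size_d2 : size d2 = 2%N).
Let f1 := split_poly al1 (c ++ d1).
Let f2 := split_poly al2 (c ++ d2).
Let f3 := split_poly (al1 * al2) (d1 ++ d2).

Definition split_sum (al : F) (s : seq F) : int := qchar al + \sum_x qchar (split_poly al s).[x].

Let uniq1 : uniq (c ++ d1).
Proof. by move: uniq_pts; rewrite catA cat_uniq => /andP[]. Qed.

Let uniq2 : uniq (c ++ d2).
Proof. by apply: subseq_uniq uniq_pts; rewrite cat_subseq // suffix_subseq. Qed.

Let d1_notin2 a : a \in d1 -> a \notin c ++ d2.
Proof.
move=> h; move: uniq_pts; rewrite uniq_catCA cat_uniq => /and3P[_ /hasPn hn _].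
by apply/negP => /hn; rewrite /= h.
Qed.

(** In the coordinate [1/x] the tower again needs simple roots as witnesses, and only nonzero roots
    survive the inversion. *)
Let nonzero_mem (d : seq F) : size d = 2%N -> uniq d -> exists2 a, a \in d & a != 0.
Proof.
case: d => [|a [|b [|]]] //= _; rewrite inE andbT => ab.
have [a0|a0] := eqVneq a 0; last by exists a; rewrite ?inE ?eqxx.
by exists b; rewrite ?inE ?eqxx ?orbT // -a0 eq_sym.
Qed.

Let count_sqrt2 (u v : F) :
  #|[set r : F * F | (r.1 ^+ 2 == u) && (r.2 ^+ 2 == v)]|%:Z = (1 + qchar u) * (1 + qchar v).
Proof.
rewrite -!card_sqrt -PoszM -cardsX; congr (Posz _); apply: eq_card => -[r s].
by rewrite !inE.
Qed.

(** Off the common roots [f1 f2] is [f3] times a nonzero square, so the product expands. At a common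
    root only [1 + qchar de] is left, and [g2 / g1] agrees with [f3] up to a square. *)
Let local_count (a de : F) :
  ((f1.[a] != 0) || (f2.[a] != 0) -> de = f2.[a]) ->
  (forall g1 g2, f1 = ('X - a%:P) * g1 -> f2 = ('X - a%:P) * g2 -> de = g2.[a] / g1.[a]) ->
  (1 + qchar f1.[a]) * (1 + qchar de) = 1 + qchar f1.[a] + qchar f2.[a] + qchar f3.[a].
Proof.
move=> h1 h2; pose PC := \prod_(r <- c) (a - r).
pose P1 := \prod_(r <- d1) (a - r); pose P2 := \prod_(r <- d2) (a - r).
have f1E : f1.[a] = al1 * (PC * P1) by rewrite horner_split big_cat.
have f2E : f2.[a] = al2 * (PC * P2) by rewrite horner_split big_cat.
have f3E : f3.[a] = al1 * al2 * (P1 * P2) by rewrite horner_split big_cat.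
have [ac|ac] := boolP (a \in c); last first.
  have PC0 : PC != 0 by rewrite prod_sub_eq0.
  rewrite {}h1; last first.
    rewrite !split_eq0 // -negb_and !mem_cat (negbTE ac) /=; apply/andP => -[ad1 ad2].
    by have := d1_notin2 ad1; rewrite mem_cat ad2 orbT.
  have -> : qchar f3.[a] = qchar f1.[a] * qchar f2.[a].
    by rewrite -(qcharM oddF) -(qcharMsqr oddF f3.[a] PC0) f1E f2E f3E; congr qchar; ring.
  by ring.
pose P := \prod_(r <- rem a c) (a - r).
have uc : uniq c by move: uniq1; rewrite cat_uniq => /andP[].
have P0 : P != 0 by rewrite prod_sub_eq0 mem_rem_uniq // !inE eqxx.
have P10 : P1 != 0.
  by rewrite prod_sub_eq0; apply/negP => /d1_notin2; rewrite mem_cat ac.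
have factor al d : split_poly al (c ++ d) = ('X - a%:P) * split_poly al (rem a c ++ d).
  rewrite /split_poly !big_cat /= (perm_big _ (perm_to_rem ac)) big_cons /= -scalerAr.
  by rewrite mulrA.
have f1a : f1.[a] = 0 by rewrite /f1 factor hornerM hornerXsubC subrr mul0r.
have f2a : f2.[a] = 0 by rewrite /f2 factor hornerM hornerXsubC subrr mul0r.
rewrite f1a f2a qchar0 !addr0 mul1r (h2 _ _ (factor al1 d1) (factor al2 d2)); congr (1 + _).
have v0 : (al1 * P1)^-1 != 0 by rewrite invr_eq0 mulf_neq0.
rewrite -(qcharMsqr oddF f3.[a] v0) f3E !horner_split !big_cat /= -/P -/P1 -/P2.
by congr qchar; field; rewrite P0 P10 al10.
Qed.

Lemma fibre_product_num_points (C : fibre_product f1 f2) :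
  exists2 N, num_points (constants C) N &
    N%:Z = #|F|%:Z + 1 + split_sum al1 (c ++ d1) + split_sum al2 (c ++ d2)
      + split_sum (al1 * al2) (d1 ++ d2).
Proof.
case: C => K cst x y1 y2 tx y1E y2E gen /=.
have two0 := odd_card_two_neq0 oddF.
have ud1 : uniq d1 by move: uniq1; rewrite cat_uniq => /and3P[].
have ud2 : uniq d2 by move: uniq2; rewrite cat_uniq => /and3P[].
have [e1 e1d e10] := nonzero_mem size_d1 ud1.
have [e2 e2d e20] := nonzero_mem size_d2 ud2.
have e1f : e1 \in c ++ d1 by rewrite mem_cat e1d orbT.
have e2f : e2 \in c ++ d2 by rewrite mem_cat e2d orbT.
have x0 : x != 0.
  apply/eqP => x0; apply: tx; exists 'X; first by rewrite polyX_eq0.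
  by rewrite map_polyX rootE hornerX x0.
have tx' : ~ algebraicOver cst x^-1 by move=> /algebraic_inv; rewrite invrK.
have f2e1 : f2.[e1] != 0 by rewrite split_eq0 // d1_notin2.
have loc (al : F) s a : al != 0 -> uniq s -> (split_poly al s).[a] = 0 -> simple_root (split_poly al s) a.
  by move=> al0 us /eqP; rewrite split_eq0 // => h; apply: split_simple_root.
have /choice[z2 /choice[de hde]] := fun a : F => local_points tx y1E y2E gen two0
  (split_simple_root al10 uniq1 e1f) (split_simple_root al20 uniq2 e2f) f2e1
  (loc al1 _ a al10 uniq1) (loc al2 _ a al20 uniq2).
pose g1 := split_poly_rev al1 (c ++ d1); pose g2 := split_poly_rev al2 (c ++ d2).
(* A sextic divided by [x^6] is its reversal in [1/x], whence the coordinate [y / x ^+ 3] at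
   infinity. *)
have rev_sqr al s (y : K) : size s = 6%N -> y ^+ 2 = (map_poly cst (split_poly al s)).[x] ->
    (y / x ^+ 3) ^+ 2 = (map_poly cst (split_poly_rev al s)).[x^-1].
  move=> ss yE; rewrite expr_div_n yE -exprM map_split -(split_rev_inv _ _ x0) size_map ss.
  by rewrite mulfK ?expf_neq0 // map_split_rev.
have y1E' : (y1 / x ^+ 3) ^+ 2 = (map_poly cst g1).[x^-1].
  by apply: rev_sqr y1E; rewrite size_cat size_c size_d1.
have y2E' : (y2 / x ^+ 3) ^+ 2 = (map_poly cst g2).[x^-1].
  by apply: rev_sqr y2E; rewrite size_cat size_c size_d2.
have gen' (S : {pred K}) : divring_closed S -> (forall a, cst a \in S) ->
    x^-1 \in S -> y1 / x ^+ 3 \in S -> y2 / x ^+ 3 \in S -> forall z, z \in S.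
  move=> Sc hc hx hy1 hy2; have [S1 SB SD] := Sc.
  have SM u v : u \in S -> v \in S -> u * v \in S.
    by move=> uS vS; rewrite -[v]invrK -[v^-1]div1r; apply: (SD) => //; apply: (SD).
  have xS : x \in S by rewrite -[x]invrK -div1r; apply: (SD).
  have x3 : x ^+ 3 \in S by rewrite !exprS expr0 mulr1; do 2 apply: (SM) => //.
  by apply: gen => //; [rewrite -(divfK (expf_neq0 3 x0) y1)|rewrite -(divfK (expf_neq0 3 x0) y2)];
    apply: (SM).
have g10 : g1.[0] = al1 by rewrite horner_split_rev big1 ?mulr1 // => r _; rewrite mulr0 subr0.
have g20 : g2.[0] = al2 by rewrite horner_split_rev big1 ?mulr1 // => r _; rewrite mulr0 subr0.
have loc1 : g1.[0] = 0 -> simple_root g1 0 by rewrite g10 => h; case/eqP: al10.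
have loc2 : g2.[0] = 0 -> simple_root g2 0 by rewrite g20 => h; case/eqP: al20.
have [zi [di [hdi1 _ hi1 hi2 hi3]]] := local_points tx' y1E' y2E' gen' two0
  (split_rev_simple_root al10 uniq1 e1f e10) (split_rev_simple_root al20 uniq2 e2f e20)
  (split_rev_neq0 al20 (d1_notin2 e1d) e10) loc1 loc2.
have {}hdi1 : di = al2 by rewrite hdi1 ?g10 ?al10 ?g20.
rewrite g10 hdi1 in hi1 hi2.
(* [None] is the infinite point of the [x]-line, where the reversed sextics take their leading
   coefficients as values. *)
pose u1 o := if o is Some a then f1.[a] else al1.
pose u2 o := if o is Some a then de a else al2.
pose A := [set t : option F * (F * F) | (t.2.1 ^+ 2 == u1 t.1) && (t.2.2 ^+ 2 == u2 t.1)].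
pose P (t : option F * (F * F)) O := if t.1 is Some a
  then [/\ residue cst O x a, residue cst O y1 t.2.1 & residue cst O (z2 a) t.2.2]
  else [/\ residue cst O x^-1 0, residue cst O (y1 / x ^+ 3) t.2.1 & residue cst O zi t.2.2].
exists #|A|.
  apply: (num_points_bij (P := P)).
  - move=> [[a|] [r1 r2]]; rewrite inE => /= /andP[/eqP h1 /eqP h2].
      by have [_ _ _ /(_ _ _ h1 h2)[O [rO ? ? ?]] _] := hde a; exists O.
    by have [O [rO ? ? ?]] := hi2 _ _ h1 h2; exists O.
  - move=> O rO; have vO := rational_points_val rO; have [xO|xO] := boolP (x \in O).
      have [a xa] := rational_points_res rO xO; have [_ _ /(_ O rO xa)[r1 [r2 [h1 h2 h3 h4]]] _ _] := hde a.
      by exists (Some a, (r1, r2)); rewrite ?inE /= ?h1 ?h2 ?eqxx.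
    have x'a : residue cst O x^-1 0 by apply/(residue0 cst); rewrite inE invrK xO orbT.
    have [r1 [r2 [h1 h2 h3 h4]]] := hi1 O rO x'a.
    by exists (None, (r1, r2)); rewrite ?inE /= ?h1 ?h2 ?eqxx.
  - move=> [[a|] [r1 r2]] O O' rO rO' [/= h1 h2 h3] [/= h1' h2' h3'].
      by have [_ _ _ _ /(_ O O' r1 r2)] := hde a; apply.
    exact: (hi3 O O' r1 r2).
  have excl O a : rational_points cst O -> residue cst O x a -> residue cst O x^-1 0 -> False.
    move=> rO xa x'a; have vO := rational_points_val rO.
    have := residueM vO xa x'a; rewrite divff // mulr0 => h.
    by have /eqP := residue_uniq vO h (residue1 cst O); rewrite eq_sym oner_eq0.
  move=> [[a|] [r1 r2]] [[a'|] [r1' r2']] O rO [/= h1 h2 h3] [/= h1' h2' h3'];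
    have vO := rational_points_val rO.
  - have aa := residue_uniq vO h1 h1'; rewrite -aa in h3' *.
    by rewrite (residue_uniq vO h2 h2') (residue_uniq vO h3 h3').
  - by case: (excl O a).
  - by case: (excl O a').
  by rewrite (residue_uniq vO h2 h2') (residue_uniq vO h3 h3').
have -> : #|A|%:Z = \sum_o (1 + qchar (u1 o)) * (1 + qchar (u2 o)).
  rewrite (eq_bigr _ (fun o _ => esym (count_sqrt2 (u1 o) (u2 o)))) -sum1_card [LHS]rmorph_sum big_mkcond.
  rewrite (sum_pair (fun t : option F * (F * F) => if t \in A then 1 : int else 0)); apply: eq_bigr => o _.
  rewrite -sum1_card [RHS]rmorph_sum [RHS]big_mkcond; apply: eq_bigr => r _.
  by rewrite !inE.
rewrite (bigD1 None) //= (reindex_omap Some id) => [|[]] //=.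
rewrite (eq_bigl xpredT) => [|a]; last by rewrite eqxx.
have hloc a : (1 + qchar f1.[a]) * (1 + qchar (de a)) = 1 + qchar f1.[a] + qchar f2.[a] + qchar f3.[a].
  by have [h1 h2 _ _ _] := hde a; exact: local_count.
rewrite (eq_bigr _ (fun a _ => hloc a)) 3!big_split /= sumr_const natz /split_sum.
rewrite (qcharM oddF al1 al2) -/f1 -/f2 -/f3 -[#|xpredT|]/#|F|; ring.
Qed.
End CountPoints.

Lemma curve_num_points (F : finFieldType) (al1 al2 a1 a2 a3 a4 a5 a6 b5 b6 s t : F) :
  let a := ((a1 - a3) * (a2 - a4)) / ((a2 - a3) * (a1 - a4)) in
  let b := ((a1 - a3) * (a2 - a5)) / ((a2 - a3) * (a1 - a5)) in
  let c := ((a1 - a3) * (a2 - b5)) / ((a2 - a3) * (a1 - b5)) in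
  let be1 := al1 * (a2 - a3) * (a1 - a4) * (a1 - a5) * (a1 - a6) in
  let be2 := al2 * (a2 - a3) * (a1 - a4) * (a1 - b5) * (a1 - b6) in
  odd #|F| -> al1 != 0 -> al2 != 0 -> uniq [:: a1; a2; a3; a4; a5; a6; b5; b6] ->
  (a2 - a4) * (a1 - a6) * (a3 - a5) = (a2 - a6) * (a1 - a5) * (a3 - a4) ->
  (a2 - a4) * (a1 - b6) * (a3 - b5) = (a2 - b6) * (a1 - b5) * (a3 - a4) ->
  s ^+ 2 = a ^+ 2 - a * b -> t ^+ 2 = a ^+ 2 - a * c ->
  forall C : fibre_product (split_poly al1 [:: a1; a2; a3; a4; a5; a6])
                           (split_poly al2 [:: a1; a2; a3; a4; b5; b6]),
  exists2 N, num_points (constants C) N &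
    N%:Z = #|F|%:Z + 1
      + legendre_sum (be1 * (1 - b) / (1 - a)) ((1 - a) * (b - 2 * a + 2 * s) / (b - 1))
      + legendre_sum (be1 * (1 - b) / (1 - a)) ((1 - a) * (b - 2 * a - 2 * s) / (b - 1))
      + legendre_sum (be2 * (1 - c) / (1 - a)) ((1 - a) * (c - 2 * a + 2 * t) / (c - 1))
      + legendre_sum (be2 * (1 - c) / (1 - a)) ((1 - a) * (c - 2 * a - 2 * t) / (c - 1))
      + legendre_sum (al1 * al2 * (a5 - b6) * (a6 - b5)) (((a5 - b5) * (a6 - b6)) / ((a5 - b6) * (a6 - b5))).
Proof.
move=> a b c be1 be2 oF al10 al20 hu ra rb hs ht C.
have u1 : uniq [:: a1; a2; a3; a4; a5; a6] by apply: subseq_uniq hu; apply: (@prefix_subseq _ _ [:: b5; b6]).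
have u2 : uniq [:: a1; a2; a3; a4; b5; b6].
  by apply: subseq_uniq hu; apply: (@cat_subseq _ [:: a1; a2; a3; a4] _ [:: a1; a2; a3; a4]); [|exact: (@suffix_subseq _ [:: a5; a6])].
have u3 : uniq [:: a5; a6; b5; b6] by apply: subseq_uniq hu; exact: (@suffix_subseq _ [:: a1; a2; a3; a4]).
have [N hN NE] := @fibre_product_num_points F al1 al2 [:: a1; a2; a3; a4] [:: a5; a6] [:: b5; b6]
  oF al10 al20 hu erefl erefl erefl C.
exists N => //; rewrite {}NE /split_sum /=.
have E1 : \sum_x qchar (split_poly al1 [:: a1; a2; a3; a4; a5; a6]).[x] =
    \sum_x qchar (al1 * ((x - a1) * (x - a2) * (x - a3) * (x - a4) * (x - a5) * (x - a6))).
  by apply: eq_bigr => x _; rewrite horner_split !big_cons big_nil; congr qchar; ring.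
have E2 : \sum_x qchar (split_poly al2 [:: a1; a2; a3; a4; b5; b6]).[x] =
    \sum_x qchar (al2 * ((x - a1) * (x - a2) * (x - a3) * (x - a4) * (x - b5) * (x - b6))).
  by apply: eq_bigr => x _; rewrite horner_split !big_cons big_nil; congr qchar; ring.
have E3 : \sum_x qchar (split_poly (al1 * al2) [:: a5; a6; b5; b6]).[x] =
    \sum_x qchar (al1 * al2 * ((x - a5) * (x - a6) * (x - b5) * (x - b6))).
  by apply: eq_bigr => x _; rewrite horner_split !big_cons big_nil; congr qchar; ring.
rewrite {}E1 {}E2 {}E3 (sextic_sum oF al1 hs u1 ra) (sextic_sum oF al2 ht u2 rb).
by rewrite (quartic_sum oF (al1 * al2) u3) !addrA.
Qed.

(** The parameters are formed in [k] before applying [phi], so that the sums over [F] can be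
    expressed by the trace over [k]. *)
Lemma curve_num_points_map (k F : finFieldType) (phi : {rmorphism k -> F})
    (al1 al2 a1 a2 a3 a4 a5 a6 b5 b6 s t : k) :
  let a := ((a1 - a3) * (a2 - a4)) / ((a2 - a3) * (a1 - a4)) in
  let b := ((a1 - a3) * (a2 - a5)) / ((a2 - a3) * (a1 - a5)) in
  let c := ((a1 - a3) * (a2 - b5)) / ((a2 - a3) * (a1 - b5)) in
  let be1 := al1 * (a2 - a3) * (a1 - a4) * (a1 - a5) * (a1 - a6) in
  let be2 := al2 * (a2 - a3) * (a1 - a4) * (a1 - b5) * (a1 - b6) in
  odd #|F| -> al1 != 0 -> al2 != 0 -> uniq [:: a1; a2; a3; a4; a5; a6; b5; b6] ->
  (a2 - a4) * (a1 - a6) * (a3 - a5) = (a2 - a6) * (a1 - a5) * (a3 - a4) ->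
  (a2 - a4) * (a1 - b6) * (a3 - b5) = (a2 - b6) * (a1 - b5) * (a3 - a4) ->
  s ^+ 2 = a ^+ 2 - a * b -> t ^+ 2 = a ^+ 2 - a * c ->
  forall C : fibre_product (map_poly phi (split_poly al1 [:: a1; a2; a3; a4; a5; a6]))
                           (map_poly phi (split_poly al2 [:: a1; a2; a3; a4; b5; b6])),
  exists2 N, num_points (constants C) N &
    N%:Z = #|F|%:Z + 1
      + legendre_sum (phi (be1 * (1 - b) / (1 - a))) (phi ((1 - a) * (b - 2 * a + 2 * s) / (b - 1)))
      + legendre_sum (phi (be1 * (1 - b) / (1 - a))) (phi ((1 - a) * (b - 2 * a - 2 * s) / (b - 1)))
      + legendre_sum (phi (be2 * (1 - c) / (1 - a))) (phi ((1 - a) * (c - 2 * a + 2 * t) / (c - 1)))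
      + legendre_sum (phi (be2 * (1 - c) / (1 - a))) (phi ((1 - a) * (c - 2 * a - 2 * t) / (c - 1)))
      + legendre_sum (phi (al1 * al2 * (a5 - b6) * (a6 - b5)))
          (phi (((a5 - b5) * (a6 - b6)) / ((a5 - b6) * (a6 - b5)))).
Proof.
move=> a b c be1 be2 oF al10 al20 hu ra rb hs ht; rewrite !map_split /= => C.
have morphE := (rmorph_nat phi 2, fmorphV, rmorphM, rmorphB, rmorphD, rmorphN, rmorph1).
have pa : phi a = ((phi a1 - phi a3) * (phi a2 - phi a4)) / ((phi a2 - phi a3) * (phi a1 - phi a4)) by rewrite !morphE.
have pb : phi b = ((phi a1 - phi a3) * (phi a2 - phi a5)) / ((phi a2 - phi a3) * (phi a1 - phi a5)) by rewrite !morphE.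
have pc : phi c = ((phi a1 - phi a3) * (phi a2 - phi b5)) / ((phi a2 - phi a3) * (phi a1 - phi b5)) by rewrite !morphE.
have pe1 : phi be1 = phi al1 * (phi a2 - phi a3) * (phi a1 - phi a4) * (phi a1 - phi a5) * (phi a1 - phi a6) by rewrite !morphE.
have pe2 : phi be2 = phi al2 * (phi a2 - phi a3) * (phi a1 - phi a4) * (phi a1 - phi b5) * (phi a1 - phi b6) by rewrite !morphE.
have := @curve_num_points F (phi al1) (phi al2) (phi a1) (phi a2) (phi a3) (phi a4) (phi a5) (phi a6)
  (phi b5) (phi b6) (phi s) (phi t).
cbv zeta; rewrite -pa -pb -pc -pe1 -pe2 => /(_ oF); rewrite !fmorph_eq0 => /(_ al10 al20).
rewrite -[[:: phi a1; _; _; _; _; _; _; _]]/(map phi [:: a1; a2; a3; a4; a5; a6; b5; b6]).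
rewrite (map_inj_uniq (fmorph_inj phi)) -!rmorphB -!rmorphM -!rmorphXn ra rb => /(_ hu erefl erefl).
rewrite hs ht -!rmorphB => /(_ erefl erefl C) [N hN NE]; exists N => //.
rewrite {}NE.
have P1 u v : phi (u * (1 - v) / (1 - a)) = phi u * (1 - phi v) / (1 - phi a) by rewrite !morphE.
have P2 v r : phi ((1 - a) * (v - 2 * a + 2 * r) / (v - 1)) =
    (1 - phi a) * (phi v - 2 * phi a + 2 * phi r) / (phi v - 1) by rewrite !morphE.
have P3 v r : phi ((1 - a) * (v - 2 * a - 2 * r) / (v - 1)) =
    (1 - phi a) * (phi v - 2 * phi a - 2 * phi r) / (phi v - 1) by rewrite !morphE.
rewrite !{}P1 !{}P2 !{}P3; congr (_ + legendre_sum _ _); by rewrite !morphE.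
Qed.

(** * Comparison with the Serre bound *)

(** These integer inequalities are all that is used of the floor later; algebraic numbers disappear
    from the argument. *)
Lemma floor_sqrt (x : algC) (n : nat) (M := Num.floor x) : 0 <= x -> x ^+ 2 = n%:R ->
  [/\ 0 <= M, M ^+ 2 <= n%:Z & n%:Z < (M + 1) ^+ 2].
Proof.
move=> x0 xE; have /andP[h1 h2] := real_floor_itv (ger0_real x0).
have M0 : 0 <= M by rewrite /M real_floor_ge_int ?ger0_real.
have e z : (z ^+ 2)%:~R = (z%:~R : algC) ^+ 2 by rewrite rmorphXn.
have M0' : 0 <= M%:~R :> algC by rewrite ler0z.
split=> //.
  by rewrite -(ler_int algC) e -[n%:Z%:~R]/(n%:R) -xE ler_sqr.
by rewrite -(ltr_int algC) e -[n%:Z%:~R]/(n%:R) -xE ltr_sqr // ?nnegrE // (le_trans x0 (ltW h2)).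
Qed.

Lemma intr_Fp_eq (p : nat) (z w : int) : prime p -> z%:~R = w%:~R :> 'F_p ->
  exists k : int, z = w + k * p%:Z.
Proof.
move=> pr /eqP; rewrite -subr_eq0 -rmorphB /= => h.
have : (p %| `|z - w|)%N.
  rewrite (dvdn_pcharf (pchar_Fp pr)); move: h; case: (intP (z - w)) => [|n|n] //=.
  by rewrite rmorphN oppr_eq0.
case/dvdnP => m hm; have [h0|h0] := leP 0 (z - w).
  by exists m%:Z; lia.
by exists (- m%:Z); lia.
Qed.

Lemma prime_not_square (p k : nat) : prime p -> (k * k)%N <> p.
Proof.
move=> pr E; have kp : k \in [:: 1%N; p].
  by case/primeP: pr => _ /(_ k); rewrite !inE; apply; rewrite -E dvdn_mulr.
have p1 := prime_gt1 pr; move: kp E; rewrite !inE => /orP[]/eqP ->; nia.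
Qed.

Lemma cube_trace_min (p t h M : int) : 11 <= p -> 0 <= M -> M ^+ 2 <= 4 * p ^+ 3 ->
  4 * p ^+ 3 < (M + 1) ^+ 2 -> t ^+ 2 <= 4 * p -> t ^+ 2 != 4 * p -> 0 <= h < p ->
  (exists k, h = t + k * p) ->
  t ^+ 3 - 3 * p * t = - M <-> h ^+ 3 - 3 * p * h = - M.
Proof.
move=> p11 M0 M1 M2 t4 tn /andP[h0 hp] [k hE].
have tp : - p < t < p by nia.
have [k0|k1] : k = 0 \/ k = 1 by nia.
  by have -> : h = t by lia.
have {}hE : h = t + p by lia.
have Mpos : 0 < M by nia.
(* Only [h = t + p] with [t < 0] is left, and here neither equation can hold. *)
split=> E; exfalso.
  pose n := - t; have nE : t = - n by rewrite /n opprK.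
  have n0 : 0 < n by nia.
  have E1 : n * (n ^+ 2 - 3 * p) = M by rewrite nE in E; nia.
  have n3 : 3 * p < n ^+ 2 by rewrite -subr_gt0 -(pmulr_rgt0 _ n0) E1.
  (* The choice of [M] makes this defect at most [2 M], while [3 p < n^2 < 4 p] makes it at least
     [4 p^2]. So [M >= 2 p^2], too large for [M^2 <= 4 p^3]. *)
  have key : 4 * p ^+ 3 - M ^+ 2 = (4 * p - n ^+ 2) * (n ^+ 2 - p) ^+ 2 by rewrite -E1; ring.
  have n4 : 1 <= 4 * p - n ^+ 2.
    have : n ^+ 2 != 4 * p by rewrite -sqrrN -nE.
    by rewrite nE sqrrN in t4; lia.
  have b1 : (2 * p) ^+ 2 <= (n ^+ 2 - p) ^+ 2 by rewrite ler_sqr ?nnegrE; lia.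
  have b2 : 4 * p ^+ 2 <= 4 * p ^+ 3 - M ^+ 2.
    rewrite key (_ : 4 * p ^+ 2 = (2 * p) ^+ 2); last by ring.
    by apply: le_trans b1 _; rewrite ler_peMl // sqr_ge0.
  have eM : (M + 1) ^+ 2 = M ^+ 2 + 2 * M + 1 by ring.
  have b3 : 2 * p ^+ 2 <= M by lia.
  have b4 : 4 * p ^+ 4 <= 4 * p ^+ 3.
    apply: le_trans M1; rewrite (_ : 4 * p ^+ 4 = (2 * p ^+ 2) ^+ 2); last by ring.
    by rewrite ler_sqr ?nnegrE // mulr_ge0 // sqr_ge0.
  have p3 : 0 < p ^+ 3 by apply: exprn_gt0; lia.
  have : 11 * p ^+ 3 <= p ^+ 4 by rewrite [p ^+ 4]exprS ler_wpM2r // ltW.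
  by lia.
have h3 : h ^+ 2 < 3 * p.
  rewrite ltNge; apply/negP => q; have : 0 <= h * (h ^+ 2 - 3 * p) by rewrite mulr_ge0 // subr_ge0.
  have -> : h * (h ^+ 2 - 3 * p) = h ^+ 3 - 3 * p * h by ring.
  by rewrite E; lia.
have t2 : (p - h) ^+ 2 <= 4 * p by rewrite (_ : p - h = - t) ?sqrrN //; lia.
have p13 : p <= 13.
  (* Cauchy-Schwarz for [p = (p - h) + h], where the squares are at most [4 p] and [3 p]. The
     weights [8 : 7] approximate the optimal [2 : sqrt 3] and give [p <= 195 / 14], just below
     14. *)
  have key : 0 <= (7 * (p - h) - 8 * h) ^+ 2 by exact: sqr_ge0.
  have : 56 * p ^+ 2 <= 780 * p.
    have -> : 56 * p ^+ 2 = 105 * (p - h) ^+ 2 + 120 * h ^+ 2 - (7 * (p - h) - 8 * h) ^+ 2 by ring.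
    by lia.
  move=> q; rewrite leNgt; apply/negP => p14; have : 14 * p <= p ^+ 2 by rewrite expr2 ler_wpM2r //; lia.
  by lia.
have h6 : h <= 6.
  rewrite leNgt; apply/negP => h7; have : 7 * 7 <= h ^+ 2 by rewrite expr2 ler_pM //; lia.
  by lia.
have h4 : p - 7 <= h.
  rewrite leNgt; apply/negP => h7; have : 8 * 8 <= (p - h) ^+ 2 by rewrite expr2 ler_pM //; lia.
  by lia.
have pE : p = 11 \/ p = 12 \/ p = 13 by lia.
have {}hE : h = 4 \/ h = 5 \/ h = 6 by lia.
have ME : M = 3 * p * h - h ^+ 3 by lia.
by move: t2 h3 M2; rewrite ME; case: pE => [->|[->|->]]; case: hE => [->|[->|->]].
Qed.

Lemma floor_two_sqrt (n : nat) (M := Num.floor (2 * sqrtC n%:R : algC)) :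
  [/\ 0 <= M, M ^+ 2 <= 4 * n%:Z & 4 * n%:Z < (M + 1) ^+ 2].
Proof.
apply: (@floor_sqrt _ (4 * n)%N); first by rewrite mulr_ge0 ?sqrtC_ge0 ?ler0n.
rewrite exprMn sqrtCK [RHS]natrM; congr (_ * _).
by rewrite -natrX.
Qed.

Lemma floor_two_mul_sqrt (n : nat) :
  Num.floor (2 * n%:R * sqrtC n%:R : algC) = Num.floor (2 * sqrtC (n ^ 3)%:R : algC).
Proof.
congr Num.floor; rewrite -mulrA; congr (_ * _).
have n0 : 0 <= n%:R :> algC by rewrite ler0n.
rewrite (expnSr n 2) natrM rootCMl ?ler0n // natrX sqrCK //.
Qed.

Section SerreBound.
Variables (F : finFieldType) (K : fieldType) (cst : {rmorphism F -> K}).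
Variables (g N : nat) (U : 'I_g -> int).
Hypotheses (hN : num_points cst N) (NE : N%:Z = #|F|%:Z + 1 + \sum_i U i).

Lemma num_points_max_iff (M : int) : (forall i, U i <= M) ->
  (N%:Z = #|F|%:Z + 1 + g%:Z * M) <-> (forall i, U i = M).
Proof.
move=> UM; have E : \sum_(i < g) M = g%:Z * M by rewrite sumr_const card_ord -mulr_natl natz.
rewrite NE -E; split=> [/addrI h i|h]; first exact: (sum_le_eq UM h).
by congr (_ + _); apply: eq_bigr => i _; exact: h.
Qed.

(** An integer with square at most [4 q] is at most the floor of [2 sqrt q], and a sum of bounded
    terms is extremal only if each term is. *)
Lemma attains_Serre_bound_iff : (forall i, U i ^+ 2 <= 4 * #|F|%:Z) ->
  attains_Serre_bound g cst <-> forall i, U i = Num.floor (2 * sqrtC #|F|%:R : algC).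
Proof.
move=> U2; have [M0 M1 M2] := floor_two_sqrt #|F|; move: M0 M1 M2.
rewrite /attains_Serre_bound; move: (Num.floor _) => M M0 M1 M2.
have UM i : U i <= M.
  rewrite leNgt; apply/negP => hM; have : (M + 1) ^+ 2 <= U i ^+ 2.
    by rewrite ler_sqr ?nnegrE; lia.
  by have := U2 i; lia.
apply: iff_trans (num_points_max_iff UM); split=> [[N' hN' E]|E]; last by exists N.
by rewrite (num_points_uniq hN hN').
Qed.

Lemma maximal_curve_iff (p : nat) : #|F| = (p ^ 2)%N -> (forall i, U i <= 2 * p%:Z) ->
  maximal_curve g cst <-> forall i, U i = 2 * p%:Z.
Proof.
move=> cF UM; apply: iff_trans (num_points_max_iff UM).
have sq : sqrtC #|F|%:R = p%:R :> algC by rewrite cF natrX sqrCK ?ler0n.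
have RE : #|F|%:R + 1 + 2 * g%:R * sqrtC #|F|%:R = (#|F| + 1 + 2 * g * p)%:R :> algC.
  by rewrite sq [RHS]natrD [X in _ = _ + X]natrM [X in _ = _ + X * _]natrM [X in _ = X + _]natrD.
rewrite /maximal_curve RE; split=> [[N' hN' /eqP]|E]; last first.
  by exists N => //; congr (_%:R); lia.
by rewrite eqr_nat (num_points_uniq hN hN') => /eqP ->; lia.
Qed.
End SerreBound.

Lemma legendre_param_quartic (F : fieldType) (a5 a6 b5 b6 : F) : a5 - b6 != 0 -> a6 - b5 != 0 ->
  ((a5 - b5) * (a6 - b6)) / ((a5 - b6) * (a6 - b5)) - 1 =
  ((a5 - a6) * (b5 - b6)) / ((a5 - b6) * (a6 - b5)).
Proof. by move=> h1 h2; field; rewrite h1 h2. Qed.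

Lemma congruent_eq (p t u : int) : 0 < p -> (t - u) ^+ 2 < p ^+ 2 ->
  (exists k, t = u + k * p) -> t = u.
Proof.
move=> p0 + [k kE]; rewrite kE (_ : u + _ - u = k * p); last by ring.
rewrite exprMn -[X in _ < X]mul1r ltr_pM2r; last by apply: exprn_gt0.
move=> k1; suff -> : k = 0 by rewrite mul0r addr0.
apply/eqP; rewrite -sqrf_eq0; have := sqr_ge0 k; lia.
Qed.

Lemma sqr_neq_4prime (p : nat) (t : int) : prime p -> t ^+ 2 != 4 * p%:Z.
Proof.
move=> pr; apply/eqP => E; apply: (@prime_not_square p (`|t|./2) pr).
have nn : (`|t| * `|t| = 4 * p)%N by have := congr1 absz E; rewrite expr2 !abszM.
have ev : ~~ odd `|t| by have := congr1 odd nn; rewrite !oddM /=; case: odd.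
by nia.
Qed.

(** The difference is at most [4 sqrt p], which is less than [p] exactly when [p > 16]. *)
Lemma hasse_difference (p t u : int) : 17 <= p -> t ^+ 2 <= 4 * p -> u ^+ 2 <= 4 * p ->
  (t - u) ^+ 2 < p ^+ 2.
Proof.
move=> p17 t4 u4; have -> : (t - u) ^+ 2 = 2 * t ^+ 2 + 2 * u ^+ 2 - (t + u) ^+ 2 by ring.
have := sqr_ge0 (t + u); have : 17 * p <= p ^+ 2 by rewrite expr2 ler_wpM2r //; lia.
by lia.
Qed.

Lemma mod4_of_dvdz (p : nat) : (4 %| p%:Z + 1)%Z -> p = 3 %[mod 4].
Proof. by lia. Qed.

(** With [t = 2 sqrt q cos u] the cubic is [2 q sqrt q cos (3 u)]; the factorisation below is the
    corresponding identity for [sin^2]. *)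
Lemma cubic_trace_bound (q t : int) : t ^+ 2 <= 4 * q ->
  (t ^+ 3 - 3 * q * t) ^+ 2 <= 4 * q ^+ 3.
Proof.
move=> t4; rewrite -subr_ge0.
have -> : 4 * q ^+ 3 - (t ^+ 3 - 3 * q * t) ^+ 2 = (4 * q - t ^+ 2) * (t ^+ 2 - q) ^+ 2 by ring.
by rewrite mulr_ge0 ?sqr_ge0 // subr_ge0.
Qed.

Theorem theorem10 (p : nat) (p_prime : prime p) (p_ge3 : (3 <= p)%N)
  (alpha1 alpha2 : 'F_p) (alpha1_neq0 : alpha1 != 0) (alpha2_neq0 : alpha2 != 0)
  (a1 a2 a3 a4 a5 a6 b5 b6 : 'F_p)
  (distinct : uniq [:: a1; a2; a3; a4; a5; a6; b5; b6])
  (rel_a : (a2 - a4) * (a1 - a6) * (a3 - a5) = (a2 - a6) * (a1 - a5) * (a3 - a4))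
  (rel_b : (a2 - a4) * (a1 - b6) * (a3 - b5) = (a2 - b6) * (a1 - b5) * (a3 - a4))
  (square_a : exists2 r : 'F_p, r != 0 &
     (a1 - a2) * (a2 - a4) * (a4 - a5) * (a5 - a1) = r ^+ 2)
  (square_b : exists2 r : 'F_p, r != 0 &
     (a1 - a2) * (a2 - a4) * (a4 - b5) * (b5 - a1) = r ^+ 2) :
  let m := (p.-1)./2 in
  let f1 : {poly 'F_p} :=
    alpha1 *: \prod_(r <- [:: a1; a2; a3; a4; a5; a6]) ('X - r%:P) in
  let f2 : {poly 'F_p} :=
    alpha2 *: \prod_(r <- [:: a1; a2; a3; a4; b5; b6]) ('X - r%:P) in
  let a := ((a1 - a3) * (a2 - a4)) / ((a2 - a3) * (a1 - a4)) in
  let b := ((a1 - a3) * (a2 - a5)) / ((a2 - a3) * (a1 - a5)) in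
  let c := ((a1 - a3) * (a2 - b5)) / ((a2 - a3) * (a1 - b5)) in
  let beta1 := alpha1 * (a2 - a3) * (a1 - a4) * (a1 - a5) * (a1 - a6) in
  let beta2 := alpha2 * (a2 - a3) * (a1 - a4) * (a1 - b5) * (a1 - b6) in
  forall (s t : 'F_p), s ^+ 2 = a ^+ 2 - a * b -> t ^+ 2 = a ^+ 2 - a * c ->
  let theta : 5.-tuple 'F_p :=
    [tuple beta1 * (1 - b) / (1 - a);
           beta1 * (1 - b) / (1 - a);
           beta2 * (1 - c) / (1 - a);
           beta2 * (1 - c) / (1 - a);
           alpha1 * alpha2 * (a5 - b6) * (a6 - b5)] in
  let lambda : 5.-tuple 'F_p :=
    [tuple (1 - a) * (b - 2 * a + 2 * s) / (b - 1);
           (1 - a) * (b - 2 * a - 2 * s) / (b - 1);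
           (1 - a) * (c - 2 * a + 2 * t) / (c - 1);
           (1 - a) * (c - 2 * a - 2 * t) / (c - 1);
           ((a5 - b5) * (a6 - b6)) / ((a5 - b6) * (a6 - b5))] in
  [/\ (17 <= p)%N ->
        forall C : fibre_product f1 f2,
        attains_Serre_bound 5 (constants C) <->
        forall i : 'I_5,
          (- tnth theta i) ^+ m * (H_poly p).[tnth lambda i]
          = - (Num.floor (2 * sqrtC p%:R : algC))%:~R,
      forall (F : finFieldType) (phi : {rmorphism 'F_p -> F})
             (C : fibre_product (map_poly phi f1) (map_poly phi f2)),
        #|F| = (p ^ 2)%N ->
        (maximal_curve 5 (constants C) <->
         forall i : 'I_5, (H_poly p).[tnth lambda i] = 0) /\
        (maximal_curve 5 (constants C) -> p = 3 %[mod 4]),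
      (11 <= p)%N ->
        forall h : 'I_5 -> int,
        (forall i : 'I_5, 0 <= h i < p%:Z /\
           (h i)%:~R = (- tnth theta i) ^+ m * (H_poly p).[tnth lambda i]) ->
        forall (F : finFieldType) (phi : {rmorphism 'F_p -> F})
               (C : fibre_product (map_poly phi f1) (map_poly phi f2)),
        #|F| = (p ^ 3)%N ->
        (attains_Serre_bound 5 (constants C) <->
         forall i : 'I_5,
           h i ^+ 3 - 3 * p%:Z * h i
           = - Num.floor (2 * p%:R * sqrtC p%:R : algC)) &
      forall (F : finFieldType) (phi : {rmorphism 'F_p -> F})
             (C : fibre_product (map_poly phi f1) (map_poly phi f2)) (k : nat),
        (0 < k)%N -> #|F| = (p ^ k)%N ->
        exists2 N : nat, num_points (constants C) N & (4 %| N)%N].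
Proof.
move=> m f1 f2 a b c beta1 beta2 s t hs ht theta lambda.
(* The branch points are eight distinct elements of the field. *)
have p_ge8 : (8 <= p)%N.
  rewrite -(card_Fp p_prime) -[8%N]/(size [:: a1; a2; a3; a4; a5; a6; b5; b6]).
  by rewrite -(card_uniqP distinct) max_card.
have p_gt3 : (3 < p)%N by lia.
have p_odd : odd p by case/even_prime: p_prime p_ge3 => [->|].
have cp := card_Fp p_prime.
have oddp : odd #|{: 'F_p}| by rewrite cp.
have dist_a : uniq [:: a1; a2; a3; a4; a5; a6].
  by apply: subseq_uniq distinct; exact: (@prefix_subseq _ _ [:: b5; b6]).
have dist_b : uniq [:: a1; a2; a3; a4; b5; b6].
  apply: subseq_uniq distinct; apply: (@cat_subseq _ [:: a1; a2; a3; a4] _ [:: a1; a2; a3; a4]) => //.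
  exact: (@suffix_subseq _ [:: a5; a6]).
have [[a_0 a_1 b_0 b_1] [_ hab _]] := sextic_params hs dist_a rel_a.
have [[_ _ c_0 c_1] [_ hac _]] := sextic_params ht dist_b rel_b.
have nz (x y : 'F_p) : x != y -> x - y != 0 by rewrite subr_eq0.
have [d23 d14 d15 d16] : [/\ a2 != a3, a1 != a4, a1 != a5 & a1 != a6].
  by move: dist_a; rewrite /= !inE !negb_or -!andbA; repeat case/andP => ?; split.
have [d15' d16'] : a1 != b5 /\ a1 != b6.
  by move: dist_b; rewrite /= !inE !negb_or -!andbA; repeat case/andP => ?; split.
have [e55 e56 e65 e66 [e5 e6]] : [/\ a5 != b5, a5 != b6, a6 != b5, a6 != b6 & a5 != a6 /\ b5 != b6].
  by move: distinct; rewrite /= !inE !negb_or -!andbA; repeat case/andP => ?; split.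
have param_neq i : [/\ tnth theta i != 0, tnth lambda i != 0 & tnth lambda i != 1].
  have hs' : (- s) ^+ 2 = a ^+ 2 - a * b by rewrite sqrrN.
  have ht' : (- t) ^+ 2 = a ^+ 2 - a * c by rewrite sqrrN.
  have a1' : 1 - a != 0 by rewrite nz // eq_sym.
  have b1' : 1 - b != 0 by rewrite nz // eq_sym.
  have c1' : 1 - c != 0 by rewrite nz // eq_sym.
  have th1 : beta1 * (1 - b) / (1 - a) != 0 by rewrite !mulf_neq0 ?invr_eq0 // nz.
  have th2 : beta2 * (1 - c) / (1 - a) != 0 by rewrite !mulf_neq0 ?invr_eq0 // nz.
  have [l1 l1'] := legendre_param_neq a_0 a_1 b_0 b_1 hab hs.
  have [l2 l2'] := legendre_param_neq a_0 a_1 b_0 b_1 hab hs'.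
  have [l3 l3'] := legendre_param_neq a_0 a_1 c_0 c_1 hac ht.
  have [l4 l4'] := legendre_param_neq a_0 a_1 c_0 c_1 hac ht'.
  rewrite mulrN in l2 l2'; rewrite mulrN in l4 l4'.
  case: i => -[|[|[|[|[|//]]]]] i5; rewrite !(tnth_nth 0) /=; split; try assumption.
  - by rewrite !mulf_neq0 ?nz.
  - by rewrite !mulf_neq0 ?invr_eq0 ?mulf_neq0 ?nz.
  rewrite -subr_eq0 (_ : _ - 1 = ((a5 - a6) * (b5 - b6)) / ((a5 - b6) * (a6 - b5))).
    by rewrite !mulf_neq0 ?invr_eq0 ?mulf_neq0 ?nz.
  by apply: legendre_param_quartic; rewrite nz.
have count (F : finFieldType) (phi : {rmorphism 'F_p -> F})
    (C : fibre_product (map_poly phi f1) (map_poly phi f2)) : odd #|F| ->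
  exists2 N, num_points (constants C) N &
    N%:Z = #|F|%:Z + 1 + \sum_i legendre_sum (phi (tnth theta i)) (phi (tnth lambda i)).
  move=> oF; have [N hN NE] := curve_num_points_map oF alpha1_neq0 alpha2_neq0 distinct rel_a rel_b hs ht C.
  by exists N => //; rewrite NE !big_ord_recl big_ord0 !(tnth_nth 0) /= addr0 !addrA.
pose T i := legendre_sum (tnth theta i) (tnth lambda i).
have T_hasse i : T i ^+ 2 <= 4 * p%:Z.
  by have [th0 l0 l1] := param_neq i; exact: legendre_sum_hasse.
have T_mod i : (T i)%:~R = - ((- tnth theta i) ^+ m * (H_poly p).[tnth lambda i]).
  exact: legendre_sum_mod.
have T_dvd4 i : (4 %| p%:Z + 1 + T i)%Z.
  by have [th0 l0 l1] := param_neq i; have := dvd4_legendre_sum oddp th0 l0 l1; rewrite cp.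
have pZ : 8 <= p%:Z by [].
split.
- move=> p17 C; have [N hN NE] : exists2 N, num_points (constants C) N & N%:Z = #|{: 'F_p}|%:Z + 1 + \sum_i T i.
    by have := count 'F_p idfun; rewrite !map_poly_id //; apply.
  apply: iff_trans (attains_Serre_bound_iff hN NE _) _; first by move=> i; rewrite cp.
  rewrite cp; have [] := floor_two_sqrt p; move: (Num.floor _) => M _ M1 _.
  split=> h i; first by rewrite -(h i) T_mod opprK.
  apply: (@congruent_eq p%:Z); [exact: lt_le_trans pZ|exact: hasse_difference|].
  by apply: (intr_Fp_eq p_prime); rewrite T_mod h opprK.
- move=> F phi C cF.
  have oF : odd #|F| by rewrite cF oddX p_odd orbT.
  have cF' : #|F| = (#|{: 'F_p}| ^ 2)%N by rewrite cp.
  have [N hN NE] := count F phi C oF.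
  pose U i := 2 * p%:Z - T i ^+ 2.
  have {}NE : N%:Z = #|F|%:Z + 1 + \sum_i U i.
    rewrite NE; congr (_ + _); apply: eq_bigr => i _; have [th0 l0 l1] := param_neq i.
    by rewrite (legendre_sum_quadratic phi oddp cF' th0 l0 l1) cp.
  have UM i : U i <= 2 * p%:Z by rewrite /U gerBl sqr_ge0.
  have max0 : maximal_curve 5 (constants C) <-> forall i, T i = 0.
    apply: iff_trans (maximal_curve_iff hN NE cF UM) _; split=> h i; last first.
      by rewrite /U h expr0n subr0.
    by apply/eqP; rewrite -sqrf_eq0 -oppr_eq0 -(inj_eq (addrI (2 * p%:Z))) addr0; apply/eqP; exact: h.
  split.
    apply: iff_trans max0 _; split=> h i.
      have := T_mod i; rewrite h => /esym/eqP; rewrite oppr_eq0 mulf_eq0 expf_eq0 oppr_eq0.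
      by have [/negbTE -> _ _] := param_neq i; rewrite andbF => /eqP.
    (* A trace divisible by [p] is 0, because [4 p < p^2]. *)
    apply: (@congruent_eq p%:Z); first exact: lt_le_trans pZ.
      by rewrite subr0; apply: le_lt_trans (T_hasse i) _; rewrite expr2 ltr_pM2r; apply: lt_le_trans pZ.
    by apply: (intr_Fp_eq p_prime); rewrite T_mod h mulr0 oppr0.
  (* With a vanishing trace, divisibility by four of [p + 1 + T] becomes a condition on [p]
     alone. *)
  move/max0 => h; have := T_dvd4 ord0; rewrite h addr0; exact: mod4_of_dvdz.
- move=> p11 h hh F phi C cF.
  have oF : odd #|F| by rewrite cF oddX p_odd orbT.
  have cF' : #|F| = (#|{: 'F_p}| ^ 3)%N by rewrite cp.
  have [N hN NE] := count F phi C oF.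
  pose U i := T i ^+ 3 - 3 * p%:Z * T i.
  have {}NE : N%:Z = #|F|%:Z + 1 + \sum_i U i.
    rewrite NE; congr (_ + _); apply: eq_bigr => i _; have [th0 l0 l1] := param_neq i.
    by rewrite (legendre_sum_cubic phi oddp cF' th0 l0 l1) cp.
  have pX : #|F|%:Z = p%:Z ^+ 3 by rewrite cF -!natz natrX.
  apply: iff_trans (attains_Serre_bound_iff hN NE _) _.
    by move=> i; rewrite pX; apply: cubic_trace_bound.
  have -> : Num.floor (2 * p%:R * sqrtC p%:R : algC) = Num.floor (2 * sqrtC #|F|%:R : algC).
    by rewrite cF floor_two_mul_sqrt.
  have [] := floor_two_sqrt #|F|; rewrite pX; move: (Num.floor _) => M M0 M1 M2.
  have aux i : U i = M <-> h i ^+ 3 - 3 * p%:Z * h i = - M.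
    have [h0 hE] := hh i.
    (* [h i] represents [- T i] modulo [p], and the cubic is odd, whence the minus sign before the
       floor. *)
    apply: iff_trans (@cube_trace_min p%:Z (- T i) (h i) M _ M0 M1 M2 _ _ h0 _).
    + rewrite (_ : (- T i) ^+ 3 - 3 * p%:Z * - T i = - U i); last by rewrite /U; ring.
      by split=> [->|/oppr_inj].
    + by [].
    + by rewrite sqrrN.
    + by rewrite sqrrN sqr_neq_4prime.
    + by apply: (intr_Fp_eq p_prime); rewrite hE mulrNz T_mod opprK.
  by split=> H i; apply/aux.
move=> F phi C k k0 cF.
have oF : odd #|F| by rewrite cF oddX p_odd orbT.
have [N hN NE] := count F phi C oF; exists N => //.
have h i : (4 %| #|F|%:Z + 1 + legendre_sum (phi (tnth theta i)) (phi (tnth lambda i)))%Z.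
  have [th0 l0 l1] := param_neq i; apply: dvd4_legendre_sum => //; rewrite ?fmorph_eq0 //.
  by rewrite -(rmorph1 phi) (inj_eq (fmorph_inj phi)).
have : (4 %| \sum_(i < 5) (#|F|%:Z + 1 + legendre_sum (phi (tnth theta i)) (phi (tnth lambda i))))%Z.
  by apply: rpred_sum => i _; exact: h.
rewrite big_split /= sumr_const card_ord => h4.
have -> : (4 %| N)%N = (4 %| N%:Z)%Z by [].
(* The five elliptic counts [q + 1 + T_i] add up to [N + 4 (q + 1)]. *)
rewrite NE; have -> : #|F|%:Z + 1 + \sum_i legendre_sum (phi (tnth theta i)) (phi (tnth lambda i)) =
  (#|F|%:Z + 1) *+ 5 + \sum_i legendre_sum (phi (tnth theta i)) (phi (tnth lambda i)) - (#|F|%:Z + 1) *+ 4.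
  by rewrite mulrSr; ring.
by apply: rpredB => //; apply/dvdzP; exists (#|F|%:Z + 1); rewrite -[LHS]mulr_natr; congr (_ * _).
Qed.
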